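(* Let $a>0$ and $N\ge 2$ be real numbers and let $g\in V_{N,a}$. Let $m\ge 3$ be an integer and let $b>0$ be such that $(a,b)\in T_m$. Then the Gabor system $\mathcal{G}(g,a,b)$ is a frame for $L^2(\mathbb{R})$, and there is a unique dual window $h\in L^2(\mathbb{R})$ such that $\operatorname{supp} h\subseteq \left[-\frac{2m-1}{2}a,\frac{2m-1}{2}a\right]$.
   Context: For $g\in L^2(\mathbb{R})$ and $a,b>0$, the Gabor system is $\mathcal{G}(g,a,b)=\{M_{\ell b}T_{ka}g=e^{2\pi i \ell b\,\cdot}g(\cdot-ka):(\ell,k)\in\mathbb{Z}^2\}$. It is a (Gabor) frame for $L^2(\mathbb{R})$ if there exist $A,B>0$ such that $A\|f\|_2^2\le \sum_{\ell,k\in\mathbb{Z}}|\langle f,M_{\ell b}T_{ka}g\rangle|^2\le B\|f\|_2^2$ for all $f\in L^2(\mathbb{R})$. A function $h\in L^2(\mathbb{R})$ is a dual window of $g$ (for the parameters $a,b$) if $\mathcal{G}(g,a,b)$ and $\mathcal{G}(h,a,b)$ are dual frames, i.e. both are frames (equivalently, Bessel sequences) and $f=\sum_{k,\ell\in\mathbb{Z}}\langle f,M_{\ell b}T_{ka}h\rangle M_{\ell b}T_{ka}g=\sum_{k,\ell\in\mathbb{Z}}\langle f,M_{\ell b}T_{ka}g\rangle M_{\ell b}T_{ka}h$ for all $f\in L^2(\mathbb{R})$. $V_{N,a}$ is the set of continuous real-valued functions $g:\mathbb{R}\to\mathbb{R}$ with $\operatorname{supp} g=[-\frac N2,\frac N2]$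 such that: (A1) $g$ is symmetric around the origin; (A2) $g$ is strictly increasing on $[-\frac N2,0]$; (A3) with $\Delta_a^2 g(x)=g(x)-2g(x-a)+g(x-2a)$: if $a<\frac N3$ then $\Delta_a^2g(x)\ge 0$ for $x\in[-\frac N2,-\frac N4+\frac{3a}{4}]$, and if $a\ge\frac N3$ then $\Delta_a^2g(x)\ge0$ for $x\in[-\frac N2,0]\cup\{-\frac N4+\frac{3a}4\}$. For an integer $m\ge2$, $T_m=\left\{(a,b)\in\mathbb{R}_+^2: a\in\left(\frac{N(m-2)}{2m-3},\frac N2\right),\ b\in\left(\frac{2(m-1)}{N+(2m-3)a},\frac{2m}{N+(2m-1)a}\right],\ b<\frac2N\right\}$. *)

(* Defs.v *)
From HB Require Import structures.
From mathcomp Require Import all_boot all_order all_algebra finmap.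
From mathcomp Require Import complex.
From mathcomp Require Import all_classical all_reals all_analysis.
From mathcomp Require Import showcase.summability.

Set Implicit Arguments.
Unset Strict Implicit.
Unset Printing Implicit Defensive.
Import Order.TTheory GRing.Theory Num.Theory.
Import numFieldNormedType.Exports.

Local Open Scope classical_set_scope.
Local Open Scope ring_scope.
Local Open Scope complex_scope.

(* Elements of L^2(R; C) are represented by Borel measurable functions
   R -> R[i]; two such functions denote the same element when they agree
   Lebesgue-almost everywhere. *)
Section L2.
Context {R : realType}.
Local Notation mu := (@lebesgue_measure R).
Implicit Types f g : R -> R[i].

Definition L2norm f : \bar R := Lnorm mu 2%:E (fun x => (Normc.normc (f x))%:E).

Definition L2 f : Prop :=
  [/\ measurable_fun setT (fun x => complex.Re (f x)),
      measurable_fun setT (fun x => complex.Im (f x)) &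
      (L2norm f < +oo)%E].

Definition inner f g : R[i] :=
  (\int[mu]_x complex.Re (f x * (g x)^*)) +i* (\int[mu]_x complex.Im (f x * (g x)^*)).

(* The support of an element of L^2: it depends only on the a.e. class. *)
Definition ess_supp f : set R :=
  ~` [set x | exists2 U : set R, nbhs x U & {ae mu, forall y, U y -> f y = 0}].

End L2.

Section Frames.
Context {R : realType} {I : choiceType}.
Implicit Types (e : I -> R -> R[i]) (f : R -> R[i]).

Definition is_frame e : Prop :=
  (forall i, L2 (e i)) /\
  exists A B : R, [/\ 0 < A, 0 < B & forall f, L2 f ->
    (A%:E * L2norm f ^+ 2 <=
       \esum_(i in setT) ((Normc.normc (inner f (e i)) ^+ 2)%:E) /\
     \esum_(i in setT) ((Normc.normc (inner f (e i)) ^+ 2)%:E) <=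
       B%:E * L2norm f ^+ 2)%E].

(* f = \sum_i c i * e i, converging unconditionally in the L^2-norm. *)
Definition L2_expansion f (c : I -> R[i]) e : Prop :=
  L2norm (fun x => f x - \sum_(i <- S) c i * e i x) @[S --> totally] --> 0%E.

Definition dual_frames e e' : Prop :=
  [/\ is_frame e, is_frame e' & forall f, L2 f ->
     L2_expansion f (fun i => inner f (e' i)) e /\
     L2_expansion f (fun i => inner f (e i)) e'].

End Frames.

Section Gabor.
Context {R : realType}.
Implicit Types (a b : R) (g h : R -> R[i]).

Definition translation (s : R) g : R -> R[i] := fun x => g (x - s).

Definition modulation (nu : R) g : R -> R[i] :=
  fun x => (cos (2 * pi * nu * x) +i* sin (2 * pi * nu * x)) * g x.

(* The element of index (l, k) is M_{l b} T_{k a} g. *)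
Definition gabor g a b (lk : int * int) : R -> R[i] :=
  modulation (lk.1%:~R * b) (translation (lk.2%:~R * a) g).

Definition dual_window g a b h : Prop :=
  L2 h /\ dual_frames (gabor g a b) (gabor h a b).

End Gabor.

Section Windows.
Context {R : realType}.
Implicit Types (N a x : R) (g : R -> R).

Definition Delta2 a g x : R := g x - 2 * g (x - a) + g (x - 2 * a).

Definition V_window N a g : Prop :=
  [/\ continuous g,
      closure [set x | g x != 0] = `[- (N / 2), N / 2]%classic,
      (forall x, g (- x) = g x),
      {in `[- (N / 2), 0] &, {homo g : x y / x < y}} &
      (a < N / 3 ->
         forall x, x \in `[- (N / 2), - (N / 4) + 3 * a / 4] ->
           0 <= Delta2 a g x) /\
      (N / 3 <= a ->
         (forall x, x \in `[- (N / 2), 0] -> 0 <= Delta2 a g x) /\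
         0 <= Delta2 a g (- (N / 4) + 3 * a / 4))].

Definition T_region N (m : nat) : set (R * R) :=
  [set ab | let: (a, b) := ab in
    [/\ 0 < a, 0 < b,
        N * (m%:R - 2) / (2 * m%:R - 3) < a < N / 2,
        2 * (m%:R - 1) / (N + (2 * m%:R - 3) * a) < b
          <= 2 * m%:R / (N + (2 * m%:R - 1) * a) &
        b < 2 / N]].

End Windows.

(* Main.v *)
From mathcomp Require Import all_boot all_order all_algebra finmap.
From mathcomp Require Import complex ring lra zify.
From mathcomp Require Import all_classical all_reals all_analysis.
From mathcomp Require Import showcase.summability.
From mathcomp Require Import measurable_realfun.
Require Import Defs.

(** Write T = 1 / b and m = m0 + 1. The proof rests on the duality conditions of Ron
    and Shen: for bounded windows g and h of bounded support, h is a dual window of g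
    if and only if, for almost every x and all integers j,

      sum over k of g (x + j T - k a) * conj (h (x - k a)) = b if j = 0, else 0.

    They come out of the Gabor series as follows. On a cell of length T the
    modulations form a Fourier system, so that for fixed k the sum over l of
    <f, M_(l b) T_(k a) h> conj <v, M_(l b) T_(k a) g> is, by Parseval's identity
    (fourier_reconstruction), an integral over the cell (janssen); when f lives on
    one cell only finitely many k occur, and exchanging the sums over k and j leaves
    the left-hand sides above. If the conditions hold, this yields the
    reconstruction formula tested against v, for f on one cell
    (weak_expansion_cell) and then for all f because both systems are Bessel
    (gabor_bessel, weak_expansion_closed). For Bessel systems the tested formula is
    enough: it gives lower frame bounds by Cauchy--Schwarz (weak_expansion_frame) and
    convergence in norm (weak_expansion_L2); see duality_dual_frames. Conversely,
    testing with indicator functions recovers the conditions almost everywhere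
    (duality_ae_cell).

    Parseval's identity is the completeness of the exponentials on a cell. The
    polynomials (1 - w ^ n) ^ (2 ^ n) tend to 1 for w < 1/2 and to 0 for w > 1/2;
    inserting a trigonometric polynomial that crosses 1/2 at a prescribed point
    approximates the indicators of intervals, and a Dynkin class argument followed
    by approximation with simple functions reaches every square-integrable function.

    It remains to solve the duality conditions for h supported in
    [- (m0 + 1/2) a, (m0 + 1/2) a]. For x in the fundamental domain [- a/2, a/2[ the
    unknowns are h (x - k a) with |k| <= m0. The parameter region makes the
    conditions with |j| > m0 void and leaves a square system whose matrix has the
    entries g (x + j T - k a). As T > N/2, a column of this matrix contains at most
    the diagonal entry and its two neighbours. If W times the matrix vanishes and
    W <> 0, choose n with W n <> 0 and y = x + n (T - a) closest to the origin, say
    y > 0. The entry g (y + T) is zero, so the column of n forces W (n - 1) <> 0,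
    and minimality puts y - (T - a) on the negative side, below - y. The columns of n
    and n - 1 then restrict to a 2 x 2 system with determinant
    g y * g (y - (T - a)) - g (y + a) * g (y - T), which is positive because g is
    even and decreases away from the origin (kernel_positive). Hence the matrix is
    invertible; Cramer's rule gives a bounded measurable solution (dual_fun), which
    is the dual window, and uniqueness of the solution for almost every x gives
    uniqueness of the dual window. *)

Set Implicit Arguments.
Unset Strict Implicit.
Unset Printing Implicit Defensive.
Import Order.TTheory GRing.Theory Num.Theory.
Import numFieldNormedType.Exports.
Local Open Scope classical_set_scope.
Local Open Scope complex_scope.
Local Open Scope ring_scope.

(** * Squared modulus *)

Section SquaredModulus.
Context {R : realType}.
Implicit Types (z w : R[i]).

Definition sqn z : R := complex.Re z ^+ 2 + complex.Im z ^+ 2.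

Lemma sqn_ge0 z : 0 <= sqn z.
Proof. by rewrite addr_ge0 ?sqr_ge0. Qed.

Lemma sqn0 : sqn 0 = 0.
Proof. by rewrite /sqn /=; ring. Qed.

Lemma sqn_eq0 z : sqn z = 0 -> z = 0.
Proof.
case: z => x y /eqP; rewrite /sqn /= paddr_eq0 ?sqr_ge0// !sqrf_eq0.
by case/andP => /eqP -> /eqP ->.
Qed.

Lemma sqnM z w : sqn (z * w) = sqn z * sqn w.
Proof. by case: z w => [x y] [u v]; rewrite /sqn /=; ring. Qed.

Lemma sqn_conj z : sqn z^* = sqn z.
Proof. by case: z => x y; rewrite /sqn /= sqrrN. Qed.

Lemma sqnN z : sqn (- z) = sqn z.
Proof. by case: z => x y; rewrite /sqn /= !sqrrN. Qed.

Lemma sqn_real (x : R) : sqn x%:C = x ^+ 2.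
Proof. by rewrite /sqn /=; ring. Qed.

Lemma normc_sqr z : Normc.normc z ^+ 2 = sqn z.
Proof. by case: z => x y; rewrite /sqn /= sqr_sqrtr // addr_ge0 ?sqr_ge0. Qed.

Lemma mulc_conj z : z * z^* = (sqn z)%:C.
Proof. by case: z => x y; apply/eqP; rewrite /sqn eq_complex /=; apply/andP; split; apply/eqP; ring. Qed.

Lemma sqnD_le z w : sqn (z + w) <= 2 * sqn z + 2 * sqn w.
Proof.
case: z w => [x y] [u v]; rewrite /sqn /=.
have := sqr_ge0 (x - u); have := sqr_ge0 (y - v); nra.
Qed.

Lemma sqnB_le z w : sqn (z - w) <= 2 * sqn z + 2 * sqn w.
Proof. by rewrite -(sqnN w) sqnD_le. Qed.

Lemma conj_sum (I : Type) (s : seq I) (P : pred I) (F : I -> R[i]) :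
  (\sum_(i <- s | P i) F i)^* = \sum_(i <- s | P i) (F i)^*.
Proof. exact: raddf_sum. Qed.

Lemma conjM z w : (z * w)^* = z^* * w^*.
Proof. exact: rmorphM. Qed.

Lemma conj_realc (x : R) : (x%:C)^* = x%:C.
Proof. exact: conjc_real. Qed.

Lemma Re_sum (I : Type) (s : seq I) (P : pred I) (F : I -> R[i]) :
  complex.Re (\sum_(i <- s | P i) F i) = \sum_(i <- s | P i) complex.Re (F i).
Proof. by elim/big_rec2: _ => // i x z _ <-; case: (F i) z => [? ?] [? ?]. Qed.

Lemma Im_sum (I : Type) (s : seq I) (P : pred I) (F : I -> R[i]) :
  complex.Im (\sum_(i <- s | P i) F i) = \sum_(i <- s | P i) complex.Im (F i).
Proof. by elim/big_rec2: _ => // i x z _ <-; case: (F i) z => [? ?] [? ?]. Qed.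

(** By induction: with A and B the sums of the squared moduli so far and Z the sum
    of the products, the new cross term is at most 2 |a_i| |b_i| |Z|, hence at most
    2 |a_i| |b_i| sqrt(A B), which |a_i|^2 B + A |b_i|^2 bounds. *)
Lemma sum_CauchySchwarz (I : Type) (s : seq I) (P : pred I) (a b : I -> R[i]) :
  sqn (\sum_(i <- s | P i) a i * b i) <=
    (\sum_(i <- s | P i) sqn (a i)) * (\sum_(i <- s | P i) sqn (b i)).
Proof.
elim: s => [|i s IH]; first by rewrite !big_nil sqn0 mul0r.
rewrite !big_cons; case: (P i) => //.
set A := \sum_(j <- s | P j) sqn (a j) in IH *.
set B := \sum_(j <- s | P j) sqn (b j) in IH *.
set Z := \sum_(j <- s | P j) a j * b j in IH *.
have A0 : 0 <= A by apply: sumr_ge0 => j _; exact: sqn_ge0.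
have B0 : 0 <= B by apply: sumr_ge0 => j _; exact: sqn_ge0.
move: (a i) (b i) => [x y] [u v]; move: Z IH => [p q]; rewrite /sqn /= => IH.
set X := x * u - y * v; set Y := x * v + y * u.
have XY : X ^+ 2 + Y ^+ 2 = (x ^+ 2 + y ^+ 2) * (u ^+ 2 + v ^+ 2) by rewrite /X /Y; ring.
set al := x ^+ 2 + y ^+ 2 in XY *; set be := u ^+ 2 + v ^+ 2 in XY *.
have al0 : 0 <= al by rewrite addr_ge0 ?sqr_ge0.
have be0 : 0 <= be by rewrite addr_ge0 ?sqr_ge0.
have key : 2 * (X * p + Y * q) <= al * B + A * be.
  have h1 : (X * p + Y * q) ^+ 2 <= (al * be) * (A * B).
    rewrite -XY; apply: (@le_trans _ _ ((X ^+ 2 + Y ^+ 2) * (p ^+ 2 + q ^+ 2))).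
      by have := sqr_ge0 (X * q - Y * p); lra.
    by apply: ler_wpM2l => //; rewrite addr_ge0 ?sqr_ge0.
  have h2 : (2 * (X * p + Y * q)) ^+ 2 <= (al * B + A * be) ^+ 2.
    by have := sqr_ge0 (al * B - A * be); lra.
  rewrite leNgt; apply/negP => h3.
  have h4 : 0 <= al * B + A * be by rewrite addr_ge0 ?mulr_ge0.
  by move: h2; rewrite leNgt ltr_pXn2r ?nnegrE// ?h3// (le_trans h4 (ltW h3)).
lra.
Qed.

End SquaredModulus.

(** * Measurable complex functions *)

Section ComplexMeasurable.
Context {R : realType}.
Implicit Types (f g : R -> R[i]).

Definition cmeas f : Prop :=
  measurable_fun setT (fun x => complex.Re (f x)) /\
  measurable_fun setT (fun x => complex.Im (f x)).

Lemma cmeasD f g : cmeas f -> cmeas g -> cmeas (fun x => f x + g x).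
Proof.
move=> [f1 f2] [g1 g2]; split.
  rewrite [X in measurable_fun _ X](_ : _ = (fun x => complex.Re (f x)) \+ (fun x => complex.Re (g x))).
    exact: measurable_funD.
  by apply/funext => x /=; case: (f x) (g x) => [? ?] [? ?].
rewrite [X in measurable_fun _ X](_ : _ = (fun x => complex.Im (f x)) \+ (fun x => complex.Im (g x))).
  exact: measurable_funD.
by apply/funext => x /=; case: (f x) (g x) => [? ?] [? ?].
Qed.

Lemma cmeasM f g : cmeas f -> cmeas g -> cmeas (fun x => f x * g x).
Proof.
move=> [f1 f2] [g1 g2]; split.
  rewrite [X in measurable_fun _ X](_ : _ =
    ((fun x => complex.Re (f x)) \* (fun x => complex.Re (g x))) \-
    ((fun x => complex.Im (f x)) \* (fun x => complex.Im (g x)))).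
    by apply: measurable_funB; exact: measurable_funM.
  by apply/funext => x /=; case: (f x) (g x) => [? ?] [? ?].
rewrite [X in measurable_fun _ X](_ : _ =
  ((fun x => complex.Re (f x)) \* (fun x => complex.Im (g x))) \+
  ((fun x => complex.Im (f x)) \* (fun x => complex.Re (g x)))).
  by apply: measurable_funD; exact: measurable_funM.
by apply/funext => x /=; case: (f x) (g x) => [? ?] [? ?].
Qed.

Lemma cmeas_conj f : cmeas f -> cmeas (fun x => (f x)^*).
Proof.
move=> [f1 f2]; split.
  by rewrite [X in measurable_fun _ X](_ : _ = fun x => complex.Re (f x)) //; apply/funext => x; case: (f x).
rewrite [X in measurable_fun _ X](_ : _ = \- (fun x => complex.Im (f x))); last by apply/funext => x /=; case: (f x).
exact: measurable_funN.
Qed.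

Lemma cmeas_real (p : R -> R) : measurable_fun setT p -> cmeas (fun x => (p x)%:C).
Proof. by move=> mp; split => //=; exact: measurable_cst. Qed.

Lemma cmeas_cst z : cmeas (fun=> z).
Proof. by split; exact: measurable_cst. Qed.

Lemma cmeas_comp f (p : R -> R) : cmeas f -> measurable_fun setT p -> cmeas (f \o p).
Proof. by move=> [f1 f2] mp; split; [exact: measurableT_comp f1 mp|exact: measurableT_comp f2 mp]. Qed.

Lemma cmeas_sqn f : cmeas f -> measurable_fun setT (fun x => sqn (f x)).
Proof. by move=> [f1 f2]; apply: measurable_funD; exact: measurable_funX. Qed.

End ComplexMeasurable.

(** * Square-integrable functions and their inner product *)

Section SquareIntegrable.
Context {R : realType}.
Local Notation mu := (@lebesgue_measure R).
Implicit Types (f g u v : R -> R[i]) (p q : R -> R).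

Local Notation rint p := (mu.-integrable setT (EFin \o p)).

Lemma rintD p q : rint p -> rint q -> rint (fun x => p x + q x).
Proof.
move=> ip iq; have := integrableD measurableT ip iq.
by apply: eq_integrable => // x _ /=; rewrite EFinD.
Qed.

Lemma rintZ (k : R) p : rint p -> rint (fun x => k * p x).
Proof.
move=> ip; have := integrableZl measurableT k ip.
by apply: eq_integrable => // x _ /=; rewrite EFinM.
Qed.

Lemma rintB p q : rint p -> rint q -> rint (fun x => p x - q x).
Proof.
move=> ip iq; have := integrableB measurableT ip iq.
by apply: eq_integrable => // x _ /=; rewrite EFinB.
Qed.

Lemma rint_le p q : measurable_fun setT p -> (forall x, `|p x| <= q x) -> rint q -> rint p.
Proof.
move=> mp pq; apply: le_integrable => //; first exact/measurable_EFinP.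
by move=> x _ /=; rewrite lee_fin (le_trans (pq x))// ler_norm.
Qed.

Lemma rint_meas p : rint p -> measurable_fun setT p.
Proof. by move=> /measurable_int /measurable_EFinP. Qed.

Definition cintegrable u : Prop :=
  rint (fun x => complex.Re (u x)) /\ rint (fun x => complex.Im (u x)).

Definition cint u : R[i] :=
  (\int[mu]_x complex.Re (u x)) +i* (\int[mu]_x complex.Im (u x)).

Lemma cintegrableD u v : cintegrable u -> cintegrable v -> cintegrable (fun x => u x + v x).
Proof.
move=> [u1 u2] [v1 v2]; split.
  by apply: eq_integrable (rintD u1 v1) => // x _ /=; case: (u x) (v x) => [? ?] [? ?].
by apply: eq_integrable (rintD u2 v2) => // x _ /=; case: (u x) (v x) => [? ?] [? ?].
Qed.

Lemma cintegrableZ (c : R[i]) u : cintegrable u -> cintegrable (fun x => c * u x).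
Proof.
move=> [u1 u2]; case: c => c d; split.
  by apply: eq_integrable (rintB (rintZ c u1) (rintZ d u2)) => // x _ /=; case: (u x).
by apply: eq_integrable (rintD (rintZ c u2) (rintZ d u1)) => // x _ /=; case: (u x).
Qed.

Lemma eq_cint u v : u =1 v -> cint u = cint v.
Proof. by move=> /funext ->. Qed.

Lemma cintD u v : cintegrable u -> cintegrable v -> cint (fun x => u x + v x) = cint u + cint v.
Proof.
move=> [u1 u2] [v1 v2]; rewrite /cint.
have -> : \int[mu]_x complex.Re (u x + v x) = \int[mu]_x (complex.Re (u x) + complex.Re (v x)).
  by apply: eq_Rintegral => x _; case: (u x) (v x) => [? ?] [? ?].
have -> : \int[mu]_x complex.Im (u x + v x) = \int[mu]_x (complex.Im (u x) + complex.Im (v x)).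
  by apply: eq_Rintegral => x _; case: (u x) (v x) => [? ?] [? ?].
by rewrite !RintegralD.
Qed.

Lemma cintZ (c : R[i]) u : cintegrable u -> cint (fun x => c * u x) = c * cint u.
Proof.
move=> [u1 u2]; rewrite /cint; case: c => c d.
have -> : \int[mu]_x complex.Re ((c +i* d) * u x) =
    \int[mu]_x (c * complex.Re (u x) - d * complex.Im (u x)).
  by apply: eq_Rintegral => x _; case: (u x) => [? ?].
have -> : \int[mu]_x complex.Im ((c +i* d) * u x) =
    \int[mu]_x (c * complex.Im (u x) + d * complex.Re (u x)).
  by apply: eq_Rintegral => x _; case: (u x) => [? ?].
rewrite RintegralB ?RintegralD//; [|exact: rintZ..].
by rewrite !RintegralZl.
Qed.

Lemma cint0 : cint (fun=> 0) = 0.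
Proof. by rewrite /cint /Rintegral /= !integral0. Qed.

Lemma cint_sum (I : Type) (s : seq I) (F : I -> R -> R[i]) :
  (forall i, cintegrable (F i)) ->
  cintegrable (fun x => \sum_(i <- s) F i x) /\
  cint (fun x => \sum_(i <- s) F i x) = \sum_(i <- s) cint (F i).
Proof.
move=> iF; elim: s => [|i s [IH1 IH2]].
  rewrite big_nil (_ : (fun _ => _) = fun=> 0); last by apply/funext => x; rewrite big_nil.
  by rewrite cint0; split=> //; split; exact: integrable0.
rewrite big_cons (_ : (fun _ => _) = fun x => F i x + \sum_(j <- s) F j x); last first.
  by apply/funext => x; rewrite big_cons.
by split; [exact: cintegrableD|rewrite cintD// IH2].
Qed.

Lemma cint_conj u : cintegrable u -> cint (fun x => (u x)^*) = (cint u)^*.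
Proof.
move=> [_ u2]; rewrite /cint.
have -> : \int[mu]_x complex.Im (u x)^* = \int[mu]_x (-1 * complex.Im (u x)).
  by apply: eq_Rintegral => x _; case: (u x) => ? ? /=; rewrite mulN1r.
rewrite RintegralZl// mulN1r; congr (_ +i* _).
by apply: eq_Rintegral => x _; case: (u x).
Qed.

Lemma cint_real p : cint (fun x => (p x)%:C) = (\int[mu]_x p x)%:C.
Proof. by rewrite /cint /= /Rintegral integral0. Qed.

Lemma cintegrable_cmeas u : cintegrable u -> cmeas u.
Proof. by move=> [/rint_meas ? /rint_meas ?]. Qed.

Definition n2 f : R := \int[mu]_x sqn (f x).

Lemma n2_ge0 f : 0 <= n2 f.
Proof. by apply: Rintegral_ge0 => x _; exact: sqn_ge0. Qed.

Lemma integral_normc_sqr f :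
  (\int[mu]_x (`|(Normc.normc (f x))%:E| `^ 2))%E = (\int[mu]_x (sqn (f x))%:E)%E.
Proof.
apply: eq_integral => x _ /=.
by rewrite powR_mulrn ?normr_ge0// -normrX normc_sqr ger0_norm ?sqn_ge0.
Qed.

Lemma poweR_sqr (x : \bar R) : (0 <= x -> x `^ 2 = x ^+ 2)%E.
Proof.
case: x => [r| |] //=; first by rewrite lee_fin => r0; rewrite powR_mulrn// EFin_expe.
by rewrite pnatr_eq0 /= mulyy.
Qed.

Lemma L2norm_sqr f : (L2norm f ^+ 2 = \int[mu]_x (sqn (f x))%:E)%E.
Proof.
by rewrite -integral_normc_sqr -(@poweR_Lnorm _ _ _ mu _ 2) ?pnatr_eq0// poweR_sqr// Lnorm_ge0.
Qed.

Lemma L2P f : L2 f <-> cmeas f /\ rint (fun x => sqn (f x)).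
Proof.
have fin : cmeas f -> (L2norm f < +oo)%E <-> rint (fun x => sqn (f x)).
  move=> mf; have E := L2norm_sqr f; have L0 : (0 <= L2norm f)%E by exact: Lnorm_ge0.
  have {E}E : (L2norm f ^+ 2 = \int[mu]_x `|(sqn (f x))%:E|)%E.
    by rewrite E; apply: eq_integral => x _; rewrite gee0_abs// lee_fin sqn_ge0.
  split=> h.
    apply/integrableP; split; first by apply/measurable_EFinP; exact: cmeas_sqn.
    rewrite /= -E; move: h L0; case: (L2norm f) => //= r _ _; exact: ltry.
  move/integrableP : h => [_]; rewrite /= -E; move: L0.
  case: (L2norm f) => [r _ _|_|//]; first exact: ltry.
  by rewrite /= mulyy ltxx.
split; first by move=> [? ? ?]; have mf : cmeas f by []; split=> //; exact/fin.
by move=> [mf fi]; have [] := mf; split=> //; exact/fin.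
Qed.

Lemma L2_cmeas f : L2 f -> cmeas f.
Proof. by case/L2P. Qed.

Lemma L2_sqn f : L2 f -> rint (fun x => sqn (f x)).
Proof. by case/L2P. Qed.

Lemma L2norm_n2 f : L2 f -> (L2norm f ^+ 2 = (n2 f)%:E)%E.
Proof.
move=> /L2_sqn fi; rewrite L2norm_sqr /n2 /Rintegral fineK//.
exact: integrable_fin_num.
Qed.

Lemma L2D f g : L2 f -> L2 g -> L2 (fun x => f x + g x).
Proof.
move=> /L2P[mf fi] /L2P[mg gi]; apply/L2P; split; first exact: cmeasD.
apply: rint_le (rintD (rintZ 2 fi) (rintZ 2 gi)); first by apply: cmeas_sqn; exact: cmeasD.
by move=> x; rewrite ger0_norm ?sqn_ge0// sqnD_le.
Qed.

Lemma L2_mulb (M : R) f g : cmeas f -> (forall x, sqn (f x) <= M) -> L2 g -> L2 (fun x => f x * g x).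
Proof.
move=> mf fM /L2P[mg gi]; apply/L2P; split; first exact: cmeasM.
apply: rint_le (rintZ M gi); first by apply: cmeas_sqn; exact: cmeasM.
move=> x; rewrite ger0_norm ?sqn_ge0// sqnM; apply: ler_wpM2r => //; exact: sqn_ge0.
Qed.

Lemma L2Z (c : R[i]) f : L2 f -> L2 (fun x => c * f x).
Proof. by move=> lf; apply: (L2_mulb (cmeas_cst c) _ lf) => x; exact: lexx. Qed.

Lemma L2B f g : L2 f -> L2 g -> L2 (fun x => f x - g x).
Proof.
move=> lf lg; have := L2D lf (L2Z (-1) lg).
by rewrite (_ : (fun x => _ + -1 * g x) = fun x => f x - g x)//; apply/funext => x; rewrite mulN1r.
Qed.

Lemma L2_conj f : L2 f -> L2 (fun x => (f x)^*).
Proof.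
move=> /L2P[mf fi]; apply/L2P; split; first exact: cmeas_conj.
by apply: eq_integrable fi => // x _ /=; rewrite sqn_conj.
Qed.

Lemma L2_0 : L2 (fun=> 0 : R[i]).
Proof.
apply/L2P; split; first exact: cmeas_cst.
rewrite (_ : _ \o _ = cst 0%E); first exact: integrable0.
by apply/funext => x /=; rewrite sqn0.
Qed.

Lemma L2_sum (I : Type) (s : seq I) (F : I -> R -> R[i]) :
  (forall i, L2 (F i)) -> L2 (fun x => \sum_(i <- s) F i x).
Proof.
move=> lF; elim: s => [|i s IH].
  by rewrite (_ : (fun _ => _) = fun=> 0); [exact: L2_0|apply/funext => x; rewrite big_nil].
rewrite (_ : (fun _ => _) = fun x => F i x + \sum_(j <- s) F j x); last by apply/funext => x; rewrite big_cons.
exact: L2D.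
Qed.

Lemma L2_mul_cintegrable f g : L2 f -> L2 g -> cintegrable (fun x => f x * (g x)^*).
Proof.
move=> /L2P[mf fi] /L2P[mg gi]; have [m1 m2] := cmeasM mf (cmeas_conj mg).
split; apply: rint_le (rintD fi gi) => // x /=; case: (f x) (g x) => [a b] [c d];
  rewrite /sqn /= ler_norml.
  have := sqr_ge0 (a - c); have := sqr_ge0 (b - d); have := sqr_ge0 (a + c); have := sqr_ge0 (b + d).
  have := sqr_ge0 a; have := sqr_ge0 b; have := sqr_ge0 c; have := sqr_ge0 d.
  by move=> *; apply/andP; split; lra.
have := sqr_ge0 (a - d); have := sqr_ge0 (b - c); have := sqr_ge0 (a + d); have := sqr_ge0 (b + c).
have := sqr_ge0 a; have := sqr_ge0 b; have := sqr_ge0 c; have := sqr_ge0 d.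
by move=> *; apply/andP; split; lra.
Qed.

Lemma innerE f g : inner f g = cint (fun x => f x * (g x)^*).
Proof. by []. Qed.

Lemma innerDl f g v : L2 f -> L2 g -> L2 v ->
  inner (fun x => f x + g x) v = inner f v + inner g v.
Proof.
move=> lf lg lv; rewrite !innerE -cintD; [|exact: L2_mul_cintegrable..].
by apply: eq_cint => x; rewrite mulrDl.
Qed.

Lemma innerZl c f v : L2 f -> L2 v -> inner (fun x => c * f x) v = c * inner f v.
Proof.
move=> lf lv; rewrite !innerE -cintZ; last exact: L2_mul_cintegrable.
by apply: eq_cint => x; rewrite mulrA.
Qed.

Lemma innerBl f g v : L2 f -> L2 g -> L2 v ->
  inner (fun x => f x - g x) v = inner f v - inner g v.
Proof.
move=> lf lg lv; rewrite -mulN1r -innerZl// -innerDl//; last exact: L2Z.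
by congr inner; apply/funext => x; rewrite mulN1r.
Qed.

Lemma inner_conj f g : L2 f -> L2 g -> inner f g = (inner g f)^*.
Proof.
move=> lf lg; rewrite !innerE -cint_conj; last exact: L2_mul_cintegrable.
by apply: eq_cint => x /=; rewrite conjM conjCK mulrC.
Qed.

Lemma inner_suml (I : Type) (s : seq I) (F : I -> R -> R[i]) v :
  (forall i, L2 (F i)) -> L2 v ->
  inner (fun x => \sum_(i <- s) F i x) v = \sum_(i <- s) inner (F i) v.
Proof.
move=> lF lv; rewrite innerE.
have [|_ <-] := cint_sum s (F := fun i x => F i x * (v x)^*).
  by move=> i; exact: L2_mul_cintegrable.
by apply: eq_cint => x; rewrite mulr_suml.
Qed.

Lemma inner_n2 f : inner f f = (n2 f)%:C.
Proof. by rewrite innerE -cint_real; apply: eq_cint => x; rewrite mulc_conj. Qed.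

(** The nonnegativity of n2 (t f - z g) at t = n2 g, z = <f, g>; when n2 g = 0,
    that of n2 (f - t z g) for t large. *)
Lemma inner_CauchySchwarz f g : L2 f -> L2 g -> sqn (inner f g) <= n2 f * n2 g.
Proof.
move=> lf lg; set z := inner f g.
have gf : inner g f = z^* by rewrite inner_conj.
have key (t : R) (w : R[i]) : (n2 (fun x => t%:C * f x - w * g x))%:C =
    (t ^+ 2 * n2 f)%:C - t%:C * (w^* * z + w * z^*) + (sqn w * n2 g)%:C.
  have l1 := L2Z t%:C lf; have l2 := L2Z w lg; have l3 := L2B l1 l2.
  rewrite -inner_n2 innerBl// !innerZl// (inner_conj lf l3) (inner_conj lg l3).
  rewrite !innerBl// !innerZl// gf -/z !inner_n2.
  rewrite !(rmorphB, rmorphM, rmorphXn) /= -!mulc_conj !conj_realc conjCK.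
  ring.
have [g0|g0] := eqVneq (n2 g) 0.
  rewrite g0 mulr0 leNgt; apply/negP => z0.
  set t := (n2 f + 1) / (2 * sqn z).
  have /(congr1 (@complex.Re R)) := key 1 (t%:C * z).
  rewrite g0 mulr0 addr0 (_ : (t%:C * z)^* = t%:C * z^*); last by rewrite conjM conj_realc.
  rewrite -!mulrA (mulrC z^*) mulc_conj mul1r -mulrDr -rmorphD -rmorphM /=.
  have -> : t * (sqn z + sqn z) = n2 f + 1 by rewrite /t; field; rewrite gt_eqF.
  move=> h; have := n2_ge0 (fun x => 1%:C * f x - t%:C * z * g x); rewrite h; lra.
have g1 : 0 < n2 g by rewrite lt_neqAle eq_sym g0 n2_ge0.
have /(congr1 (@complex.Re R)) := key (n2 g) z.
rewrite (mulrC z^*) mulc_conj -rmorphD -rmorphM /= => h.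
have := n2_ge0 (fun x => (n2 g)%:C * f x - z * g x); rewrite h => h'.
have h'' : 0 <= n2 g * (n2 f * n2 g - sqn z).
  apply: le_trans h' _; rewrite le_eqVlt; apply/orP; left; apply/eqP; ring.
by move: h''; rewrite pmulr_rge0// subr_ge0.
Qed.

End SquareIntegrable.

(** * Unconditional sums *)

Section Sums.
Context {R : realType} {I : choiceType}.
Implicit Types (a : I -> R[i]) (z : R[i]) (S : {fset I}).

(** Unconditional convergence, measured by the squared modulus so that it combines
    with the Bessel and Cauchy--Schwarz bounds without square roots. *)
Definition has_sum a z : Prop :=
  forall eps : R, 0 < eps -> exists S0 : {fset I}, forall S : {fset I},
    (S0 `<=` S)%fset -> sqn (z - \sum_(i <- S) a i) <= eps.

Lemma has_sumD a1 z1 a2 z2 : has_sum a1 z1 -> has_sum a2 z2 ->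
  has_sum (fun i => a1 i + a2 i) (z1 + z2).
Proof.
move=> h1 h2 e e0; have e4 : 0 < e / 4 by rewrite divr_gt0.
have [S1 {}h1] := h1 _ e4; have [S2 {}h2] := h2 _ e4.
exists (S1 `|` S2)%fset => S; rewrite fsubUset => /andP[/h1 {}h1 /h2 {}h2].
rewrite big_split /= opprD addrACA (le_trans (sqnD_le _ _))//; lra.
Qed.

Lemma has_sumZ (c : R[i]) a z : has_sum a z -> has_sum (fun i => c * a i) (c * z).
Proof.
move=> h e e0; have c1 : 0 < sqn c + 1 by rewrite ltr_wpDl ?sqn_ge0.
have [S0 {}h] := h (e / (sqn c + 1)) (divr_gt0 e0 c1).
exists S0 => S /h {}h; rewrite -mulr_sumr -mulrBr sqnM.
apply: le_trans (_ : (sqn c + 1) * (e / (sqn c + 1)) <= _); last by rewrite mulrC divfK ?gt_eqF.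
by apply: ler_pM => //; rewrite ?sqn_ge0// lerDl.
Qed.

Lemma has_sum_conj a z : has_sum a z -> has_sum (fun i => (a i)^*) z^*.
Proof.
move=> h e /h[S0 {}h]; exists S0 => S /h.
by rewrite -conj_sum -sqn_conj rmorphB.
Qed.

Lemma has_sum_ext a b z : a =1 b -> has_sum a z -> has_sum b z.
Proof. by move=> /funext ->. Qed.

Lemma has_sum0 : has_sum (fun=> 0) 0.
Proof. by move=> e e0; exists fset0 => S _; rewrite big1// subrr sqn0 ltW. Qed.

Lemma has_sum_sum (J : eqType) (s : seq J) (F : J -> I -> R[i]) (z : J -> R[i]) :
  (forall j, j \in s -> has_sum (F j) (z j)) ->
  has_sum (fun i => \sum_(j <- s) F j i) (\sum_(j <- s) z j).
Proof.
elim: s => [_|j s IH h].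
  by rewrite big_nil; apply: has_sum_ext has_sum0 => i; rewrite big_nil.
have hj := h j (mem_head _ _); have hs : forall k, k \in s -> has_sum (F k) (z k).
  by move=> k ks; apply: h; rewrite in_cons ks orbT.
by rewrite big_cons; apply: has_sum_ext (has_sumD hj (IH hs)) => i; rewrite big_cons.
Qed.

Lemma has_sum_unique a z w : has_sum a z -> has_sum a w -> z = w.
Proof.
move=> h1 h2; apply/eqP; rewrite -subr_eq0; apply/eqP/sqn_eq0.
apply/eqP; rewrite eq_le sqn_ge0 andbT; apply/ler_addgt0Pl => e e0; rewrite addr0.
have e4 : 0 < e / 4 by rewrite divr_gt0.
have [S1 {}h1] := h1 _ e4; have [S2 {}h2] := h2 _ e4.
have {}h1 := h1 _ (fsubsetUl S1 S2); have {}h2 := h2 _ (fsubsetUr S1 S2).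
move: (\sum_(i <- _) _) h1 h2 => s h1 h2.
rewrite (_ : z - w = (z - s) - (w - s)); last by ring.
by rewrite (le_trans (sqnB_le _ _))//; lra.
Qed.

Lemma sum_fsetD (V : nmodType) S S' (F : I -> V) : (S `<=` S')%fset ->
  \sum_(i <- S') F i = \sum_(i <- S) F i + \sum_(i <- (S' `\` S)%fset) F i.
Proof.
move=> SS'; rewrite -big_cat /=; apply: perm_big; apply: uniq_perm.
- exact: fset_uniq.
- rewrite cat_uniq !fset_uniq /= andbT; apply/hasPn => i.
  by rewrite in_fsetD => /andP[].
move=> i; rewrite mem_cat in_fsetD.
by have [iS|] //= := boolP (i \in S); rewrite (fsubsetP SS').
Qed.

Lemma le_sum_fset S S' (F : I -> R) : (forall i, 0 <= F i) -> (S `<=` S')%fset ->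
  \sum_(i <- S) F i <= \sum_(i <- S') F i.
Proof. by move=> F0 SS'; rewrite (sum_fsetD F SS') lerDl sumr_ge0. Qed.

(** The tail of a summable family: take a finite set whose sum is close to the
    supremum of all finite sums. *)
Lemma small_tail (F : I -> R) (M : R) : (forall i, 0 <= F i) ->
  (forall S, \sum_(i <- S) F i <= M) -> forall eps, 0 < eps ->
  exists S0, forall S S', (S0 `<=` S)%fset -> (S `<=` S')%fset ->
    \sum_(i <- (S' `\` S)%fset) F i <= eps.
Proof.
move=> F0 FM eps e0; pose E := [set \sum_(i <- S) F i | S in [set: {fset I}]].
have hE : has_sup E.
  split; first by exists (\sum_(i <- fset0) F i), fset0.
  by exists M => _ [S _ <-].
have [_ [S0 _ <-] hS0] := sup_adherent e0 hE; exists S0 => S S' S0S SS'.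
have h1 : \sum_(i <- S') F i <= sup E by apply: ub_le_sup; [case: hE|exists S'].
have h2 := le_sum_fset F0 S0S.
by rewrite (sum_fsetD F SS') in h1; lra.
Qed.

Lemma esum_le_fset (F : I -> R) (M : \bar R) :
  (forall S, ((\sum_(i <- S) F i)%:E <= M)%E) -> (\esum_(i in setT) (F i)%:E <= M)%E.
Proof.
move=> h; apply: ge_ereal_sup => _ [A [finA _] <-].
by rewrite fsbig_finite//= sumEFin.
Qed.

Lemma fset_le_esum (F : I -> R) S : ((\sum_(i <- S) F i)%:E <= \esum_(i in setT) (F i)%:E)%E.
Proof.
apply: esum_ge; exists [set` S]; first by split => //; exact: finite_fset.
by rewrite fsbig_finite//= set_fsetK sumEFin.
Qed.

End Sums.

(** * Bessel systems and weak reconstruction *)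

#[local] Existing Instance totally_filter.

Section WeakExpansions.
Context {R : realType} {I : choiceType}.
Implicit Types (e : I -> R -> R[i]) (f v : R -> R[i]).

Definition bessel e (B : R) : Prop :=
  (forall i, L2 (e i)) /\
  forall f, L2 f -> forall S : {fset I}, \sum_(i <- S) sqn (inner f (e i)) <= B * n2 f.

(** The reconstruction formula read against test functions; the factor kappa
    accommodates the unnormalised exponentials. *)
Definition weak_expansion (kappa : R) e e' f : Prop :=
  forall v, L2 v ->
    has_sum (fun i => inner f (e' i) * (inner v (e i))^*) (kappa%:C * inner f v).

Lemma weak_expansionD kappa e e' f g : (forall i, L2 (e' i)) -> L2 f -> L2 g ->
  weak_expansion kappa e e' f -> weak_expansion kappa e e' g ->
  weak_expansion kappa e e' (fun x => f x + g x).
Proof.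
move=> le lf lg hf hg v lv; rewrite innerDl// mulrDr.
by apply: has_sum_ext (has_sumD (hf v lv) (hg v lv)) => i; rewrite innerDl// mulrDl.
Qed.

Lemma weak_expansionZ kappa e e' f c : (forall i, L2 (e' i)) -> L2 f ->
  weak_expansion kappa e e' f -> weak_expansion kappa e e' (fun x => c * f x).
Proof.
move=> le lf hf v lv; rewrite innerZl// mulrCA.
by apply: has_sum_ext (has_sumZ c (hf v lv)) => i; rewrite innerZl// mulrA.
Qed.

Lemma weak_expansionB kappa e e' f g : (forall i, L2 (e' i)) -> L2 f -> L2 g ->
  weak_expansion kappa e e' f -> weak_expansion kappa e e' g ->
  weak_expansion kappa e e' (fun x => f x - g x).
Proof.
move=> le lf lg hf hg; have := weak_expansionD le lf (L2Z (-1) lg) hf (@weak_expansionZ kappa e e' g (-1) le lg hg).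
by rewrite (_ : (fun x => _ + -1 * g x) = fun x => f x - g x)//; apply/funext => x; rewrite mulN1r.
Qed.

Lemma weak_expansion0 kappa e e' : weak_expansion kappa e e' (fun=> 0).
Proof.
move=> v lv; have z w : inner (fun=> 0) w = 0 :> R[i].
  by rewrite innerE -[RHS](@cint0 R); apply: eq_cint => x; rewrite mul0r.
by rewrite z mulr0; apply: has_sum_ext (@has_sum0 R I) => i; rewrite z mul0r.
Qed.

Lemma weak_expansion_sum kappa e e' (J : Type) (s : seq J) (F : J -> R -> R[i]) :
  (forall i, L2 (e' i)) -> (forall j, L2 (F j)) ->
  (forall j, weak_expansion kappa e e' (F j)) ->
  weak_expansion kappa e e' (fun x => \sum_(j <- s) F j x).
Proof.
move=> le lF hF; elim: s => [|j s IH].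
  rewrite (_ : (fun x => _) = fun=> 0); first exact: weak_expansion0.
  by apply/funext => x; rewrite big_nil.
rewrite (_ : (fun x => _) = fun x => F j x + \sum_(j <- s) F j x); last by apply/funext => x; rewrite big_cons.
by apply: weak_expansionD => //; exact: L2_sum.
Qed.

Lemma bessel_pair_sum e e' (B B' : R) f v (S : {fset I}) : 0 <= B -> 0 <= B' ->
  bessel e B -> bessel e' B' -> L2 f -> L2 v ->
  sqn (\sum_(i <- S) inner f (e' i) * (inner v (e i))^*) <= (B' * n2 f) * (B * n2 v).
Proof.
move=> B0 B0' [_ he] [_ he'] lf lv; apply: le_trans (sum_CauchySchwarz _ _ _ _) _.
apply: ler_pM; try by apply: sumr_ge0 => i _; exact: sqn_ge0.
  exact: he'.
by under eq_bigr do rewrite sqn_conj; exact: he.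
Qed.

(** Both sides of the weak reconstruction formula are continuous in f for the
    L2-norm, uniformly over the finite partial sums: the set of reconstructed
    functions is closed. *)
Lemma weak_expansion_closed kappa e e' (B B' : R) f : 0 <= B -> 0 <= B' ->
  bessel e B -> bessel e' B' -> L2 f ->
  (forall delta, 0 < delta -> exists g, [/\ L2 g, weak_expansion kappa e e' g &
     n2 (fun x => f x - g x) <= delta]) ->
  weak_expansion kappa e e' f.
Proof.
move=> B0 B0' be be' lf h v lv eps eps0.
pose K := kappa ^+ 2 * n2 v + 2 * (B' * B * n2 v) + 1.
have K0' : 0 <= kappa ^+ 2 * n2 v + 2 * (B' * B * n2 v).
  apply: addr_ge0; first by rewrite mulr_ge0 ?sqr_ge0 ?n2_ge0.
  by apply: mulr_ge0 => //; apply: mulr_ge0; [exact: mulr_ge0|exact: n2_ge0].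
have K0 : 0 < K by exact: ltr_wpDl.
have [g [lg hg fg]] := h (eps / (4 * K)) (divr_gt0 eps0 (mulr_gt0 (ltr0Sn _ _) K0)).
have lfg := L2B lf lg.
have [S0 hS] := hg v lv (eps / 8) (divr_gt0 eps0 (ltr0Sn _ _)).
exists S0 => S /hS {}hS.
have -> : kappa%:C * inner f v - \sum_(i <- S) inner f (e' i) * (inner v (e i))^* =
   kappa%:C * inner (fun x => f x - g x) v +
   ((kappa%:C * inner g v - \sum_(i <- S) inner g (e' i) * (inner v (e i))^*) +
   - \sum_(i <- S) inner (fun x => f x - g x) (e' i) * (inner v (e i))^*).
  have le' := be'.1; rewrite innerBl// (_ : \sum_(i <- S) inner (fun x => f x - g x) (e' i) * (inner v (e i))^* =
    \sum_(i <- S) inner f (e' i) * (inner v (e i))^* - \sum_(i <- S) inner g (e' i) * (inner v (e i))^*).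
    by ring.
  by rewrite -sumrB; apply: eq_bigr => i _; rewrite innerBl// mulrBl.
apply: le_trans (sqnD_le _ _) _.
have h1 := sqnD_le (kappa%:C * inner g v - \sum_(i <- S) inner g (e' i) * (inner v (e i))^*)
   (- \sum_(i <- S) inner (fun x => f x - g x) (e' i) * (inner v (e i))^*).
have h2 := bessel_pair_sum S B0 B0' be be' lfg lv.
have h3 : sqn (kappa%:C * inner (fun x => f x - g x) v) <= kappa ^+ 2 * (n2 (fun x => f x - g x) * n2 v).
  by rewrite sqnM sqn_real ler_wpM2l ?sqr_ge0// inner_CauchySchwarz.
rewrite sqnN in h1.
set d := n2 _ in fg h2 h3.
have h4 : (kappa ^+ 2 * n2 v + 2 * (B' * B * n2 v)) * d <= eps / 4.
  apply: (@le_trans _ _ (K * (eps / (4 * K)))); last first.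
    by rewrite le_eqVlt; apply/orP; left; apply/eqP; field; rewrite gt_eqF.
  by apply: ler_pM => //; [exact: n2_ge0|rewrite /K lerDl].
nra.
Qed.

Lemma weak_expansion_swap e e' : (forall i, L2 (e' i)) -> (forall i, L2 (e i)) ->
  (forall f, L2 f -> weak_expansion 1 e e' f) -> forall f, L2 f -> weak_expansion 1 e' e f.
Proof.
move=> le' le h f lf v lv; have -> : 1%:C * inner f v = (1%:C * inner v f)^*.
  by rewrite conjM conj_realc -inner_conj.
apply: has_sum_ext (has_sum_conj (h v lv f lf)) => i /=.
by rewrite conjM conjCK mulrC.
Qed.

Lemma L2_residual e (c : I -> R[i]) f (S : {fset I}) : (forall i, L2 (e i)) -> L2 f ->
  L2 (fun x => f x - \sum_(i <- S) c i * e i x).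
Proof. by move=> le lf; apply: L2B => //; apply: L2_sum => i; exact: L2Z. Qed.

Lemma inner_residual e (c : I -> R[i]) f v (S : {fset I}) : (forall i, L2 (e i)) -> L2 f -> L2 v ->
  inner (fun x => f x - \sum_(i <- S) c i * e i x) v =
  inner f v - \sum_(i <- S) c i * (inner v (e i))^*.
Proof.
move=> le lf lv; rewrite innerBl//; last by apply: L2_sum => i; exact: L2Z.
rewrite inner_suml//; last by move=> i; exact: L2Z.
by congr (_ - _); apply: eq_bigr => i _; rewrite innerZl// inner_conj.
Qed.

(** Testing the residual r of a partial sum against itself leaves the tail of
    the series, which the two Bessel bounds control by the tail of the
    square-summable coefficients times the norm of r. *)
Lemma n2_residual e e' (B B' : R) f : 0 <= B -> 0 <= B' ->
  bessel e B -> bessel e' B' -> L2 f -> weak_expansion 1 e e' f ->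
  forall eps, 0 < eps -> exists S0 : {fset I}, forall S : {fset I}, (S0 `<=` S)%fset ->
    n2 (fun x => f x - \sum_(i <- S) inner f (e' i) * e i x) <= eps.
Proof.
move=> B0 B0' be be' lf hf eps eps0.
have B1 : 0 < 2 * B + 1 by rewrite ltr_wpDl ?mulr_ge0.
have [S0 hS0] := small_tail (fun i => sqn_ge0 (inner f (e' i))) (be'.2 f lf) (divr_gt0 eps0 B1).
exists S0 => S S0S; set r := fun x => _.
have le := be.1; have lr : L2 r by exact: L2_residual.
have r0 := n2_ge0 r.
suff h : (n2 r) ^+ 2 <= eps * n2 r.
  by have [->|r1] := eqVneq (n2 r) 0; [exact: ltW|rewrite -(@ler_pM2r _ (n2 r)) ?lt_neqAle 1?eq_sym ?r1// -expr2].
apply/ler_addgt0Pl => d d0.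
have [S1 hS1] := hf r lr (d / 2) (divr_gt0 d0 (ltr0Sn _ _)).
have {}hS1 := hS1 _ (fsubsetUl S1 S).
have SU : (S `<=` S1 `|` S)%fset by exact: fsubsetUr.
rewrite (sum_fsetD _ SU) in hS1.
have hT := hS0 _ _ S0S SU.
have := sqnD_le (1%:C * inner f r - (\sum_(i <- S) inner f (e' i) * (inner r (e i))^* +
   \sum_(i <- ((S1 `|` S) `\` S)%fset) inner f (e' i) * (inner r (e i))^*))
   (\sum_(i <- ((S1 `|` S) `\` S)%fset) inner f (e' i) * (inner r (e i))^*).
set X := \sum_(i <- S) _ in hS1 *; set Y := \sum_(i <- (_ `\` S)%fset) _ in hS1 *.
have -> : 1%:C * inner f r - (X + Y) + Y = (n2 r)%:C.
  by rewrite -inner_n2 {2}/r inner_residual// -/X mul1r; ring.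
rewrite sqn_real => h1.
have h2 : sqn Y <= (eps / (2 * B + 1)) * (B * n2 r).
  apply: le_trans (sum_CauchySchwarz _ _ _ _) _.
  apply: ler_pM => //; try by apply: sumr_ge0 => i _; exact: sqn_ge0.
  by under eq_bigr do rewrite sqn_conj; exact: be.2.
have h3 : 2 * (eps / (2 * B + 1) * (B * n2 r)) <= eps * n2 r.
  rewrite (_ : 2 * _ = (eps * n2 r) * (2 * B / (2 * B + 1))); last by field; rewrite gt_eqF.
  apply: ler_piMr; first by rewrite mulr_ge0// ltW.
  by rewrite ler_pdivrMr// mul1r lerDl.
lra.
Qed.

Lemma L2norm_sqrt f : L2 f -> L2norm f = (Num.sqrt (n2 f))%:E.
Proof.
move=> lf; have : (0 <= L2norm f)%E by exact: Lnorm_ge0.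
have := L2norm_n2 lf; case: (L2norm f) => [r| |//].
  by rewrite -EFin_expe => -[<-]; rewrite lee_fin => r0; rewrite sqrtr_sqr ger0_norm.
by rewrite /= mulyy.
Qed.

(** For Bessel systems weak reconstruction already converges in norm, since the
    coefficients are square-summable. *)
Lemma weak_expansion_L2 e e' (B B' : R) f : 0 <= B -> 0 <= B' ->
  bessel e B -> bessel e' B' -> L2 f -> weak_expansion 1 e e' f ->
  L2_expansion f (fun i => inner f (e' i)) e.
Proof.
move=> B0 B0' be be' lf hf; have le := be.1.
suff : (fun S : {fset I} => L2norm (fun x => f x - \sum_(i <- S) inner f (e' i) * e i x)) @ totally --> 0%E by [].
set F := (F in F @ _).
have -> : F = (EFin \o (fun S : {fset I} =>
    Num.sqrt (n2 (fun x => f x - \sum_(i <- S) inner f (e' i) * e i x)))).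
  by apply/funext => S /=; rewrite /F L2norm_sqrt//; exact: L2_residual.
apply/fine_cvgP; split; first exact: nearW.
apply/cvgrPdist_le => eps eps0.
have [S0 hS0] := n2_residual B0 B0' be be' lf hf (exprn_gt0 2 eps0).
exists S0 => // S /= /hS0 h; rewrite sub0r normrN ger0_norm ?sqrtr_ge0//.
by rewrite -(ger0_norm (ltW eps0)) -sqrtr_sqr ler_wsqrtr.
Qed.

Lemma L2_expansion_weak e (c : I -> R[i]) f v : (forall i, L2 (e i)) -> L2 f -> L2 v ->
  L2_expansion f c e -> has_sum (fun i => c i * (inner v (e i))^*) (inner f v).
Proof.
move=> le lf lv h eps eps0; have v1 : 0 < n2 v + 1 by rewrite ltr_wpDl ?n2_ge0.
have d0 : 0 < Num.sqrt (eps / (n2 v + 1)) by rewrite sqrtr_gt0 divr_gt0.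
have /h [S0 _ hS0] : nbhs (0%E : \bar R) [set y : \bar R | (y < (Num.sqrt (eps / (n2 v + 1)))%:E)%E].
  by apply: open_ereal_lt'; rewrite lte_fin.
exists S0 => S /hS0 /=; have lr := L2_residual c S le lf.
rewrite L2norm_sqrt// lte_fin ltr_sqrt ?divr_gt0// => hr.
rewrite -inner_residual//; apply: le_trans (inner_CauchySchwarz lr lv) _.
apply: le_trans (_ : (eps / (n2 v + 1)) * (n2 v + 1) <= _); last by rewrite divfK ?gt_eqF.
by apply: ler_pM; rewrite ?n2_ge0// ?ltW// ltrDl.
Qed.

(** Testing the weak formula for f against f itself and applying Cauchy--Schwarz
    gives n2 f ^ 2 <= (B' n2 f) (sum of |<f, e_i>|^2) up to a factor 2: the Bessel
    bound of one system yields a lower frame bound of the other. *)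
Lemma weak_expansion_frame e e' (B B' : R) : 0 <= B -> 0 <= B' ->
  bessel e B -> bessel e' B' -> (forall f, L2 f -> weak_expansion 1 e e' f) -> is_frame e.
Proof.
move=> B0 B0' be be' h; split; first exact: be.1.
have B1 : 0 < 2 * B' + 1 by rewrite ltr_wpDl ?mulr_ge0.
exists (2 * B' + 1)^-1, (B + 1); split; [by rewrite invr_gt0|by rewrite ltr_wpDl|move=> f lf].
have E i : (Normc.normc (inner f (e i)) ^+ 2)%:E = (sqn (inner f (e i)))%:E by rewrite normc_sqr.
have -> : (\esum_(i in setT) (Normc.normc (inner f (e i)) ^+ 2)%:E =
           \esum_(i in setT) (sqn (inner f (e i)))%:E)%E by apply: eq_esum => i _; rewrite E.
rewrite L2norm_n2//; split; last first.
  apply: esum_le_fset => S; rewrite -EFinM lee_fin; apply: le_trans (be.2 f lf S) _.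
  by rewrite ler_wpM2r ?n2_ge0// lerDl.
have := @fset_le_esum R I (fun i => sqn (inner f (e i))).
case: (\esum_(i in _) _)%E => [s hs| |hs]; last by have := hs fset0.
  rewrite -EFinM lee_fin mulrC ler_pdivrMr//.
  have s0 : 0 <= s by have := hs fset0; rewrite big_seq_fset0 lee_fin.
  have f0 := n2_ge0 f.
  suff h2 : (n2 f) ^+ 2 <= (2 * B' * s) * n2 f.
    have [->|f1] := eqVneq (n2 f) 0; first by rewrite mulr_ge0// ltW.
    have f2 : 0 < n2 f by rewrite lt_neqAle eq_sym f1.
    rewrite expr2 ler_pM2r// in h2; lra.
  apply/ler_addgt0Pl => d d0.
  have [S {}h] := h f lf f lf (d / 2) (divr_gt0 d0 (ltr0Sn _ _)).
  have {}h := h S (fsubset_refl S); rewrite mul1r in h.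
  have := sqnD_le (1%:C * inner f f - \sum_(i <- S) inner f (e' i) * (inner f (e i))^*)
      (\sum_(i <- S) inner f (e' i) * (inner f (e i))^*).
  rewrite subrK mul1r {1}inner_n2 sqn_real => h3.
  have h4 : sqn (\sum_(i <- S) inner f (e' i) * (inner f (e i))^*) <= (B' * n2 f) * s.
    apply: le_trans (sum_CauchySchwarz _ _ _ _) _.
    apply: ler_pM; try by apply: sumr_ge0 => i _; exact: sqn_ge0.
      exact: be'.2.
    by under eq_bigr do rewrite sqn_conj; have := hs S; rewrite lee_fin.
  have h5 : n2 f ^+ 2 <= 2 * (d / 2) + 2 * (B' * n2 f * s).
    by apply: le_trans h3 _; apply: lerD; rewrite ler_pM2l.
  lra.
by move=> _; exact: leey.
Qed.

End WeakExpansions.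

(** * Translation invariance of the Lebesgue integral *)

Section Translation.
Context {R : realType}.
Local Notation mu := (@lebesgue_measure R).
Local Notation rint p := (mu.-integrable setT (EFin \o p)).
Implicit Types (p : R -> R) (t : R).

Lemma measurable_shift t :
  measurable_fun setT (fun x : measurableTypeR R => x + t : measurableTypeR R).
Proof. exact: measurable_funD. Qed.

Definition shifted_lebesgue t : {measure set (measurableTypeR R) -> \bar R}.
refine [the {measure set _ -> \bar R} of
  pushforward mu (fun x : measurableTypeR R => x + t : measurableTypeR R)].
Unshelve. exact: measurable_shift.
Defined.

(** The Lebesgue measure is determined by its values on half-open intervals, which
    translations preserve. *)
Lemma lebesgue_measure_shift t (A : set R) : measurable A -> mu A = shifted_lebesgue t A.
Proof.
apply: lebesgue_measure_unique => _ [[a b] _ <-] /=; rewrite /pushforward.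
have -> : (fun x : R => x + t) @^-1` `]a, b]%classic = `](a - t), (b - t)]%classic.
  by apply/seteqP; split => x /=; rewrite !in_itv /= ltrBlDr lerBrDr.
rewrite !lebesgue_measure_itv /= !lte_fin ltrD2r.
by case: ifP => // _; rewrite -!EFinD; congr (_%:E); ring.
Qed.

Lemma integral_lebesgue_shift (f : R -> \bar R) t :
  (\int[mu]_x f x = \int[shifted_lebesgue t]_x f x)%E.
Proof.
by apply: eq_measure_integral => A mA _; exact: lebesgue_measure_shift.
Qed.

Lemma integral_shift_ge0 t p : measurable_fun setT p -> (forall x, 0 <= p x) ->
  (\int[mu]_x (p (x + t))%:E = \int[mu]_x (p x)%:E)%E.
Proof.
move=> mp p0; rewrite [RHS](integral_lebesgue_shift _ t).
rewrite [RHS](ge0_integral_pushforward (measurable_shift t))//=.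
- exact/measurable_EFinP.
- by move=> x _; rewrite lee_fin.
Qed.

Lemma rint_shift t p : rint p -> rint (fun x => p (x + t)).
Proof.
move=> ip; have mp := rint_meas ip.
have mpt : measurable_fun setT (fun x : R => p (x + t)) by apply: measurableT_comp mp (measurable_shift t).
apply/integrableP; split; first exact/measurable_EFinP.
have E q : (\int[mu]_x `|(EFin \o q) x| = \int[mu]_x (`|q x|)%:E)%E by exact: eq_integral.
have /integrableP[_] := ip; rewrite !E.
by rewrite (integral_shift_ge0 t (p := fun x => `|p x|))//; exact: measurableT_comp.
Qed.

Lemma Rintegral_shift t p : rint p -> \int[mu]_x p (x + t) = \int[mu]_x p x.
Proof.
move=> ip; rewrite /Rintegral; congr fine.
rewrite [RHS](integral_lebesgue_shift _ t).
rewrite [RHS](integral_pushforward (measurable_shift t))//=.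
- by apply/measurable_EFinP; exact: rint_meas.
- exact: rint_shift.
Qed.

Lemma cint_shift t (u : R -> R[i]) : cintegrable u ->
  cintegrable (fun x => u (x + t)) /\ cint (fun x => u (x + t)) = cint u.
Proof.
move=> [u1 u2]; split.
  by split; [exact: (rint_shift t u1)|exact: (rint_shift t u2)].
by rewrite /cint (Rintegral_shift t u1) (Rintegral_shift t u2).
Qed.

Lemma L2_shift t f : L2 f -> L2 (fun x => f (x + t)).
Proof.
move=> /L2P[mf fi]; apply/L2P; split.
  exact: cmeas_comp mf (measurable_shift t).
exact: (rint_shift t fi).
Qed.

Lemma ae_shift t (P : R -> Prop) : {ae mu, forall x, P x} -> {ae mu, forall x, P (x + t)}.
Proof.
move=> [N [mN N0 PN]]; exists ((fun x : R => x + t) @^-1` N); split.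
- by rewrite -[X in measurable X]setTI; exact: measurable_shift.
- by have := lebesgue_measure_shift t mN; rewrite N0.
- by move=> x /= Px; exact: PN.
Qed.

End Translation.

(** * Approximation in mean square *)

Section Approximation.
Context {R : realType}.
Local Notation mu := (@lebesgue_measure R).
Local Notation rint p := (mu.-integrable setT (EFin \o p)).

Lemma Rintegral_cvg0 (h : nat -> R -> R) (G : R -> R) :
  (forall n, measurable_fun setT (h n)) -> rint G ->
  (forall n x, `|h n x| <= G x) ->
  {ae mu, forall x, h n x @[n --> \oo] --> (0 : R)} ->
  forall eps : R, 0 < eps -> exists n, \int[mu]_x h n x <= eps.
Proof.
move=> mh iG hG h0 eps eps0.
have [] := @dominated_convergence _ _ _ mu setT measurableT (fun n x => (h n x)%:E) (fun=> 0%E) (EFin \o G).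
- by move=> n; apply/measurable_EFinP; exact: mh.
- exact: measurable_cst.
- case: h0 => N [mN N0 hN]; exists N; split => // x /= hx; apply: hN => /= hx0; apply: hx => _.
  by apply/fine_cvgP; split; [exact: nearW|exact: hx0].
- exact: iG.
- by apply: aeW => x n _; rewrite lee_fin.
move=> _ _; rewrite integral0 => hc.
have /hc [n _ hn] : nbhs (0%E : \bar R) [set y : \bar R | (y < eps%:E)%E].
  by apply: open_ereal_lt'; rewrite lte_fin.
exists n; have := hn n (leqnn n); rewrite /= /Rintegral.
case: (\int[mu]_x _)%E => [r| |] //=; first by rewrite lte_fin => /ltW.
by move=> _; exact: ltW.
Qed.

(** One good approximant is all that the closedness of the set of reconstructed
    functions asks for. *)
Lemma n2_cvg (f : R -> R[i]) (g : nat -> R -> R[i]) (G : R -> R) :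
  L2 f -> (forall n, L2 (g n)) -> rint G ->
  (forall n x, sqn (f x - g n x) <= G x) ->
  {ae mu, forall x, sqn (f x - g n x) @[n --> \oo] --> (0 : R)} ->
  forall eps : R, 0 < eps -> exists n, n2 (fun x => f x - g n x) <= eps.
Proof.
move=> lf lg iG fG h0; apply: (Rintegral_cvg0 (h := fun n x => sqn (f x - g n x)) _ iG _ h0).
  by move=> n; apply: cmeas_sqn; apply: L2_cmeas; exact: L2B.
by move=> n x; rewrite ger0_norm ?sqn_ge0.
Qed.

End Approximation.

(** * Indicator functions *)

Section Indicators.
Context {R : realType}.
Local Notation mu := (@lebesgue_measure R).
Implicit Types (A B : set R) (f : R -> R[i]).

Definition cind A : R -> R[i] := fun x => (\1_A x)%:C.

Lemma cind_in A x : A x -> cind A x = 1.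
Proof. by move=> Ax; rewrite /cind indicE mem_set. Qed.

Lemma cind_out A x : ~ A x -> cind A x = 0.
Proof. by move=> Ax; rewrite /cind indicE memNset. Qed.

Lemma cind_conj A x : (cind A x)^* = cind A x.
Proof. exact: conj_realc. Qed.

Lemma cindM A B x : cind A x * cind B x = cind (A `&` B) x.
Proof. by rewrite /cind indicI /= rmorphM. Qed.

Lemma sqn_cind_le A x : sqn (cind A x) <= 1.
Proof. by rewrite sqn_real indicE; case: (_ \in _); rewrite ?expr1n// expr0n. Qed.

Lemma cmeas_cind A : measurable A -> cmeas (cind A).
Proof. by move=> mA; apply: cmeas_real; exact: measurable_indic. Qed.

Lemma L2_mul_cind A f : measurable A -> L2 f -> L2 (fun x => f x * cind A x).
Proof.
move=> mA lf; have := L2_mulb (cmeas_cind mA) (sqn_cind_le A) lf.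
by congr L2; apply/funext => x; rewrite mulrC.
Qed.

Lemma L2_cind A : measurable A -> (mu A < +oo)%E -> L2 (cind A).
Proof.
move=> mA fA; apply/L2P; split; first exact: cmeas_cind.
have : mu.-integrable setT (EFin \o (\1_A : R -> R)).
  apply/integrableP; split; first by apply/measurable_EFinP; exact: measurable_indic.
  suff -> : (\int[mu]_x `|(EFin \o (\1_A : R -> R)) x| = mu A)%E by [].
  rewrite -[in RHS](setIT A) -integral_indic//.
  by apply: eq_integral => x _ /=; rewrite ger0_norm.
apply: eq_integrable => // x _ /=; rewrite sqn_real indicE.
by case: (_ \in _); rewrite ?expr1n// expr0n.
Qed.

Lemma L2_bounded (M : R) A f : measurable A -> (mu A < +oo)%E -> cmeas f ->
  (forall x, sqn (f x) <= M) -> (forall x, ~ A x -> f x = 0) -> L2 f.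
Proof.
move=> mA fA mf fM f0; have := L2_mulb mf fM (L2_cind mA fA).
congr L2; apply/funext => x; have [Ax|Ax] := pselect (A x).
  by rewrite cind_in// mulr1.
by rewrite f0// mul0r.
Qed.

End Indicators.

(** * Exponentials *)

Section Exponentials.
Context {R : realType}.
Local Notation mu := (@lebesgue_measure R).
Implicit Types (nu x y : R).

Definition expi nu x : R[i] := cos (2 * pi * nu * x) +i* sin (2 * pi * nu * x).

Lemma expiD nu1 nu2 x : expi (nu1 + nu2) x = expi nu1 x * expi nu2 x.
Proof.
apply/eqP; rewrite eq_complex /= mulrDr mulrDl cosD sinD.
by apply/andP; split; apply/eqP => //; rewrite addrC; congr (_ + _); rewrite mulrC.
Qed.

Lemma expi_shift nu x y : expi nu (x + y) = expi nu x * expi nu y.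
Proof.
apply/eqP; rewrite eq_complex /= mulrDr cosD sinD.
by apply/andP; split; apply/eqP => //; rewrite addrC; congr (_ + _); rewrite mulrC.
Qed.

Lemma expi_conj nu x : (expi nu x)^* = expi (- nu) x.
Proof.
by apply/eqP; rewrite eq_complex /= mulrN mulNr cosN sinN !eqxx.
Qed.

Lemma expi0 x : expi 0 x = 1.
Proof. by apply/eqP; rewrite eq_complex /= mulr0 mul0r cos0 sin0 !eqxx. Qed.

Lemma sqn_expi nu x : sqn (expi nu x) = 1.
Proof. by rewrite /sqn /= cos2Dsin2. Qed.

Lemma expi_nat (n : nat) : expi n%:R 1 = 1.
Proof.
elim: n => [|n IH]; first exact: expi0.
rewrite -natr1 expiD IH mul1r; apply/eqP.
by rewrite eq_complex /= !mulr1 mulr_natl cos2pi sin2pi !eqxx.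
Qed.

Lemma expi_int (l : int) : expi l%:~R 1 = 1.
Proof.
case: l => n; first exact: expi_nat.
by rewrite NegzE mulrNz -expi_conj expi_nat conjC1.
Qed.

Lemma expi_period (b : R) (l j : int) : b != 0 -> expi (l%:~R * b) (j%:~R * b^-1) = 1.
Proof.
move=> b0; rewrite -(expi_int (l * j)) /expi.
by rewrite (_ : 2 * pi * (l%:~R * b) * (j%:~R * b^-1) = 2 * pi * (l * j)%:~R * 1)// intrM; field.
Qed.

Lemma continuous_cosM (c : R) : continuous (fun x : R => cos (c * x)).
Proof.
move=> x; apply: (@continuous_comp _ _ _ (fun x : R => c * x) cos).
  exact: mulrl_continuous.
exact: continuous_cos.
Qed.

Lemma continuous_sinM (c : R) : continuous (fun x : R => sin (c * x)).
Proof.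
move=> x; apply: (@continuous_comp _ _ _ (fun x : R => c * x) sin).
  exact: mulrl_continuous.
exact: continuous_sin.
Qed.

Lemma cmeas_expi nu : cmeas (expi nu).
Proof.
split; apply: continuous_measurable_fun; [exact: continuous_cosM|exact: continuous_sinM].
Qed.

Lemma integral_itvco (f F : R -> R) (a b : R) : a < b -> continuous f ->
  (forall x : R, is_derive x 1 F (f x)) ->
  \int[mu]_x (f x * \1_`[a, b[%classic x) = F b - F a.
Proof.
move=> ab cf dF.
have fi : mu.-integrable `[a, b]%classic (EFin \o f).
  apply: continuous_compact_integrable; first exact: segment_compact.
  exact: continuous_subspaceT.
have -> : \int[mu]_x (f x * \1_`[a, b[%classic x) = \int[mu]_(x in `[a, b[%classic) f x.
  rewrite [RHS]Rintegral_mkcond; apply: eq_Rintegral => x _.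
  by rewrite /restrict indicE; case: ifP => _; rewrite ?mulr1 ?mulr0.
rewrite Rintegral_itv_bndo_bndc; last first.
  by apply: integrableS fi => //; apply: subset_itvl; rewrite bnd_simp.
have cF : continuous F.
  by move=> x; apply: differentiable_continuous; apply/derivable1_diffP; case: (dF x).
rewrite /Rintegral (continuous_FTC2 (F := F))//.
- exact: continuous_subspaceT.
- split=> [x _||]; first by case: (dF x).
    by apply: cvg_at_right_filter; exact: cF.
  by apply: cvg_at_left_filter; exact: cF.
- by move=> x _; rewrite derive1E; apply: derive_val.
Qed.

Lemma is_derive_linear (c x : R) : is_derive x 1 (fun y : R => c * y) c.
Proof.
have := is_deriveZ c (is_derive_id x (1 : R)).
by rewrite /GRing.scale /= mulr1.
Qed.

Lemma is_derive_sinM (c x : R) : c != 0 -> is_derive x 1 (fun y : R => c^-1 * sin (c * y)) (cos (c * x)).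
Proof.
move=> c0; have h := is_derive1_comp (is_derive_sin (c * x)) (is_derive_linear c x).
have := is_deriveZ c^-1 h.
by rewrite /GRing.scale /= mulrCA mulVf// mulr1.
Qed.

Lemma is_derive_cosM (c x : R) : c != 0 -> is_derive x 1 (fun y : R => - c^-1 * cos (c * y)) (sin (c * x)).
Proof.
move=> c0; have h := is_derive1_comp (is_derive_cos (c * x)) (is_derive_linear c x).
have := is_deriveZ (- c^-1) h.
by rewrite /GRing.scale /= mulNr mulrCA mulVf// mulr1 opprK.
Qed.

End Exponentials.

(** * The Fourier system on a cell of length 1 / b *)

Section FourierSystem.
Context {R : realType}.
Variables (b s : R).
Hypothesis b0 : 0 < b.
Local Notation mu := (@lebesgue_measure R).
Local Notation cell := (`[s, s + b^-1[%classic : set R).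
Implicit Types (l k : int) (f v : R -> R[i]).

Definition cellexp l : R -> R[i] := fun x => expi (l%:~R * b) x * cind cell x.

Let binv0 : 0 < b^-1. Proof. by rewrite invr_gt0. Qed.

Lemma cell_lty : (mu cell < +oo)%E.
Proof. by rewrite lebesgue_measure_itv /= lte_fin ltrDl binv0 -EFinD ltry. Qed.

Lemma L2_cellexp l : L2 (cellexp l).
Proof.
apply: (L2_mulb (M := 1)) (L2_cind _ cell_lty) => //; first exact: cmeas_expi.
by move=> x; rewrite sqn_expi.
Qed.

Lemma cellexp_orthogonal l k :
  inner (cellexp l) (cellexp k) = if l == k then (b^-1)%:C else 0.
Proof.
have E : inner (cellexp l) (cellexp k) = cint (fun x => expi ((l - k)%:~R * b) x * cind cell x).
  rewrite innerE; apply: eq_cint => x; rewrite /cellexp rmorphM /= cind_conj expi_conj.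
  by rewrite mulrACA -expiD cindM setIid intrB mulrBl.
have sb : s < s + b^-1 by rewrite ltrDl.
case: eqP => [lk|lk].
  rewrite E lk subrr mul0r.
  have -> : cint (fun x => expi 0 x * cind cell x) = cint (cind cell).
    by apply: eq_cint => x; rewrite expi0 mul1r.
  rewrite cint_real; congr (_%:C).
  have := @integral_itvco _ (fun=> 1) id _ _ sb (@cst_continuous _ _ _) (fun x => is_derive_id x 1).
  by under eq_Rintegral do rewrite mul1r; move=> ->; ring.
rewrite E; set c := 2 * pi * ((l - k)%:~R * b).
have c0 : c != 0.
  apply: mulf_neq0; first by rewrite gt_eqF// mulr_gt0// pi_gt0.
  by apply: mulf_neq0; [rewrite intr_eq0 subr_eq0; apply/eqP|rewrite gt_eqF].
have P : expi ((l - k)%:~R * b) (s + b^-1) = expi ((l - k)%:~R * b) s.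
  by rewrite expi_shift -[b^-1]mul1r (expi_period _ 1)// ?mulr1// gt_eqF.
have [P1 P2] : cos (c * (s + b^-1)) = cos (c * s) /\ sin (c * (s + b^-1)) = sin (c * s).
  by move: P; rewrite /expi -/c => -[].
rewrite /cint /=; congr (_ +i* _).
  rewrite (_ : \int[mu]_x _ = \int[mu]_x (cos (c * x) * \1_cell x)).
    rewrite (integral_itvco sb (@continuous_cosM R c) (fun x => is_derive_sinM x c0)).
    by rewrite P2 subrr.
  by apply: eq_Rintegral => x _; rewrite mulr0 subr0.
rewrite (_ : \int[mu]_x _ = \int[mu]_x (sin (c * x) * \1_cell x)).
  rewrite (integral_itvco sb (@continuous_sinM R c) (fun x => is_derive_cosM x c0)).
  by rewrite P1 subrr.
by apply: eq_Rintegral => x _; rewrite mulr0 add0r.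
Qed.

(** Cauchy--Schwarz between f and its partial Fourier sum. *)
Lemma cellexp_bessel : bessel cellexp b^-1.
Proof.
split; first exact: L2_cellexp.
move=> f lf S; set A := \sum_(l <- S) _.
pose g x := \sum_(l <- S) inner f (cellexp l) * cellexp l x.
have lZ l : L2 (fun x => inner f (cellexp l) * cellexp l x) by apply: L2Z; exact: L2_cellexp.
have lg : L2 g by exact: L2_sum.
have gl l : l \in S -> inner g (cellexp l) = (b^-1)%:C * inner f (cellexp l).
  move=> lS; rewrite inner_suml//; last exact: L2_cellexp.
  rewrite (bigD1_seq l) ?fset_uniq//= innerZl; [|exact: L2_cellexp..].
  rewrite cellexp_orthogonal eqxx big1 ?addr0; first by rewrite mulrC.
  move=> k kl; rewrite innerZl; [|exact: L2_cellexp..].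
  by rewrite cellexp_orthogonal (negbTE kl) mulr0.
have fg : inner f g = A%:C.
  rewrite inner_conj// inner_suml// conj_sum rmorph_sum /=.
  apply: eq_bigr => l _; rewrite innerZl//; last exact: L2_cellexp.
  rewrite rmorphM /= -(inner_conj lf (L2_cellexp l)).
  by rewrite mulrC mulc_conj.
have gg : n2 g = b^-1 * A.
  apply: (@complexI R); rewrite -inner_n2 {1}/g inner_suml// rmorphM rmorph_sum /= mulr_sumr.
  rewrite big_seq [RHS]big_seq; apply: eq_bigr => l lS.
  rewrite innerZl//; last exact: L2_cellexp.
  rewrite (inner_conj (L2_cellexp l) lg).
  by rewrite gl// rmorphM /= conj_realc mulrCA mulc_conj.
have := inner_CauchySchwarz lf lg; rewrite fg gg sqn_real => h.
have A0 : 0 <= A by apply: sumr_ge0 => l _; exact: sqn_ge0.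
have [->|A1] := eqVneq A 0; first by rewrite mulr_ge0 ?n2_ge0// ltW.
by rewrite -(@ler_pM2r _ A) ?lt_neqAle 1?eq_sym ?A1//; rewrite -expr2; lra.
Qed.

Local Notation reconstructed := (weak_expansion b^-1 cellexp cellexp).

Lemma reconstructed_cellexp l : reconstructed (cellexp l).
Proof.
move=> v lv eps eps0; exists [fset l]%fset => S; rewrite fsub1set => lS.
rewrite (bigD1_seq l) ?fset_uniq//= cellexp_orthogonal eqxx big1 ?addr0; last first.
  by move=> k kl; rewrite cellexp_orthogonal eq_sym (negbTE kl) mul0r.
rewrite (inner_conj (L2_cellexp l) lv) subrr sqn0; exact: ltW.
Qed.

(** Generated by the exponentials, so that reconstruction passes to all of them by
    linearity. *)
Inductive trigpoly : (R -> R[i]) -> Prop :=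
| trigpoly_exp l : trigpoly (expi (l%:~R * b))
| trigpolyD p q : trigpoly p -> trigpoly q -> trigpoly (fun x => p x + q x)
| trigpolyZ c p : trigpoly p -> trigpoly (fun x => c * p x).

Lemma trigpolyM p q : trigpoly p -> trigpoly q -> trigpoly (fun x => p x * q x).
Proof.
move=> hp hq; elim: hp q hq => [l|p1 p2 _ IH1 _ IH2|c p1 _ IH] q hq.
- elim: hq => [k|q1 q2 _ IH1 _ IH2|c q1 _ IH].
  + rewrite (_ : (fun x => _) = expi ((l + k)%:~R * b)); first exact: trigpoly_exp.
    by apply/funext => x; rewrite intrD mulrDl expiD.
  + rewrite (_ : (fun x => _) = fun x => expi (l%:~R * b) x * q1 x + expi (l%:~R * b) x * q2 x).
      exact: trigpolyD.
    by apply/funext => x; rewrite mulrDr.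
  + rewrite (_ : (fun x => _) = fun x => c * (expi (l%:~R * b) x * q1 x)).
      exact: trigpolyZ.
    by apply/funext => x; rewrite mulrCA.
- rewrite (_ : (fun x => _) = fun x => p1 x * q x + p2 x * q x).
    by apply: trigpolyD; [exact: IH1|exact: IH2].
  by apply/funext => x; rewrite mulrDl.
- rewrite (_ : (fun x => _) = fun x => c * (p1 x * q x)).
    by apply: trigpolyZ; exact: IH.
  by apply/funext => x; rewrite mulrA.
Qed.

Lemma trigpoly_cst c : trigpoly (fun=> c).
Proof.
rewrite (_ : (fun=> c) = fun x => c * expi (0%:~R * b) x).
  by apply: trigpolyZ; exact: trigpoly_exp.
by apply/funext => x; rewrite mul0r expi0 mulr1.
Qed.

Lemma trigpolyX p n : trigpoly p -> trigpoly (fun x => p x ^+ n).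
Proof.
move=> hp; elim: n => [|n IH].
  by rewrite (_ : (fun x => _) = fun=> 1)//; exact: trigpoly_cst.
rewrite (_ : (fun x => _) = fun x => p x * p x ^+ n); first exact: trigpolyM.
by apply/funext => x; rewrite exprS.
Qed.

Lemma reconstructed_trigpoly p : trigpoly p ->
  L2 (fun x => p x * cind cell x) /\ reconstructed (fun x => p x * cind cell x).
Proof.
have le := L2_cellexp; elim => [l|p1 p2 _ [l1 h1] _ [l2 h2]|c p1 _ [l1 h1]].
- by split; [exact: L2_cellexp|exact: reconstructed_cellexp].
- rewrite (_ : (fun x => _) = fun x => p1 x * cind cell x + p2 x * cind cell x).
    by split; [exact: L2D|exact: weak_expansionD].
  by apply/funext => x; rewrite mulrDl.
- rewrite (_ : (fun x => _) = fun x => c * (p1 x * cind cell x)).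
    by split; [exact: L2Z|exact: weak_expansionZ].
  by apply/funext => x; rewrite mulrA.
Qed.

End FourierSystem.

(** * Polynomials that approximate a step *)

Section StepPolynomials.
Context {R : realType}.
Implicit Types (w t : R).

Lemma bernoulli_ineq (m : nat) t : -1 <= t -> 1 + m%:R * t <= (1 + t) ^+ m.
Proof.
move=> t1; elim: m => [|m IH]; first by rewrite mul0r addr0 expr0.
rewrite exprS -natr1; apply: (@le_trans _ _ ((1 + t) * (1 + m%:R * t))).
  have := mulr_ge0 (ler0n R m) (sqr_ge0 t); lra.
by rewrite ler_wpM2l// -lerBlDl sub0r.
Qed.

(** Polynomials in w that tend on [0, 1] to the indicator of w < 1/2, away from
    w = 1/2: the exponent 2 ^ n balances w ^ n exactly at that threshold. *)
Definition step (n : nat) w : R := (1 - w ^+ n) ^+ (2 ^ n).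

Lemma step_itv n w : 0 <= w <= 1 -> 0 <= step n w <= 1.
Proof.
move=> /andP[w0 w1]; have h0 : 0 <= w ^+ n by rewrite exprn_ge0.
have h1 : w ^+ n <= 1 by rewrite exprn_ile1.
by rewrite exprn_ge0 ?subr_ge0//= exprn_ile1 ?subr_ge0// lerBlDl lerDr.
Qed.

Lemma step_cvg1 w : 0 <= w -> w < 2^-1 -> step n w @[n --> \oo] --> (1 : R).
Proof.
move=> w0 w2; have w1 : w <= 1 by lra.
have z1 : `|2 * w| < 1 by rewrite ger0_norm ?mulr_ge0//; lra.
apply: (@squeeze_cvgr _ _ _ _ (fun n => 1 - (2 * w) ^+ n) (fun=> 1)).
- apply: nearW => n; have /andP[_ ->] := step_itv n (introT andP (conj w0 w1)); rewrite andbT.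
  have h : -1 <= - w ^+ n by rewrite lerN2 exprn_ile1.
  by have := bernoulli_ineq (2 ^ n) h; rewrite natrX mulrN -exprMn.
- rewrite -[X in _ --> X](subr0 (1 : R)); apply: cvgB; [exact: cvg_cst|exact: cvg_expr].
- exact: cvg_cst.
Qed.

Lemma step_cvg0 w : 2^-1 < w -> w <= 1 -> step n w @[n --> \oo] --> (0 : R).
Proof.
move=> w2 w1; have w0 : 0 <= w by lra.
have z1 : `|(2 * w)^-1| < 1 by rewrite ger0_norm ?invr_ge0 ?mulr_ge0// invf_lt1; lra.
apply: (@squeeze_cvgr _ _ _ _ (fun=> 0) (fun n => (2 * w)^-1 ^+ n)).
- apply: nearW => n; have /andP[s0 _] := step_itv n (introT andP (conj w0 w1)); rewrite s0 /=.
  have h0 : 0 <= w ^+ n by rewrite exprn_ge0.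
  have h1 : w ^+ n <= 1 by rewrite exprn_ile1.
  have h : -1 <= w ^+ n by lra.
  have {}h := bernoulli_ineq (2 ^ n) h; rewrite natrX -exprMn in h.
  have p : 0 < (2 * w) ^+ n by rewrite exprn_gt0//; lra.
  rewrite exprVn -[leRHS]mul1r ler_pdivlMr//.
  apply: (@le_trans _ _ (step n w * (1 + w ^+ n) ^+ (2 ^ n))).
    by apply: ler_wpM2l => //; lra.
  rewrite -exprMn exprn_ile1//; last by rewrite -subr_sqr expr1n lerBlDl lerDr sqr_ge0.
  by rewrite mulr_ge0//; lra.
- exact: cvg_cst.
- exact: cvg_expr.
Qed.

End StepPolynomials.

(** * Completeness of the Fourier system *)

Section FourierCompleteness.
Context {R : realType}.
Variables (b s : R).
Hypothesis b0 : 0 < b.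
Local Notation mu := (@lebesgue_measure R).
Local Notation cell := (`[s, s + b^-1[%classic : set R).
Local Notation reconstructed := (weak_expansion b^-1 (cellexp b s) (cellexp b s)).
Local Notation rint p := (mu.-integrable setT (EFin \o p)).
Implicit Types (f v : R -> R[i]).

Let binv0 : 0 < b^-1. Proof. by rewrite invr_gt0. Qed.

Let le := L2_cellexp s b0.
Let be := cellexp_bessel s b0.

Let reconstructed_closed f : L2 f ->
  (forall delta, 0 < delta -> exists g, [/\ L2 g, reconstructed g &
     n2 (fun x => f x - g x) <= delta]) -> reconstructed f.
Proof. by move=> lf; apply: (weak_expansion_closed (ltW binv0) (ltW binv0) be be lf). Qed.

Lemma rint_cell : rint (\1_cell : R -> R).
Proof. exact: integrable_indic_itv. Qed.

Section Threshold.
Variable q : R.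
Hypotheses (sq : s < q) (qs : q <= s + b^-1).

(** On the cell, theta and phi - theta lie in [0, pi] and ]-pi, pi] for
    theta = pi b (x - s) and phi = pi b (q - s), so that the sign of
    sin theta * sin (phi - theta) decides whether x < q; product-to-sum makes it
    a trigonometric polynomial. *)
Definition threshold (x : R) : R :=
  2^-1 - 2^-1 * (sin (pi * b * (x - s)) * sin (pi * b * (q - s) - pi * b * (x - s))).

Lemma threshold_itv x : 0 <= threshold x <= 1.
Proof.
rewrite /threshold; set t := pi * b * (x - s); set u := _ - t.
have := cos2Dsin2 t; have := cos2Dsin2 u.
have := sqr_ge0 (cos t); have := sqr_ge0 (cos u).
have := sqr_ge0 (sin t - sin u); have := sqr_ge0 (sin t + sin u).
by move=> *; apply/andP; split; lra.
Qed.

Lemma trigpoly_threshold : trigpoly b (fun x => (threshold x)%:C).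
Proof.
pose k := pi * b * (q + s); pose c := cos (pi * b * (q - s)).
pose al : R[i] := (- (8^-1) * cos k) +i* (8^-1 * sin k).
have -> : (fun x => (threshold x)%:C) = fun x => (2^-1 + 4^-1 * c)%:C +
   (al * expi (1%:~R * b) x + al^* * expi ((-1)%:~R * b) x).
  apply/funext => x; rewrite mulrNz mulNr -expi_conj -rmorphM mul1r.
  have E (z : R[i]) : z + z^* = (2 * complex.Re z)%:C.
    by case: z => z1 z2; apply/eqP; rewrite eq_complex /=; apply/andP; split; apply/eqP; ring.
  rewrite E -rmorphD /expi /al /=; congr (_%:C).
  have -> : 2 * pi * b * x = pi * b * (x - s) + pi * b * (x - s) + 2 * (pi * b * s) by ring.
  rewrite /threshold /c /k.
  have -> : pi * b * (q + s) = pi * b * (q - s) + 2 * (pi * b * s) by ring.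
  move: (pi * b * (x - s)) (pi * b * (q - s)) (2 * (pi * b * s)) => t p z.
  rewrite !(sinB, cosD, sinD).
  have := cos2Dsin2 z; have := cos2Dsin2 t.
  move: (sin t) (cos t) (sin p) (cos p) (sin z) (cos z) => st ct sp cp sz cz ht hz.
  have Hz : cz ^+ 2 = 1 - sz ^+ 2 by rewrite -hz addrK.
  have Ht : ct ^+ 2 = 1 - st ^+ 2 by rewrite -ht addrK.
  (* Both sides agree up to multiples of sin^2 + cos^2 - 1. *)
  transitivity (2^-1 - 2^-1 * st * (sp * ct - cp * st) + 4^-1 * cp * (1 - ct ^+ 2 - st ^+ 2)
     - 4^-1 * (cp * (ct ^+ 2 - st ^+ 2) + 2 * sp * st * ct) * (sz ^+ 2 + cz ^+ 2 - 1)).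
    by rewrite Ht Hz; ring.
  by field.
by apply: trigpolyD; [exact: trigpoly_cst|apply: trigpolyD; apply: trigpolyZ; exact: trigpoly_exp].
Qed.

Lemma trigpoly_step n : trigpoly b (fun x => (step n (threshold x))%:C).
Proof.
rewrite (_ : (fun x => _) = fun x => (1 + -1 * (threshold x)%:C ^+ n) ^+ (2 ^ n)).
  apply: trigpolyX; apply: trigpolyD; first exact: trigpoly_cst.
  by apply: trigpolyZ; apply: trigpolyX; exact: trigpoly_threshold.
by apply/funext => x; rewrite /step rmorphXn rmorphB rmorphXn rmorph1 mulN1r.
Qed.

Lemma threshold_lt x : s < x -> x < q -> threshold x < 2^-1.
Proof.
move=> sx xq; rewrite /threshold ltrBlDr ltrDl; apply: mulr_gt0; first by rewrite invr_gt0.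
have pb : 0 < pi * b by rewrite mulr_gt0 ?pi_gt0.
have bb : b * b^-1 = 1 by rewrite divff ?gt_eqF.
apply: mulr_gt0; apply: sin_gt0_pi; rewrite -?mulrBr.
  rewrite mulr_gt0 ?subr_gt0//= -mulrA gtr_pMr ?pi_gt0//.
  by rewrite -bb ltr_pM2l// ltrBlDl (lt_le_trans xq).
rewrite (_ : q - s - (x - s) = q - x); last by ring.
rewrite mulr_gt0 ?subr_gt0//= -mulrA gtr_pMr ?pi_gt0//.
by rewrite -bb ltr_pM2l// ltrBlDr (le_lt_trans qs)// addrC ltrD2l.
Qed.

Lemma threshold_gt x : q < x -> x < s + b^-1 -> 2^-1 < threshold x.
Proof.
move=> qx xs; rewrite /threshold -(opprB (pi * b * (x - s))) sinN !mulrN opprK.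
rewrite ltrDl; apply: mulr_gt0; first by rewrite invr_gt0.
have pb : 0 < pi * b by rewrite mulr_gt0 ?pi_gt0.
have bb : b * b^-1 = 1 by rewrite divff ?gt_eqF.
apply: mulr_gt0; apply: sin_gt0_pi; rewrite -?mulrBr.
  rewrite mulr_gt0 ?subr_gt0//= ?(lt_trans sq)// -mulrA gtr_pMr ?pi_gt0//.
  by rewrite -bb ltr_pM2l// ltrBlDl.
rewrite (_ : x - s - (q - s) = x - q); last by ring.
rewrite mulr_gt0 ?subr_gt0//= -mulrA gtr_pMr ?pi_gt0//.
by rewrite -bb ltr_pM2l// ltrBlDr (lt_trans xs)// addrC ltrD2l.
Qed.

(** The trigonometric polynomials step n (threshold x) converge on the cell to the
    indicator of [s, q[ except at s and q, and they stay in [0, 1]. *)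
Lemma reconstructed_itv : reconstructed (cind `[s, q[%classic).
Proof.
have lq : L2 (cind `[s, q[%classic : R -> R[i]).
  by apply: L2_cind => //; rewrite lebesgue_measure_itv /= lte_fin sq -EFinD ltry.
have sub x : `[s, q[%classic x -> cell x.
  by rewrite /= !in_itv /= => /andP[-> xq]; rewrite (lt_le_trans xq).
apply: reconstructed_closed => // delta d0.
pose g n x := (step n (threshold x))%:C * cind cell x.
have hg n := reconstructed_trigpoly s b0 (trigpoly_step n).
have E x n : cell x -> sqn (cind `[s, q[%classic x - g n x) =
    (\1_`[s, q[%classic x - step n (threshold x)) ^+ 2.
  by move=> cx; rewrite /g (cind_in cx) mulr1 /cind -rmorphB sqn_real.
have Z x n : ~ cell x -> sqn (cind `[s, q[%classic x - g n x) = 0.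
  move=> cx; rewrite /g (cind_out cx) mulr0 cind_out ?subrr ?sqn0//.
  by move=> /sub.
have [n hn] : exists n, n2 (fun x => cind `[s, q[%classic x - g n x) <= delta.
  apply: (n2_cvg (G := \1_cell)) d0 => //.
  - by move=> n; exact: (hg n).1.
  - exact: rint_cell.
  - move=> n x; have [cx|cx] := pselect (cell x); last by rewrite Z.
    rewrite E//; have -> : \1_cell x = 1 :> R by rewrite indicE mem_set.
    have /(step_itv n)/andP[h1 h2] := threshold_itv x.
    rewrite indicE; case: (_ \in _) => /=; nra.
  exists [set s; q]; split.
  - by apply: measurableU.
  - by apply: countable_lebesgue_measure0; apply: finite_set_countable; rewrite finite_setU; split; exact: finite_set1.
  move=> x /=; apply: contra_notP => /not_orP[xs xq].
  have [cx|cx] := pselect (cell x); last first.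
    rewrite (_ : (fun n => _) = fun=> 0); first exact: cvg_cst.
    by apply/funext => n; rewrite Z.
  rewrite (_ : (fun n => _) = fun n => (\1_`[s, q[%classic x - step n (threshold x)) ^+ 2); last first.
    by apply/funext => n; rewrite E.
  have sx : s < x by move: cx; rewrite /= in_itv /= => /andP[+ _]; rewrite le_eqVlt => /orP[/eqP/esym|].
  have xsb : x < s + b^-1 by move: cx; rewrite /= in_itv /= => /andP[].
  have /andP[h1 h2] := threshold_itv x.
  have [xlq|qlx|/xq//] := ltgtP x q.
    rewrite indicE mem_set /=; last by rewrite in_itv /= (ltW sx).
    rewrite (_ : (0 : R) = (1 - 1) * (1 - 1)); last by rewrite subrr mulr0.
    by apply: cvgM; (apply: cvgB; [exact: cvg_cst|apply: step_cvg1 => //; exact: threshold_lt]).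
  rewrite indicE memNset /=; last by rewrite in_itv /= => /andP[_]; rewrite ltNge ltW.
  rewrite (_ : (0 : R) = (0 - 0) * (0 - 0)); last by rewrite subrr mulr0.
  by apply: cvgM; (apply: cvgB; [exact: cvg_cst|apply: step_cvg0 => //; exact: threshold_gt]).
by exists (g n); split=> //; [exact: (hg n).1|exact: (hg n).2].
Qed.

End Threshold.

Let mcell : measurable cell. Proof. exact: measurable_itv. Qed.

Let L2_cell A : measurable A -> L2 (cind (A `&` cell) : R -> R[i]).
Proof.
move=> mA; have := L2_mul_cind mA (L2_cind mcell (cell_lty s b0)).
by congr L2; apply/funext => x; rewrite cindM setIC.
Qed.

Lemma reconstructed_cell : reconstructed (cind cell).
Proof.
rewrite (_ : cind cell = cellexp b s 0); first exact: reconstructed_cellexp.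
by apply/funext => x; rewrite /cellexp mul0r expi0 mul1r.
Qed.

(** Up to intersection with the cell, the half-lines [q, +oo[ generate the Borel
    sets and are reconstructed; reconstruction is stable under complements and, by
    closedness, under countable disjoint unions: the Dynkin class argument. *)
Lemma reconstructed_indic A : measurable A -> reconstructed (cind (A `&` cell)).
Proof.
have rc := reconstructed_cell.
have lc : L2 (cind cell : R -> R[i]) by have := L2_cell measurableT; rewrite setTI.
move=> mA; have {mA} : <<s @RGenCInfty.G R >> A.
  have mA' : (@RGenCInfty.G R).-sigma.-measurable A by rewrite -RGenCInfty.measurableE.
  exact: mA'.
move: A; apply: (@dynkin_induction _ (measurableTypeR R)).
- exact: RGenCInfty.measurableE.
- move=> _ _ [x ->] [y ->]; exists (Num.max x y); apply/seteqP; split => z /=.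
    by rewrite !in_itv /= !andbT ge_max => -[-> ->].
  by rewrite !in_itv /= !andbT ge_max => /andP[].
- by rewrite setTI.
- move=> _ [q ->]; have [qs|sq] := leP q s.
    rewrite (_ : _ `&` _ = cell)//; apply: setIidr => x /=.
    by rewrite !in_itv /= andbT => /andP[/(le_trans qs)].
  have [sbq|qsb] := leP (s + b^-1) q.
    rewrite (_ : cind _ = fun=> 0); first exact: weak_expansion0.
    apply/funext => x; rewrite cind_out//= !in_itv /= andbT => -[qx /andP[_ xs]].
    by have := lt_le_trans xs (le_trans sbq qx); rewrite ltxx.
  rewrite (_ : cind _ = fun x => cind cell x - cind `[s, q[%classic x).
    apply: weak_expansionB => //; last exact (reconstructed_itv sq (ltW qsb)).
    by apply: L2_cind => //; rewrite lebesgue_measure_itv /= lte_fin sq -EFinD ltry.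
  apply/funext => x; rewrite /cind -rmorphB; congr (_%:C); rewrite !indicE.
  rewrite in_setI !mem_setE !in_itv /= andbT.
  case: (leP q x) => [qx|xq] /=; first by rewrite andbF subr0.
  by rewrite (lt_trans xq qsb) subrr.
- move=> A mA rA.
  rewrite (_ : cind _ = fun x => cind cell x - cind (A `&` cell) x).
    by apply: weak_expansionB => //; exact: L2_cell.
  apply/funext => x; rewrite /cind -rmorphB; congr (_%:C).
  rewrite !indicE !in_setI in_setC.
  by case: (x \in A); case: (x \in cell); rewrite /= ?mulr0n ?subr0 ?subrr.
move=> F mF tF rF.
apply: reconstructed_closed; first by apply: L2_cell; exact: bigcupT_measurable.
move=> delta d0; pose g n x := \sum_(k <- iota 0 n) cind (F k `&` cell) x : R[i].
have lg n : L2 (g n) by apply: L2_sum => k; apply: L2_cell; exact: mF.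
(* At most one F k contains x, so the partial sum is 1 as soon as it is reached. *)
have gE n x k : F k x -> g n x = if (k < n)%N then cind cell x else 0.
  move=> Fk; have Fj j : j != k -> cind (F j `&` cell) x = 0 :> R[i].
    move=> jk; apply: cind_out => -[Fjx _].
    by move/eqP: jk; apply; apply: tF => //; exists x.
  case: ifP => kn.
    rewrite /g (bigD1_seq k) ?iota_uniq ?mem_iota//= big1 ?addr0 => [|j /Fj//].
    by have [cx|cx] := pselect (cell x); [rewrite !cind_in|rewrite !cind_out// => -[]].
  rewrite /g big_seq big1// => j; rewrite mem_iota /= add0n => jn; apply: Fj.
  by apply: contraFneq kn => <-.
have gE0 n x : ~ (\bigcup_k F k) x -> g n x = 0.
  by move=> Fx; rewrite /g big1// => k _; apply: cind_out => -[Fk _]; apply: Fx; exists k.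
have [n hn] : exists n, n2 (fun x => cind (\bigcup_k F k `&` cell) x - g n x) <= delta.
  apply: (n2_cvg (G := \1_cell)) d0 => //.
  - by apply: L2_cell; exact: bigcupT_measurable.
  - exact: rint_cell.
  - move=> n x; have [[k _ Fk]|Fx] := pselect ((\bigcup_k F k) x); last first.
      by rewrite gE0// cind_out ?subrr ?sqn0// => -[].
    rewrite (gE _ _ _ Fk); have [cx|cx] := pselect (cell x); last first.
      by rewrite !cind_out ?if_same ?subrr ?sqn0// => -[].
    rewrite !cind_in//; last by split=> //; exists k.
    rewrite (_ : \1_cell x = 1 :> R); last by rewrite indicE mem_set.
    by case: ifP => _; rewrite ?subrr ?subr0 ?sqn0// sqn_real expr1n.
  apply: aeW => x; have [[k _ Fk]|Fx] := pselect ((\bigcup_k F k) x); last first.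
    rewrite (_ : (fun n => _) = fun=> 0); first exact: cvg_cst.
    by apply/funext => n; rewrite gE0// cind_out ?subrr ?sqn0// => -[].
  apply: cvg_near_cst; exists k.+1 => // n /= kn.
  rewrite (gE _ _ _ Fk) kn; have [cx|cx] := pselect (cell x).
    by rewrite !cind_in ?subrr ?sqn0//; split=> //; exists k.
  by rewrite !cind_out ?subrr ?sqn0// => -[].
exists (g n); split=> //.
by apply: weak_expansion_sum => // k; apply: L2_cell; exact: mF.
Qed.

Import HBNNSimple.

Let reconstructed_sfun (p : {nnsfun (measurableTypeR R) >-> R}) :
  L2 (fun x => (p x)%:C * cind cell x) /\ reconstructed (fun x => (p x)%:C * cind cell x).
Proof.
have E : (fun x => (p x)%:C * cind cell x) = fun x =>
    \sum_(y <- fset_set (range p)) y%:C * cind (p @^-1` [set y] `&` cell) x.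
  apply/funext => x; rewrite fimfunE fsbig_finite//= rmorph_sum mulr_suml.
  by apply: eq_bigr => y _; rewrite rmorphM -mulrA cindM.
have mp y : measurable (p @^-1` [set y]) by exact: measurable_sfunP.
rewrite E; split; first by apply: L2_sum => y; apply: L2Z; exact: L2_cell (mp y).
apply: weak_expansion_sum => // y; first by apply: L2Z; exact: L2_cell (mp y).
by apply: weak_expansionZ => //; [exact: L2_cell (mp y)|exact: reconstructed_indic (mp y)].
Qed.

Let reconstructed_ge0 (p : R -> R) : measurable_fun setT p -> (forall x, 0 <= p x) ->
  L2 (fun x => (p x)%:C) -> reconstructed (fun x => (p x)%:C * cind cell x).
Proof.
move=> mp p0 lp; have lpc := L2_mul_cind mcell lp.
apply: reconstructed_closed => // delta d0.
have mpE : measurable_fun setT (EFin \o p) by exact/measurable_EFinP.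
pose phi := @nnsfun_approx _ (measurableTypeR R) R setT measurableT _ mpE.
have phi_le n x : phi n x <= p x.
  by rewrite -lee_fin /phi nnsfun_approxE; apply: le_approx => // y _; rewrite lee_fin.
have phi_cvg x : phi n x @[n --> \oo] --> p x.
  have /fine_cvgP[_] := @cvg_nnsfun_approx _ (measurableTypeR R) R setT measurableT _ mpE
    (fun y _ => p0 y) x I.
  exact.
have [n hn] : exists n, n2 (fun x => (p x)%:C * cind cell x - (phi n x)%:C * cind cell x) <= delta.
  apply: (n2_cvg (G := fun x => sqn (p x)%:C)) d0 => //.
  - by move=> n; exact: (reconstructed_sfun (phi n)).1.
  - exact: L2_sqn.
  - move=> n x; rewrite -mulrBl sqnM -rmorphB !sqn_real.
    apply: (@le_trans _ _ ((p x - phi n x) ^+ 2)).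
      by apply: ler_piMr; [exact: sqr_ge0|rewrite -sqn_real; exact: sqn_cind_le].
    by have := phi_le n x; have : 0 <= phi n x by []; nra.
  apply: aeW => x; rewrite (_ : (fun n => _) = fun n => (p x - phi n x) * (p x - phi n x) * sqn (cind cell x)); last first.
    by apply/funext => n; rewrite -mulrBl sqnM -rmorphB sqn_real expr2.
  rewrite (_ : (0 : R) = (p x - p x) * (p x - p x) * sqn (cind cell x)); last by rewrite subrr !mul0r.
  apply: cvgM; last exact: cvg_cst.
  by apply: cvgM; (apply: cvgB; [exact: cvg_cst|exact: phi_cvg]).
by exists (fun x => (phi n x)%:C * cind cell x); split=> //; [exact: (reconstructed_sfun (phi n)).1|exact: (reconstructed_sfun (phi n)).2].
Qed.

Let reconstructed_real (p : R -> R) : L2 (fun x => (p x)%:C) ->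
  reconstructed (fun x => (p x)%:C * cind cell x).
Proof.
move=> lp; have [mp _] := L2_cmeas lp; rewrite /= in mp.
have part (q : R -> R) : measurable_fun setT q -> (forall x, 0 <= q x <= `|p x|) ->
    L2 (fun x => (q x)%:C * cind cell x) /\ reconstructed (fun x => (q x)%:C * cind cell x).
  move=> mq qp.
  have lq : L2 (fun x => (q x)%:C).
    apply/L2P; split; first exact: cmeas_real.
    apply: rint_le (L2_sqn lp); first by apply: cmeas_sqn; exact: cmeas_real.
    move=> x; rewrite ger0_norm ?sqn_ge0// !sqn_real -[leRHS]real_normK ?num_real//.
    by have /andP[? ?] := qp x; rewrite ler_pXn2r ?nnegrE.
  split; first exact: L2_mul_cind.
  by apply: reconstructed_ge0 => // x; have /andP[] := qp x.
have [l1 h1] : L2 (fun x => (Num.max (p x) 0)%:C * cind cell x) /\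
    reconstructed (fun x => (Num.max (p x) 0)%:C * cind cell x).
  apply: part; first by apply: measurable_maxr => //; exact: measurable_cst.
  by move=> x; rewrite le_max lexx orbT /= ge_max ler_norm normr_ge0.
have [l2 h2] : L2 (fun x => (Num.max (- p x) 0)%:C * cind cell x) /\
    reconstructed (fun x => (Num.max (- p x) 0)%:C * cind cell x).
  apply: part; first by apply: measurable_maxr; [exact: measurable_funN|exact: measurable_cst].
  by move=> x; rewrite le_max lexx orbT /= ge_max -normrN ler_norm normr_ge0.
rewrite (_ : (fun x => _) = fun x => (Num.max (p x) 0)%:C * cind cell x - (Num.max (- p x) 0)%:C * cind cell x).
  exact: weak_expansionB.
apply/funext => x; rewrite -mulrBl -rmorphB; congr (_%:C * _).
by case: (leP 0 (p x)) => h; [rewrite (max_idPr _) ?oppr_le0// subr0|rewrite (max_idPl _) ?oppr_ge0 ?ltW// sub0r opprK].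
Qed.

(** Parseval's identity on the cell. Simple functions increase to a nonnegative
    function; real and imaginary, then positive and negative parts do the rest. *)
Lemma fourier_reconstruction f : L2 f -> reconstructed (fun x => f x * cind cell x).
Proof.
move=> lf; have [m1 m2] := L2_cmeas lf.
have part (q : R -> R) : measurable_fun setT q -> (forall x, q x ^+ 2 <= sqn (f x)) ->
    L2 (fun x => (q x)%:C * cind cell x) /\ reconstructed (fun x => (q x)%:C * cind cell x).
  move=> mq qf.
  have lq : L2 (fun x => (q x)%:C).
    apply/L2P; split; first exact: cmeas_real.
    apply: rint_le (L2_sqn lf); first by apply: cmeas_sqn; exact: cmeas_real.
    by move=> x; rewrite ger0_norm ?sqn_ge0// sqn_real.
  by split; [exact: L2_mul_cind|exact: reconstructed_real].
have [l1 h1] : L2 (fun x => (complex.Re (f x))%:C * cind cell x) /\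
    reconstructed (fun x => (complex.Re (f x))%:C * cind cell x).
  by apply: part => // x; rewrite lerDl sqr_ge0.
have [l2 h2] : L2 (fun x => (complex.Im (f x))%:C * cind cell x) /\
    reconstructed (fun x => (complex.Im (f x))%:C * cind cell x).
  by apply: part => // x; rewrite lerDr sqr_ge0.
rewrite (_ : (fun x => _) = fun x => (complex.Re (f x))%:C * cind cell x +
    (0 +i* 1) * ((complex.Im (f x))%:C * cind cell x)).
  by apply: (weak_expansionD le l1 (L2Z _ l2) h1); exact: weak_expansionZ.
apply/funext => x; rewrite mulrA -mulrDl; congr (_ * _).
by case: (f x) => u v; apply/eqP; rewrite eq_complex /=; apply/andP; split; apply/eqP; ring.
Qed.

End FourierCompleteness.

(** * Double series summed by slices *)

Section Slices.
Implicit Types (S : {fset int * int}).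

Definition slice S (k : int) : {fset int} := [fset x.1 | x in S & x.2 == k]%fset.

Lemma in_slice S k l : (l \in slice S k) = ((l, k) \in S).
Proof.
apply/imfsetP/idP => [[[l' k'] /=]|lS].
  by rewrite inE /= => /andP[h /eqP <-] ->.
by exists (l, k) => //=; rewrite inE /= lS eqxx.
Qed.

Lemma sum_slice (V : nmodType) S (k : int) (F : int * int -> V) :
  \sum_(p <- S | p.2 == k) F p = \sum_(l <- slice S k) F (l, k).
Proof.
rewrite -big_filter -(big_map (fun l => (l, k)) predT F); apply: perm_big; apply: uniq_perm.
- by rewrite filter_uniq ?fset_uniq.
- by rewrite map_inj_uniq ?fset_uniq// => x y [].
move=> [l k']; rewrite mem_filter /=; apply/andP/mapP => [[/eqP -> lS]|[l' + [-> ->]]].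
  by exists l; rewrite ?in_slice.
by rewrite in_slice eqxx.
Qed.

Lemma sum_slices (V : nmodType) S (F : int * int -> V) :
  \sum_(p <- S) F p = \sum_(k <- [fset x.2 | x in S]%fset) \sum_(l <- slice S k) F (l, k).
Proof.
rewrite (partition_big_imfset _ (fun p : int * int => p.2)) /=.
by apply: eq_bigr => k _; exact: sum_slice.
Qed.

Lemma has_sum_slice {R : realType} (a : int * int -> R[i]) (k : int) (z : R[i]) :
  has_sum (fun l => a (l, k)) z -> has_sum (fun p => if p.2 == k then a p else 0) z.
Proof.
move=> h e e0; have [S0 hS0] := h e e0.
exists [fset (l, k) | l in S0]%fset => S S0S; rewrite -big_mkcond sum_slice; apply: hS0.
by apply/fsubsetP => l lS0; rewrite in_slice (fsubsetP S0S)//; apply/imfsetP; exists l.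
Qed.

(** Windows of bounded support involve finitely many translations k on a given
    cell: the Gabor series splits into finitely many Fourier series. *)
Lemma has_sum_slices {R : realType} (K : seq int) (a : int * int -> R[i]) (z : int -> R[i]) :
  uniq K -> (forall k, k \in K -> has_sum (fun l => a (l, k)) (z k)) ->
  (forall l k, k \notin K -> a (l, k) = 0) -> has_sum a (\sum_(k <- K) z k).
Proof.
move=> uK hK aK.
have := has_sum_sum (fun k kK => has_sum_slice (hK k kK)).
apply: has_sum_ext => -[l k] /=.
have [kK|kK] := boolP (k \in K).
  rewrite (bigD1_seq k)//= eqxx big1 ?addr0// => j /negbTE; by rewrite eq_sym => ->.
rewrite aK// big_seq big1// => j jK.
by case: eqP => // kj; rewrite -kj (negbTE kK) in jK.
Qed.

End Slices.

(** * Symmetric ranges of integers *)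

Section IntegerRanges.
Context {R : realType}.

Definition irange (n : nat) : seq int := [seq i%:Z - n%:Z | i <- iota 0 (2 * n).+1].

Lemma irange_uniq n : uniq (irange n).
Proof. by rewrite map_inj_uniq ?iota_uniq// => i j /addIr []. Qed.

Lemma mem_irange n (j : int) : (j \in irange n) = (- n%:Z <= j <= n%:Z).
Proof.
apply/mapP/idP => [[i + ->]|/andP[h1 h2]]; first by rewrite mem_iota; lia.
by exists (absz (j + n%:Z)); [rewrite mem_iota|]; lia.
Qed.

Lemma mem_irange_le n (j : int) : (j \in irange n) = (`|j| <= n%:Z).
Proof. by rewrite mem_irange ler_norml. Qed.

Lemma mem_irangeN n (j : int) : (- j \in irange n) = (j \in irange n).
Proof. by rewrite !mem_irange_le normrN. Qed.

Lemma mem_irange_norm n (j : int) (x : R) : `|j%:~R| <= x -> x < n%:R + 1 -> j \in irange n.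
Proof.
move=> jx xn; have := le_lt_trans jx xn; rewrite -intr_norm -[n%:R]/(n%:Z%:~R) -intrD1 ltr_int.
by rewrite ltzD1 mem_irange_le.
Qed.

End IntegerRanges.

(** * Bessel bounds for bounded windows of bounded support *)

Section GaborBessel.
Context {R : realType}.
Local Notation mu := (@lebesgue_measure R).
Local Notation rint p := (mu.-integrable setT (EFin \o p)).
Implicit Types (f g h v : R -> R[i]).

Lemma gaborE g (a b : R) (l k : int) x :
  gabor g a b (l, k) x = expi (l%:~R * b) x * g (x - k%:~R * a).
Proof. by []. Qed.

Lemma L2_gabor g (a b : R) i : L2 g -> L2 (gabor g a b i).
Proof.
move=> lg; case: i => l k; apply: (L2_mulb (M := 1)).
- exact: cmeas_expi.
- by move=> x; rewrite sqn_expi.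
- exact: L2_shift.
Qed.

Lemma rint_sum (I : Type) (s : seq I) (F : I -> R -> R) : (forall i, rint (F i)) ->
  rint (fun x => \sum_(i <- s) F i x) /\
  \int[mu]_x (\sum_(i <- s) F i x) = \sum_(i <- s) \int[mu]_x F i x.
Proof.
move=> iF; elim: s => [|i s [IH1 IH2]].
  rewrite big_nil (_ : (fun _ => _) = fun=> 0); last by apply/funext => x; rewrite big_nil.
  by split; [exact: integrable0|rewrite /Rintegral integral0].
rewrite big_cons (_ : (fun _ => _) = fun x => F i x + \sum_(j <- s) F j x); last first.
  by apply/funext => x; rewrite big_cons.
by split; [exact: rintD|rewrite RintegralD// IH2].
Qed.

(** A window living on one cell of length at most the period: each modulation
    orbit is a Fourier system on a cell, and the translates of the window do not
    overlap. *)
Lemma gabor_bessel_cell g (a b s M : R) : 0 < a -> 0 < b -> a <= b^-1 ->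
  cmeas g -> (forall x, sqn (g x) <= M) ->
  (forall x, ~ `[s, s + a[%classic x -> g x = 0) ->
  bessel (gabor g a b) (b^-1 * M).
Proof.
move=> a0 b0 ab mg gM g0.
have M0 : 0 <= M by apply: le_trans (gM 0); exact: sqn_ge0.
have lg : L2 g.
  apply: (L2_bounded (M := M)) g0 => //.
  by rewrite lebesgue_measure_itv /= lte_fin ltrDl a0 -EFinD ltry.
split; first by move=> i; exact: L2_gabor.
move=> f lf S.
pose u k x := f x * (g (x - k%:~R * a))^*.
have lu k : L2 (u k).
  rewrite /u (_ : (fun x => _) = fun x => (g (x - k%:~R * a))^* * f x); last by apply/funext => x; rewrite mulrC.
  apply: (L2_mulb (M := M)) lf; last by move=> x; rewrite sqn_conj.
  by apply: cmeas_conj; apply: L2_cmeas; exact: L2_shift.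
have E l k : inner f (gabor g a b (l, k)) = inner (u k) (cellexp b (s + k%:~R * a) l).
  rewrite !innerE; apply: eq_cint => x; rewrite gaborE /cellexp /u !rmorphM /= cind_conj.
  have [c|c] := pselect (`[s, s + a[%classic (x - k%:~R * a)).
    rewrite cind_in; first by rewrite mulr1 -mulrA; congr (_ * _); rewrite mulrC.
    move: c; rewrite /= !in_itv /= lerBrDr ltrBlDr => /andP[-> h].
    by rewrite (lt_le_trans h)// addrAC lerD2l.
  by rewrite g0// conjC0 !(mulr0, mul0r).
rewrite sum_slices.
apply: (@le_trans _ _ (\sum_(k <- [fset x.2 | x in S]%fset) b^-1 * n2 (u k))).
  apply: ler_sum => k _; under eq_bigr do rewrite E.
  exact: (cellexp_bessel (s + k%:~R * a) b0).2.
rewrite -mulr_sumr -mulrA ler_wpM2l ?invr_ge0 ?(ltW b0)//.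
have [iu <-] := rint_sum [fset x.2 | x in S]%fset (fun k => L2_sqn (lu k)).
rewrite /n2 -RintegralZl//; last exact: L2_sqn.
apply: le_Rintegral => //; first by apply: rintZ; exact: L2_sqn.
move=> x _.
under eq_bigr do rewrite sqnM sqn_conj.
rewrite -mulr_sumr mulrC ler_wpM2r ?sqn_ge0//.
have [[k [kS gk]]|H] := pselect (exists k, k \in [fset x.2 | x in S]%fset /\ g (x - k%:~R * a) <> 0); last first.
  by rewrite big_seq big1// => k kS; have [->|/eqP gk] := eqVneq (g (x - k%:~R * a)) 0; [rewrite sqn0|case: H; exists k].
rewrite (bigD1_seq k) ?fset_uniq//= big1 ?addr0//.
have c (j : int) : g (x - j%:~R * a) <> 0 -> `[s, s + a[%classic (x - j%:~R * a).
  by move=> gj; apply: contrapT => /g0.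
move=> j /eqP jk; have [->|/eqP/c cj] := eqVneq (g (x - j%:~R * a)) 0; first by rewrite sqn0.
have ck := c _ gk; exfalso; apply: jk.
move: cj ck; rewrite /= !in_itv /= => /andP[h1 h2] /andP[h3 h4].
have h5 : (j - k)%:~R * a < a by rewrite intrB mulrBl; lra.
have h6 : (k - j)%:~R * a < a by rewrite intrB mulrBl; lra.
rewrite gtr_pMl// -[1]/(1%:~R) ltr_int in h5; rewrite gtr_pMl// -[1]/(1%:~R) ltr_int in h6.
by clear -h5 h6; lia.
Qed.

Lemma gaborD g1 g2 (a b : R) i x :
  gabor (fun x => g1 x + g2 x) a b i x = gabor g1 a b i x + gabor g2 a b i x.
Proof. by case: i => l k; rewrite !gaborE mulrDr. Qed.

Lemma innerDr f g h : L2 f -> L2 g -> L2 h ->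
  inner f (fun x => g x + h x) = inner f g + inner f h.
Proof.
move=> lf lg lh; rewrite (inner_conj lf (L2D lg lh)) innerDl// rmorphD /=.
by rewrite -(inner_conj lf lg) -(inner_conj lf lh).
Qed.

Lemma gabor_besselD g1 g2 (a b B1 B2 : R) : L2 g1 -> L2 g2 ->
  bessel (gabor g1 a b) B1 -> bessel (gabor g2 a b) B2 ->
  bessel (gabor (fun x => g1 x + g2 x) a b) (2 * B1 + 2 * B2).
Proof.
move=> l1 l2 h1 h2; split; first by move=> i; apply: L2_gabor; exact: L2D.
move=> f lf S; have {}h1 := h1.2 f lf S; have {}h2 := h2.2 f lf S.
apply: (@le_trans _ _ (2 * \sum_(i <- S) sqn (inner f (gabor g1 a b i)) +
    2 * \sum_(i <- S) sqn (inner f (gabor g2 a b i)))); last first.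
  rewrite (_ : _ * n2 f = 2 * (B1 * n2 f) + 2 * (B2 * n2 f)); last by ring.
  by apply: lerD; rewrite ler_pM2l.
rewrite !mulr_sumr -big_split /=; apply: ler_sum => i _.
have -> : gabor (fun x => g1 x + g2 x) a b i = fun x => gabor g1 a b i x + gabor g2 a b i x.
  by apply/funext => x; exact: gaborD.
by rewrite innerDr//; [exact: sqnD_le|exact: L2_gabor..].
Qed.

Lemma L2_itv_bounded g (M x y : R) : cmeas g -> (forall x, sqn (g x) <= M) ->
  (forall z, ~ `[x, y[%classic z -> g z = 0) -> L2 g.
Proof.
move=> mg gM g0; apply: (L2_bounded (M := M)) g0 => //.
by rewrite lebesgue_measure_itv /=; case: ifP => _; rewrite -?EFinD ltry.
Qed.

(** Cut the support into cells of length a. *)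
Lemma gabor_bessel g (a b s M : R) (n : nat) : 0 < a -> 0 < b -> a <= b^-1 ->
  cmeas g -> (forall x, sqn (g x) <= M) ->
  (forall x, ~ `[s, s + n%:R * a[%classic x -> g x = 0) ->
  exists2 B, 0 <= B & bessel (gabor g a b) B.
Proof.
move=> a0 b0 ab; elim: n g s => [|n IH] g s mg gM g0.
  have M0 : 0 <= M by apply: le_trans (gM 0); exact: sqn_ge0.
  exists (b^-1 * M); first by rewrite mulr_ge0// invr_ge0 ltW.
  apply: (gabor_bessel_cell (s := s)) => // x _; apply: g0.
  by rewrite /= in_itv /= mul0r addr0 => /andP[h1 h2]; have := le_lt_trans h1 h2; rewrite ltxx.
pose A : set R := `[s, s + a[%classic.
pose g1 x := g x * cind A x; pose g2 x := g x * cind (~` A) x.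
have mA : measurable A by exact: measurable_itv.
have m1 : cmeas g1 by apply: cmeasM => //; exact: cmeas_cind.
have m2 : cmeas g2 by apply: cmeasM => //; apply: cmeas_cind; exact: measurableC.
have gcM (X : set R) x : sqn (g x * cind X x) <= M.
  by rewrite sqnM; apply: le_trans (gM x); apply: ler_piMr; [exact: sqn_ge0|exact: sqn_cind_le].
have g10 x : ~ A x -> g1 x = 0 by move=> Ax; rewrite /g1 cind_out// mulr0.
have g20 x : ~ `[s + a, (s + a) + n%:R * a[%classic x -> g2 x = 0.
  move=> h; rewrite /g2; have [Ax|Ax] := pselect (A x); first by rewrite cind_out ?mulr0//; apply.
  rewrite g0 ?mul0r// => h'; apply: h; move: h' Ax.
  rewrite /A /= !in_itv /= => /andP[-> h] /negP; rewrite -leNgt => ->.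
  by rewrite /= (_ : s + a + n%:R * a = s + n.+1%:R * a)// -natr1; ring.
have [B2 B20 hB2] := IH g2 (s + a) m2 (gcM _) g20.
have hB1 := gabor_bessel_cell a0 b0 ab m1 (gcM A) g10.
have M0 : 0 <= M by apply: le_trans (gM 0); exact: sqn_ge0.
exists (2 * (b^-1 * M) + 2 * B2).
  by rewrite addr_ge0// mulr_ge0// mulr_ge0// invr_ge0 ltW.
rewrite (_ : g = fun x => g1 x + g2 x).
  apply: gabor_besselD => //.
  - exact: (L2_itv_bounded m1 (gcM A) g10).
  - exact: (L2_itv_bounded m2 (gcM (~` A)) g20).
apply/funext => x; rewrite /g1 /g2; have [Ax|Ax] := pselect (A x).
  by rewrite cind_in// cind_out ?mulr0 ?mulr1 ?addr0//; apply.
by rewrite cind_out// cind_in// mulr0 mulr1 add0r.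
Qed.

End GaborBessel.

(** * Inner products with Gabor systems as Fourier coefficients *)

Section Janssen.
Context {R : realType}.
Variables (a b : R).
Hypothesis b0 : 0 < b.
Local Notation T := (b^-1).
Local Notation cell s := (`[s, s + T[%classic : set R).
Implicit Types (f g h v u : R -> R[i]).

Let T0 : 0 < T. Proof. by rewrite invr_gt0. Qed.

Lemma cell_index (s x : R) : exists j : int, cell s (x - j%:~R * T).
Proof.
exists (Num.floor ((x - s) * b)); have /andP[] := floor_itv ((x - s) * b).
rewrite intrD1 /= in_itv /= => h1 h2; apply/andP; split.
  have : (Num.floor ((x - s) * b))%:~R * T <= x - s by rewrite ler_pdivrMr.
  by lra.
have : x - s < ((Num.floor ((x - s) * b))%:~R + 1) * T by rewrite ltr_pdivlMr.
by rewrite mulrDl mul1r; lra.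
Qed.

Lemma cell_index_uniq (s x : R) (i j : int) :
  cell s (x - i%:~R * T) -> cell s (x - j%:~R * T) -> i = j.
Proof.
rewrite /= !in_itv /= => /andP[h1 h2] /andP[h3 h4].
have h5 : (j - i)%:~R * T < T by rewrite intrB mulrBl; lra.
have h6 : (i - j)%:~R * T < T by rewrite intrB mulrBl; lra.
rewrite gtr_pMl// -[1]/(1%:~R) ltr_int in h5; rewrite gtr_pMl// -[1]/(1%:~R) ltr_int in h6; lia.
Qed.

(** A sum over finitely many cells sees each point at most once. *)
Lemma sum_cells (s x : R) (n : nat) (F : R[i]) :
  (F <> 0 -> exists2 j, j \in irange n & cell s (x - j%:~R * T)) ->
  \sum_(j <- irange n) F * cind (cell s) (x - j%:~R * T) = F.
Proof.
move=> h; have [->|/eqP/h[j jn cj]] := eqVneq F 0.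
  by rewrite big1// => j _; rewrite mul0r.
rewrite (bigD1_seq j) ?irange_uniq//= cind_in// mulr1 big1 ?addr0// => i /eqP ij.
by rewrite cind_out ?mulr0// => ci; apply: ij; exact: cell_index_uniq ci cj.
Qed.

Lemma cintegrable_mul_cind u (A : set R) : measurable A -> cintegrable u ->
  cintegrable (fun x => u x * cind A x).
Proof.
move=> mA iu; have [m1 m2] := cmeasM (cintegrable_cmeas iu) (cmeas_cind mA); case: iu => u1 u2.
have n1 := integrable_norm u1; have n2 := integrable_norm u2.
have E x (p : R) : `|p * \1_A x| <= `|p|.
  by rewrite normrM ler_piMr// indicE; case: (_ \in _); rewrite ?normr1 ?normr0.
split; [apply: rint_le n1 => // x|apply: rint_le n2 => // x]; rewrite /= /cind;
  by case: (u x) => p q /=; rewrite mulr0 ?subr0 ?add0r E.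
Qed.

Lemma cint_periodize (s : R) u (n : nat) : cintegrable u ->
  (forall x, u x <> 0 -> exists2 j, j \in irange n & cell s (x - j%:~R * T)) ->
  cint u = cint (fun x => (\sum_(j <- irange n) u (x + j%:~R * T)) * cind (cell s) x).
Proof.
move=> iu hu.
have mc : measurable (cell s) by exact: measurable_itv.
pose F (j : int) x := u (x + j%:~R * T) * cind (cell s) x.
have iF j : cintegrable (F j) by apply: cintegrable_mul_cind => //; exact: (cint_shift _ iu).1.
pose G (j : int) x := F j (x + - (j%:~R * T)).
have [iG hG] : (forall j, cintegrable (G j)) /\ (forall j, cint (G j) = cint (F j)).
  by split => j; have [] := cint_shift (- (j%:~R * T)) (iF j).
have -> : cint u = cint (fun x => \sum_(j <- irange n) G j x).
  apply: eq_cint => x; rewrite -{1}(sum_cells (hu x)); apply: eq_bigr => j _.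
  by rewrite /G /F subrK.
rewrite (cint_sum _ iG).2 (eq_bigr _ (fun j _ => hG j)) -(cint_sum _ iF).2.
by apply: eq_cint => x; rewrite mulr_suml.
Qed.

(** Janssen's representation: on a cell of length 1/b the modulations form a
    Fourier system, so that Parseval in l turns the inner products with the
    Gabor systems of h and g into integrals of products over the cell. *)
Lemma janssen (s M : R) f h g v (n n' : nat) :
  cmeas g -> (forall x, sqn (g x) <= M) -> L2 g -> L2 v ->
  (forall x, ~ cell s x -> f x = 0) ->
  (forall k : int, L2 (fun x => f x * (h (x - k%:~R * a))^*)) ->
  (forall (k : int) x, k \notin irange n -> f x * (h (x - k%:~R * a))^* = 0) ->
  (forall (k : int) x, k \in irange n -> g (x - k%:~R * a) <> 0 ->
     exists2 j, j \in irange n' & cell s (x - j%:~R * T)) ->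
  has_sum (fun i => inner f (gabor h a b i) * (inner v (gabor g a b i))^*)
    (\sum_(k <- irange n) T%:C * cint (fun x => f x * (h (x - k%:~R * a))^* *
       (\sum_(j <- irange n') v (x + j%:~R * T) * (g (x + j%:~R * T - k%:~R * a))^*)^*)).
Proof.
move=> mg gM lg lv f0 lu hn gn.
have mc : measurable (cell s) by exact: measurable_itv.
pose u (k : int) x := f x * (h (x - k%:~R * a))^*.
pose vg (k : int) x := v x * (g (x - k%:~R * a))^*.
pose W (k : int) x := \sum_(j <- irange n') vg k (x + j%:~R * T).
pose w k x := W k x * cind (cell s) x.
have lvg k : L2 (vg k).
  rewrite (_ : vg k = fun x => (g (x - k%:~R * a))^* * v x); last by apply/funext => x; rewrite /vg mulrC.
  apply: (L2_mulb (M := M)) lv; last by move=> x; rewrite sqn_conj.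
  by apply: cmeas_conj; apply: L2_cmeas; exact: L2_shift.
have lW k : L2 (W k) by apply: L2_sum => j; exact: (L2_shift _ (lvg k)).
have lw k : L2 (w k) by exact: L2_mul_cind.
have uc k : (fun x => u k x * cind (cell s) x) = u k.
  apply/funext => x; have [cx|cx] := pselect (cell s x); first by rewrite cind_in// mulr1.
  by rewrite /u f0// !mul0r.
have E1 l k : inner f (gabor h a b (l, k)) = inner (u k) (cellexp b s l).
  rewrite -[in RHS](uc k) !innerE; apply: eq_cint => x.
  rewrite gaborE /cellexp /u !rmorphM /= cind_conj.
  have [cx|cx] := pselect (cell s x); last by rewrite f0// !mul0r.
  by rewrite cind_in// !mulr1 -mulrA; congr (_ * _); rewrite mulrC.
have E2 l k : k \in irange n -> inner v (gabor g a b (l, k)) = inner (w k) (cellexp b s l).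
  move=> kn; rewrite !innerE (cint_periodize (s := s) (n := n')).
  - apply: eq_cint => x; rewrite /w /W /cellexp !mulr_suml; apply: eq_bigr => j _.
    rewrite gaborE expi_shift expi_period ?gt_eqF// mulr1 /vg !rmorphM /= cind_conj.
    have [cx|cx] := pselect (cell s x); last by rewrite cind_out// !(mulr0, mul0r).
    by rewrite cind_in// !mulr1 -mulrA; congr (_ * _); rewrite mulrC.
  - by apply: L2_mul_cintegrable => //; exact: L2_gabor.
  - move=> x ux; apply: gn kn _ => gx; apply: ux.
    by rewrite gaborE gx mulr0 conjC0 mulr0.
have E3 k : inner (u k) (w k) = cint (fun x => f x * (h (x - k%:~R * a))^* * (W k x)^*).
  rewrite innerE; apply: eq_cint => x; rewrite /w rmorphM /= cind_conj.
  by rewrite mulrA mulrAC -/(u k x) -{2}(uc k).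
apply: has_sum_slices => [|k kn|l k kn]; first exact: irange_uniq.
  have := fourier_reconstruction s b0 (lu k); rewrite -/(u k) uc => /(_ _ (lw k)).
  rewrite E3; apply: has_sum_ext => l; by rewrite E1 E2.
rewrite E1 (_ : u k = fun=> 0); last by apply/funext => x; exact: hn.
rewrite innerE (_ : (fun x => _) = fun=> 0) ?cint0 ?mul0r//.
by apply/funext => x; rewrite mul0r.
Qed.

End Janssen.

(** * The duality conditions and their sufficiency *)

Section Duality.
Context {R : realType}.
Variables (a b : R).
Hypotheses (a0 : 0 < a) (b0 : 0 < b).
Local Notation T := (b^-1).
Local Notation cell s := (`[s, s + T[%classic : set R).
Implicit Types (f g h v u : R -> R[i]).

Let T0 : 0 < T. Proof. by rewrite invr_gt0. Qed.

(** The pointwise duality conditions: the j-th one is the matrix equation that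
    couples the values of h along x + a Z with those of g along x + j / b + a Z.
    The finite range n only has to cover the k where h(x - k a) does not vanish. *)
Definition duality_at g h (x : R) : Prop := forall (j : int) (n : nat),
  (forall k : int, k \notin irange n -> h (x - k%:~R * a) = 0) ->
  \sum_(k <- irange n) g (x + j%:~R * T - k%:~R * a) * (h (x - k%:~R * a))^* =
  if j == 0 then b%:C else 0.

Lemma irange_bound (x : R) : exists n : nat, forall k : int, `|k%:~R| <= x -> k \in irange n.
Proof.
exists (Num.bound `|x|) => k kx; apply: (mem_irange_norm kx).
by rewrite (le_lt_trans (ler_norm x))// (lt_trans (archi_boundP (normr_ge0 x)))// ltrDl.
Qed.

(** For windows supported in [-C, C] and points of the cell starting at s, finitely
    many translates, and then finitely many cells, carry all the mass. *)
Lemma translate_range (s C : R) : exists n : nat, forall (k : int) x,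
  cell s x -> `|x - k%:~R * a| <= C -> k \in irange n.
Proof.
have [n hn] := irange_bound ((`|s| + T + C) / a); exists n => k x cx kx; apply: hn.
rewrite ler_pdivlMr// -[X in _ * X](gtr0_norm a0) -normrM.
have -> : k%:~R * a = x - (x - k%:~R * a) by ring.
apply: le_trans (ler_normB _ _) _; apply: lerD => //.
move: cx; rewrite /= in_itv /= => /andP[h1 h2]; rewrite ler_norml.
have := ler_norm s; have := ler_norm (- s); rewrite normrN => h3 h4.
by apply/andP; split; [have := T0; lra|have := T0; lra].
Qed.

Lemma cell_range (s C : R) (n : nat) : exists n' : nat, forall (k : int) x,
  k \in irange n -> `|x - k%:~R * a| <= C ->
  exists2 j, j \in irange n' & cell s (x - j%:~R * T).
Proof.
have [n' hn'] := irange_bound ((`|s| + T + (C + n%:R * a)) / T); exists n' => k x kn kx.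
have [j cj] := cell_index b0 s x; exists j => //; apply: hn'.
rewrite ler_pdivlMr// -[X in _ * X](gtr0_norm T0) -normrM.
have -> : j%:~R * T = x - (x - j%:~R * T) by ring.
apply: le_trans (ler_normB _ _) _; rewrite addrC; apply: lerD; last first.
  have -> : x = (x - k%:~R * a) + k%:~R * a by ring.
  apply: le_trans (ler_normD _ _) _; apply: lerD => //.
  rewrite normrM (gtr0_norm a0) ler_wpM2r ?(ltW a0)// -intr_norm -[n%:R]/(n%:Z%:~R) ler_int.
  by rewrite -mem_irange_le.
move: cj; rewrite /= in_itv /= => /andP[h1 h2]; rewrite ler_norml.
have := ler_norm s; have := ler_norm (- s); rewrite normrN => h3 h4.
by apply/andP; split; [have := T0; lra|have := T0; lra].
Qed.

Section Sufficiency.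
Variables (g h : R -> R[i]) (C Mg Mh : R).
Hypotheses (mg : cmeas g) (mh : cmeas h).
Hypotheses (gM : forall x, sqn (g x) <= Mg) (hM : forall x, sqn (h x) <= Mh).
Hypotheses (gC : forall x, C < `|x| -> g x = 0) (hC : forall x, C < `|x| -> h x = 0).
Hypothesis gh : forall x, duality_at g h x.

Lemma L2_window w M : cmeas w -> (forall x, sqn (w x) <= M) -> (forall x, C < `|x| -> w x = 0) -> L2 w.
Proof.
move=> mw wM wC; apply: (@L2_itv_bounded R w M (- C) (C + 1)) => // x /negP xC; apply: wC.
rewrite ltNge; apply: contraNN xC; rewrite ler_norml /= in_itv /= => /andP[-> h1] /=; lra.
Qed.

(** For f living on one cell the representation by Fourier coefficients is a finite
    sum of integrals; exchanging the sums over k and j exposes the duality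
    conditions, which leave the term j = 0, that is <f, v>. *)
Lemma weak_expansion_cell s f : L2 f -> (forall x, ~ cell s x -> f x = 0) ->
  weak_expansion 1 (gabor g a b) (gabor h a b) f.
Proof.
move=> lf f0 v lv; have lg := L2_window mg gM gC; have lh := L2_window mh hM hC.
have [n hn] := translate_range s C; have [n' hn'] := cell_range s C n.
have hz (k : int) x : cell s x -> k \notin irange n -> h (x - k%:~R * a) = 0.
  by move=> cx /negP kn; apply: hC; rewrite ltNge; apply/negP => /(hn k x cx).
have lu k : L2 (fun x => f x * (h (x - k%:~R * a))^*).
  rewrite (_ : (fun x => _) = fun x => (h (x - k%:~R * a))^* * f x); last by apply/funext => x; rewrite mulrC.
  apply: (L2_mulb (M := Mh)) lf; last by move=> x; rewrite sqn_conj.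
  by apply: cmeas_conj; apply: L2_cmeas; exact: L2_shift.
have := @janssen R a b b0 s Mg f h g v n n' mg gM lg lv f0 lu.
have L2F k : cintegrable (fun x => f x * (h (x - k%:~R * a))^* *
       (\sum_(j <- irange n') v (x + j%:~R * T) * (g (x + j%:~R * T - k%:~R * a))^*)^*).
  apply: (L2_mul_cintegrable (g := fun x => \sum_(j <- irange n') v (x + j%:~R * T) *
    (g (x + j%:~R * T - k%:~R * a))^*) (lu k)); apply: L2_sum => j.
  have lvg : L2 (fun y => (g (y - k%:~R * a))^* * v y).
    apply: (L2_mulb (M := Mg)) lv; last by move=> x; rewrite sqn_conj.
    by apply: cmeas_conj; apply: L2_cmeas; exact: L2_shift.
  have := L2_shift (j%:~R * T) lvg; congr L2; apply/funext => x; exact: mulrC.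
have -> : \sum_(k <- irange n) T%:C * cint (fun x => f x * (h (x - k%:~R * a))^* *
       (\sum_(j <- irange n') v (x + j%:~R * T) * (g (x + j%:~R * T - k%:~R * a))^*)^*) =
     1%:C * inner f v.
  rewrite -mulr_sumr -(cint_sum _ L2F).2 -cintZ; last exact: (cint_sum _ L2F).1.
  rewrite mul1r innerE; apply: eq_cint => x.
  have [cx|cx] := pselect (cell s x); last first.
    by rewrite f0// mul0r big1 ?mulr0// => k _; rewrite !mul0r.
  (* Exchange the two sums: the inner one is the duality condition at x. *)
  have E : \sum_(k <- irange n) f x * (h (x - k%:~R * a))^* *
       (\sum_(j <- irange n') v (x + j%:~R * T) * (g (x + j%:~R * T - k%:~R * a))^*)^* =
     f x * \sum_(j <- irange n') (v (x + j%:~R * T))^* * (if j == 0 then b%:C else 0).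
    under [in RHS]eq_bigr => j _ do rewrite -(gh j (n := n) (fun k => hz k x cx)) mulr_sumr.
    rewrite exchange_big /= mulr_sumr; apply: eq_bigr => k _.
    rewrite -mulrA; congr (_ * _); rewrite conj_sum mulr_sumr; apply: eq_bigr => j _.
    by rewrite rmorphM /= conjCK; ring.
  rewrite E (bigD1_seq 0) ?irange_uniq ?mem_irange; [|lia|by []].
  rewrite /= mul0r addr0 big1 ?addr0; last by move=> j /negbTE ->; rewrite mulr0.
  have e : T%:C * b%:C = 1 :> R[i] by rewrite -rmorphM mulVf ?gt_eqF.
  by rewrite (mulrCA T%:C) (mulrCA T%:C) e mulr1.
apply.
- move=> k x kn; have [cx|cx] := pselect (cell s x); last by rewrite f0// mul0r.
  by rewrite hz// conjC0 mulr0.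
- move=> k x kn /eqP gx; apply: hn' kn _; rewrite leNgt; apply: contra gx => /gC ->.
  by rewrite eqxx.
Qed.

Hypothesis ab : a <= T.

Lemma window_bessel w M : cmeas w -> (forall x, sqn (w x) <= M) -> (forall x, C < `|x| -> w x = 0) ->
  exists2 B, 0 <= B & bessel (gabor w a b) B.
Proof.
move=> mw wM wC; pose n := Num.bound ((`|C| + `|C| + 1) / a).
apply: (@gabor_bessel R w a b (- `|C|) M n) => // x /negP xC; apply: wC.
rewrite ltNge; apply: contraNN xC => xC; rewrite /= in_itv /=.
have := le_trans xC (ler_norm C); rewrite ler_norml => /andP[-> h1] /=.
have : (`|C| + `|C| + 1) / a < n%:R.
  by apply: archi_boundP; rewrite divr_ge0 ?ltW// !addr_ge0.
rewrite ltr_pdivrMr//; lra.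
Qed.

(** Cut f into its restrictions to the cells p / b + [0, 1 / b[; finitely many of
    them approximate f. *)
Lemma weak_expansion_gabor f : L2 f -> weak_expansion 1 (gabor g a b) (gabor h a b) f.
Proof.
move=> lf; have [Bg Bg0 hBg] := window_bessel mg gM gC; have [Bh Bh0 hBh] := window_bessel mh hM hC.
apply: (weak_expansion_closed Bg0 Bh0 hBg hBh lf) => delta d0.
pose A (p : int) : set R := `[p%:~R * T, p%:~R * T + T[%classic.
have mA p : measurable (A p) by exact: measurable_itv.
have AE p x : A p x <-> cell 0 (x - p%:~R * T).
  rewrite /A /= !in_itv /= add0r lerBrDr add0r ltrBlDr addrC; split=> //.
pose F n x := \sum_(p <- irange n) f x * cind (A p) x.
have lF n : L2 (F n) by apply: L2_sum => p; exact: L2_mul_cind.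
have [n hn] : exists n, n2 (fun x => f x - F n x) <= delta.
  have FE n x p : A p x -> F n x = if p \in irange n then f x else 0.
    move=> Ap; have Aj j : j != p -> f x * cind (A j) x = 0.
      move=> /eqP jp; rewrite cind_out ?mulr0// => Aj; apply: jp.
      by move/AE : Aj => Aj; move/AE : Ap; exact: cell_index_uniq.
    case: ifP => pn; last first.
      rewrite /F big_seq big1// => j jn; apply: Aj.
      by apply: contraFneq pn => <-.
    by rewrite /F (bigD1_seq p) ?irange_uniq//= cind_in// mulr1 big1 ?addr0.
  apply: (n2_cvg (G := fun x => sqn (f x))) d0 => //; first exact: L2_sqn.
    move=> n x; have [p /AE/FE ->] := cell_index b0 0 x.
    by case: ifP => _; rewrite ?subr0// subrr sqn0 sqn_ge0.
  apply: aeW => x; have [p /AE/FE E] := cell_index b0 0 x.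
  apply: cvg_near_cst; exists (absz p) => // n /= pn.
  by rewrite E mem_irange ifT ?subrr ?sqn0//; lia.
exists (F n); split=> //; apply: weak_expansion_sum => [i|p|p].
- exact: L2_gabor (L2_window mh hM hC).
- exact: L2_mul_cind.
- apply: (@weak_expansion_cell (p%:~R * T)); first exact: L2_mul_cind.
  by move=> x Ax; rewrite cind_out// mulr0.
Qed.

(** The weak reconstruction formula, its adjoint and the two Bessel bounds give the
    frame bounds and the convergence in norm. *)
Lemma duality_dual_frames : is_frame (gabor g a b) /\ dual_window g a b h.
Proof.
have lg := L2_window mg gM gC; have lh := L2_window mh hM hC.
have lgi i : L2 (gabor g a b i) by exact: L2_gabor.
have lhi i : L2 (gabor h a b i) by exact: L2_gabor.
have [Bg Bg0 hBg] := window_bessel mg gM gC; have [Bh Bh0 hBh] := window_bessel mh hM hC.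
have W := weak_expansion_gabor; have W' := weak_expansion_swap lhi lgi W.
have fg := weak_expansion_frame Bg0 Bh0 hBg hBh W.
have fh := weak_expansion_frame Bh0 Bg0 hBh hBg W'.
split=> //; split=> //; split=> // f lf; split.
  exact: (weak_expansion_L2 Bg0 Bh0 hBg hBh lf (W f lf)).
exact: (weak_expansion_L2 Bh0 Bg0 hBh hBg lf (W' f lf)).
Qed.

End Sufficiency.

End Duality.

(** * Almost everywhere statements *)

Section AlmostEverywhere.
Context {R : realType}.
Local Notation mu := (@lebesgue_measure R).
Local Notation rint p := (mu.-integrable setT (EFin \o p)).
Implicit Types (f g h v u : R -> R[i]).

Lemma ae_sub (P Q : R -> Prop) : (forall x, P x -> Q x) ->
  {ae mu, forall x, P x} -> {ae mu, forall x, Q x}.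
Proof.
move=> PQ [N [mN N0 hN]]; exists N; split=> // x /= Qx; apply: hN => /= Px; exact/Qx/PQ.
Qed.

Lemma ae_forall_countable (I : countType) (P : I -> R -> Prop) :
  (forall i, {ae mu, forall x, P i x}) -> {ae mu, forall x, forall i, P i x}.
Proof.
move=> h.
have : {ae mu, forall x, forall n : nat, if @choice.unpickle I n is Some i then P i x else True}.
  apply: ae_foralln => n; case: (choice.unpickle n) => [i|]; first exact: h.
  exact: aeW.
by apply: ae_sub => x hx i; have := hx (choice.pickle i); rewrite choice.pickleK.
Qed.

Lemma ae_and (P Q : R -> Prop) : {ae mu, forall x, P x} -> {ae mu, forall x, Q x} ->
  {ae mu, forall x, P x /\ Q x}.
Proof.
move=> hP hQ; have : {ae mu, forall x, forall i : bool, if i then P x else Q x}.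
  by apply: ae_forall_countable => -[].
by apply: ae_sub => x hx; split; [exact: hx true|exact: hx false].
Qed.

Lemma ae_neq (c : R) : {ae mu, forall x, x <> c}.
Proof.
exists [set c]; split=> //; first by rewrite lebesgue_measure_set1.
by move=> x /= /contrapT.
Qed.

Lemma Rintegral_ae (p q : R -> R) : measurable_fun setT p -> measurable_fun setT q ->
  {ae mu, forall x, p x = q x} -> \int[mu]_x p x = \int[mu]_x q x.
Proof.
move=> mp mq pq; rewrite /Rintegral; congr fine; apply: ae_eq_integral => //.
- exact/measurable_EFinP.
- exact/measurable_EFinP.
- by apply: ae_sub pq => x -> _.
Qed.

Lemma cint_ae u v : cmeas u -> cmeas v -> {ae mu, forall x, u x = v x} -> cint u = cint v.
Proof.
move=> [u1 u2] [v1 v2] uv; rewrite /cint; congr (_ +i* _).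
  by apply: Rintegral_ae => //; apply: ae_sub uv => x ->.
by apply: Rintegral_ae => //; apply: ae_sub uv => x ->.
Qed.

Lemma Rintegral_indic_eq0 (p : R -> R) : rint p ->
  (forall A, measurable A -> \int[mu]_x (\1_A x * p x) = 0) -> {ae mu, forall x, p x = 0}.
Proof.
move=> ip h; have := @integral_ae_eq _ _ _ mu setT measurableT (cst 0%E) (EFin \o p) ip (measurable_cst _).
move=> H; apply: ae_sub (H _) => [x /(_ I) [] //|E _ mE].
rewrite integral0 -[RHS]/(0%R%:E) -(h E mE) /Rintegral fineK.
  rewrite integral_mkcond; apply: eq_integral => x _ /=.
  by rewrite /patch indicE; case: (x \in E); rewrite ?mul1r ?mul0r.
apply: integrable_fin_num => //; apply: rint_le (integrable_norm ip).
  by apply: measurable_funM; [exact: measurable_indic|exact: rint_meas].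
move=> x; rewrite normrM ler_piMl// indicE; case: (_ \in _); rewrite ?normr1 ?normr0//.
Qed.

Lemma cint_indic_eq0 u : cintegrable u ->
  (forall A, measurable A -> cint (fun x => cind A x * u x) = 0) -> {ae mu, forall x, u x = 0}.
Proof.
move=> [u1 u2] h.
have [e1 e2] : {ae mu, forall x, complex.Re (u x) = 0} /\ {ae mu, forall x, complex.Im (u x) = 0}.
  split.
    apply: Rintegral_indic_eq0 => // A mA; have /(congr1 (@complex.Re R)) /= := h A mA.
    by move=> <-; apply: eq_Rintegral => x _; case: (u x) => p q /=; rewrite mul0r subr0.
  apply: Rintegral_indic_eq0 => // A mA; have /(congr1 (@complex.Im R)) /= := h A mA.
  by move=> <-; apply: eq_Rintegral => x _; case: (u x) => p q /=; rewrite mul0r addr0.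
by apply: ae_sub (ae_and e1 e2) => x; case: (u x) => p q /= [-> ->].
Qed.

(** The complement of the essential support is a union of countably many rational
    intervals on which the function vanishes almost everywhere. *)
Lemma ess_supp_ae h (A : set R) : ess_supp h `<=` A -> {ae mu, forall x, ~ A x -> h x = 0}.
Proof.
move=> hA; pose J (pq : rat * rat) : set R := `]ratr pq.1, ratr pq.2[%classic.
have : {ae mu, forall x, forall pq, {ae mu, forall y, J pq y -> h y = 0} -> J pq x -> h x = 0}.
  apply: ae_forall_countable => pq.
  have [H|H] := pselect {ae mu, forall y, J pq y -> h y = 0}; first by apply: ae_sub H.
  exact: aeW.
apply: ae_sub => x hx Ax.
have : ~ ess_supp h x by move/hA.
rewrite /ess_supp /= => /contrapT [U /nbhs_ballP[e /= e0 eU] hU].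
have /rat_in_itvoo[p] : x - e < x by rewrite ltrBlDr ltrDl.
have /rat_in_itvoo[q] : x < x + e by rewrite ltrDl.
rewrite !in_itv /= => /andP[q1 q2] /andP[p1 p2]; apply: (hx (p, q)).
  apply: ae_sub hU => y hy; rewrite /J /= in_itv /= => /andP[y1 y2]; apply: hy.
  by apply: eU; rewrite /ball /= ltr_distlC; apply/andP; split; lra.
by rewrite /J /= in_itv /= p2 q1.
Qed.

End AlmostEverywhere.

(** * Necessity of the duality conditions *)

Section Necessity.
Context {R : realType}.
Variables (a b : R).
Hypotheses (a0 : 0 < a) (b0 : 0 < b).
Local Notation mu := (@lebesgue_measure R).
Local Notation T := (b^-1).
Local Notation cell s := (`[s, s + T[%classic : set R).
Implicit Types (f g h v u : R -> R[i]).

Lemma sum_seq_indep (V : nmodType) (I : eqType) (s1 s2 : seq I) (F : I -> V) : uniq s1 -> uniq s2 ->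
  (forall k, k \notin s1 -> F k = 0) -> (forall k, k \notin s2 -> F k = 0) ->
  \sum_(k <- s1) F k = \sum_(k <- s2) F k.
Proof.
move=> u1 u2 h1 h2.
have E (s s' : seq I) : (forall k, k \notin s' -> F k = 0) ->
    \sum_(k <- s) F k = \sum_(k <- [seq k <- s | k \in s']) F k.
  move=> Fs'; rewrite (bigID (fun k => k \in s')) /= [X in _ + X]big1; last by move=> k; exact: Fs'.
  by rewrite addr0 big_filter.
rewrite (E s1 s2 h2) (E s2 s1 h1); apply: perm_big; apply: uniq_perm; rewrite ?filter_uniq//.
by move=> k; rewrite !mem_filter andbC.
Qed.

(** Reconstruct the indicator of a measurable subset E of the cell and test against
    the indicator of the cell translated by j / b: Fourier coefficients turn the
    series into the integral over E of the left-hand side of the j-th duality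
    condition, and reconstruction says that this is the integral of its right-hand
    side. As E is arbitrary, the j-th condition holds almost everywhere. *)
Lemma duality_ae_cell (s C M : R) g h : cmeas g -> (forall x, sqn (g x) <= M) ->
  (forall x, C < `|x| -> g x = 0) -> (forall x, C < `|x| -> h x = 0) -> L2 h ->
  (forall f v, L2 f -> L2 v ->
    has_sum (fun i => inner f (gabor h a b i) * (inner v (gabor g a b i))^*) (inner f v)) ->
  {ae mu, forall x, cell s x -> duality_at a b g h x}.
Proof.
move=> mg gM gC hC lh W; have lg := L2_window mg gM gC.
have T0 : 0 < T by rewrite invr_gt0.
have [n hn] := translate_range a0 b0 s C; have [n1 hn1] := cell_range a0 b0 s C n.
have mc : measurable (cell s) by exact: measurable_itv.
have lc : L2 (cind (cell s) : R -> R[i]) by apply: L2_cind => //; exact: cell_lty.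
have hz (k : int) x : cell s x -> k \notin irange n -> h (x - k%:~R * a) = 0.
  by move=> cx /negP kn; apply: hC; rewrite ltNge; apply/negP => /(hn k x cx).
suff : {ae mu, forall x, forall j : int, cell s x ->
    T%:C * (\sum_(k <- irange n) g (x + j%:~R * T - k%:~R * a) * (h (x - k%:~R * a))^*) =
    if j == 0 then 1 else 0}.
  apply: ae_sub => x hx cx j n2 hn2; have := hx j cx.
  have -> : \sum_(k <- irange n) g (x + j%:~R * T - k%:~R * a) * (h (x - k%:~R * a))^* =
      \sum_(k <- irange n2) g (x + j%:~R * T - k%:~R * a) * (h (x - k%:~R * a))^*.
    apply: sum_seq_indep => [||k kn|k kn]; [exact: irange_uniq|exact: irange_uniq|by rewrite hz// conjC0 mulr0|].
    by rewrite hn2// conjC0 mulr0.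
  have e : b%:C * T%:C = 1 :> R[i] by rewrite -rmorphM mulfV ?gt_eqF.
  move=> H; rewrite -[LHS]mul1r -e -mulrA H.
  by case: ifP; rewrite ?mulr1 ?mulr0.
apply: ae_forall_countable => j.
pose n' := maxn n1 (absz j).
have n'j : j \in irange n' by rewrite mem_irange /n'; lia.
have hn' (k : int) x : k \in irange n -> g (x - k%:~R * a) <> 0 ->
    exists2 i, i \in irange n' & cell s (x - i%:~R * T).
  move=> kn /eqP gx; have [|i i1 ci] := hn1 k x kn.
    by rewrite leNgt; apply: contra gx => /gC ->.
  by exists i => //; move: i1; rewrite !mem_irange /n'; lia.
pose B : set R := `[s + j%:~R * T, s + j%:~R * T + T[%classic.
have BE x : B x <-> cell s (x - j%:~R * T).
  by rewrite /B /= !in_itv /= lerBrDr ltrBlDr addrAC.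
have lB : L2 (cind B : R -> R[i]).
  by apply: L2_cind; [exact: measurable_itv|exact: (cell_lty (s + j%:~R * T) b0)].
have BI x i : cell s x -> cind B (x + i%:~R * T) = (if i == j then 1 else 0) :> R[i].
  move=> cx; case: eqP => [->|ij]; first by rewrite cind_in//; apply/BE; rewrite addrK.
  rewrite cind_out// => /BE ci; apply: ij.
  have ci' : cell s (x + i%:~R * T - i%:~R * T) by rewrite addrK.
  exact: cell_index_uniq b0 _ _ _ _ ci' ci.
pose G x := \sum_(k <- irange n) g (x + j%:~R * T - k%:~R * a) * (h (x - k%:~R * a))^*.
have lG : L2 G.
  apply: L2_sum => k; apply: (L2_mulb (M := M)).
  - apply: L2_cmeas; have := L2_shift (j%:~R * T - k%:~R * a) lg.
    by congr L2; apply/funext => x; rewrite addrA.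
  - by [].
  - by apply: L2_conj; exact: L2_shift.
pose d : R[i] := if j == 0 then 1 else 0.
pose F x := (T%:C * G x - d) * cind (cell s) x.
have iF : cintegrable F.
  have l1 := L2_mul_cind mc (L2Z T%:C lG); have l2 := L2Z d lc.
  have := L2_mul_cintegrable (L2B l1 l2) lc; congr cintegrable; apply/funext => x.
  rewrite cind_conj -mulrBl /F; have [cx|cx] := pselect (cell s x).
    by rewrite cind_in// !mulr1.
  by rewrite cind_out// !mulr0.
suff : {ae mu, forall x, F x = 0}.
  apply: ae_sub => x + cx; rewrite /F cind_in// mulr1 => /eqP.
  by rewrite subr_eq0 => /eqP.
apply: cint_indic_eq0 => // E mE; pose A := E `&` cell s.
have mA : measurable A by exact: measurableI.
have lA : L2 (cind A : R -> R[i]).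
  by have := L2_mul_cind mE lc; congr L2; apply/funext => x; rewrite cindM setIC.
have lAh k : L2 (fun x => cind A x * (h (x - k%:~R * a))^*).
  apply: (L2_mulb (M := 1)); [exact: cmeas_cind|exact: sqn_cind_le|].
  by apply: L2_conj; exact: L2_shift.
have A0 x : ~ cell s x -> cind A x = 0 :> R[i] by move=> cx; apply: cind_out => -[].
have J := @janssen R a b b0 s M (cind A) h g (cind B) n n' mg gM lg lB A0 lAh.
have hAn (k : int) x : k \notin irange n -> cind A x * (h (x - k%:~R * a))^* = 0.
  move=> kn; have [cx|cx] := pselect (cell s x); last by rewrite A0// mul0r.
  by rewrite hz// conjC0 mulr0.
have := has_sum_unique (W _ _ lA lB) (J hAn hn').
set Z := \sum_(k <- _) _ => HZ.
have lterm k : L2 (fun x => g (x + j%:~R * T - k%:~R * a) * (h (x - k%:~R * a))^*).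
  apply: (L2_mulb (M := M)).
  - apply: L2_cmeas; have := L2_shift (j%:~R * T - k%:~R * a) lg.
    by congr L2; apply/funext => x; rewrite addrA.
  - by [].
  - by apply: L2_conj; exact: L2_shift.
have lAterm k : cintegrable (fun x => cind A x * (g (x + j%:~R * T - k%:~R * a) * (h (x - k%:~R * a))^*)).
  have := L2_mul_cintegrable (lterm k) lA; congr cintegrable; apply/funext => x.
  by rewrite cind_conj mulrC.
have ZE : Z = cint (fun x => cind A x * (T%:C * G x)).
  have -> : cint (fun x => cind A x * (T%:C * G x)) =
      T%:C * cint (fun x => \sum_(k <- irange n) cind A x * (g (x + j%:~R * T - k%:~R * a) * (h (x - k%:~R * a))^*)).
    rewrite -cintZ; last exact: (cint_sum _ lAterm).1.
    by apply: eq_cint => x; rewrite /G -mulr_sumr mulrCA.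
  rewrite (cint_sum _ lAterm).2 mulr_sumr; apply: eq_bigr => k _; congr (_ * _).
  apply: eq_cint => x; have [cx|cx] := pselect (cell s x); last by rewrite A0// !mul0r.
  rewrite (bigD1_seq j) ?irange_uniq//= big1 ?addr0; last first.
    by move=> i /negbTE ij; rewrite BI// ij mul0r.
  by rewrite BI// eqxx mul1r conjCK -mulrA; congr (_ * _); rewrite mulrC.
have IE : inner (cind A) (cind B) = cint (fun x => cind A x * d) :> R[i].
  rewrite innerE; apply: eq_cint => x; rewrite cind_conj.
  have [cx|cx] := pselect (cell s x); last by rewrite A0// !mul0r.
  have := BI x 0 cx; rewrite mul0r addr0 => ->; congr (_ * _).
  by rewrite /d eq_sym.
have -> : cint (fun x => cind E x * F x) = cint (fun x => cind A x * (T%:C * G x) + -1 * (cind A x * d)).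
  apply: eq_cint => x; rewrite /F mulN1r -mulrBr mulrCA mulrC; congr (_ * _).
  exact: cindM.
rewrite cintD; last 2 first.
- have := L2_mul_cintegrable (L2Z T%:C lG) lA; congr cintegrable; apply/funext => x.
  by rewrite cind_conj mulrC.
- apply: cintegrableZ; have := L2_mul_cintegrable (L2Z d lc) lA; congr cintegrable; apply/funext => x.
  rewrite cind_conj; have [cx|cx] := pselect (cell s x); last by rewrite A0// mulr0 mul0r.
  by rewrite cind_in// mulr1 mulrC.
rewrite cintZ; last first.
  have := L2_mul_cintegrable (L2Z d lc) lA; congr cintegrable; apply/funext => x.
  rewrite cind_conj; have [cx|cx] := pselect (cell s x); last by rewrite A0// mulr0 mul0r.
  by rewrite cind_in// mulr1 mulrC.
by rewrite -ZE -HZ IE mulN1r subrr.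
Qed.

End Necessity.

(** * Shape of the window *)

Section WindowShape.
Context {R : realType}.
Variables (N a : R) (g : R -> R).
Hypotheses (N0 : 0 < N) (hg : V_window N a g).

Lemma window_continuous : continuous g. Proof. by case: hg. Qed.

Lemma window_even x : g (- x) = g x. Proof. by case: hg. Qed.

Lemma window_out x : N / 2 <= `|x| -> g x = 0.
Proof.
have [gcont gcl _ _ _] := hg.
have key y : N / 2 <= y -> g y = 0.
  move=> Ny; have [//|gy] := eqVneq (g y) 0; exfalso.
  have /nbhs_ballP[e /= e0 he] : nbhs y [set z | g z != 0].
    exact: (@cvgr_neq0 R R R (nbhs y) _ g (g y) (gcont y) gy).
  have /he gz : ball y e (y + e / 2).
    rewrite /ball /= opprD addrA subrr sub0r normrN gtr0_norm ?divr_gt0//; lra.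
  have : closure [set x | g x != 0] (y + e / 2) by exact: subset_closure.
  by rewrite gcl /= in_itv /= => /andP[_]; lra.
by case: (ger0P x) => [_|_] /key //; rewrite window_even.
Qed.

Lemma window_norm x : g `|x| = g x.
Proof. by case: (ger0P x) => // _; exact: window_even. Qed.

Lemma window_pos x : `|x| < N / 2 -> 0 < g x.
Proof.
have [_ _ _ ginc _] := hg => xN; rewrite -window_norm -window_even.
rewrite -(@window_out (- (N / 2))); last by rewrite normrN ler_norm.
have x0 := normr_ge0 x.
by apply: ginc; rewrite ?in_itv /= ?lerN2 ?oppr_le0 ?ltrN2 ?lexx ?(ltW xN) ?x0//; lra.
Qed.

Lemma window_ge0 x : 0 <= g x.
Proof. by have [/window_out ->//|/window_pos/ltW] := leP (N / 2) `|x|. Qed.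

Lemma window_decr x y : `|x| < N / 2 -> `|x| < `|y| -> g y < g x.
Proof.
have [_ _ _ ginc _] := hg => xN xy; have [/window_out ->|yN] := leP (N / 2) `|y|.
  exact: window_pos.
rewrite -(window_norm x) -(window_norm y) -(window_even `|x|) -(window_even `|y|).
have x0 := normr_ge0 x; have y0 := normr_ge0 y.
by apply: ginc; rewrite ?in_itv /= ?lerN2 ?oppr_le0 ?ltrN2 ?(ltW xN) ?(ltW yN) ?x0 ?y0.
Qed.

Lemma window_le x : g x <= g 0.
Proof.
have [->|x0] := eqVneq x 0; first exact: lexx.
by apply/ltW/window_decr; rewrite normr0 ?normr_gt0// divr_gt0.
Qed.

End WindowShape.

Lemma minimizer_seq (R : realType) (I : eqType) (s : seq I) (P : pred I) (f : I -> R) (i0 : I) :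
  i0 \in s -> P i0 -> exists i, [/\ i \in s, P i & forall j, j \in s -> P j -> f i <= f j].
Proof.
elim: s i0 => // i s IH i0.
have [/hasP[j js Pj]|/hasPn H] := boolP (has P s).
  have [k [ks Pk hk]] := IH j js Pj => _ _.
  have [/andP[Pi ik]|] := boolP (P i && (f i <= f k)).
    exists i; split; rewrite ?mem_head// => l; rewrite in_cons => /orP[/eqP ->//|ls Pl].
    by apply: le_trans ik _; exact: hk.
  rewrite negb_and => h; exists k; split; rewrite ?in_cons ?ks ?orbT// => l.
  move=> /orP[/eqP -> Pi|]; last exact: hk.
  by move: h; rewrite Pi /= -ltNge => /ltW.
rewrite in_cons => /orP[/eqP -> Pi|/H/negbTE -> //].
exists i; split; rewrite ?mem_head// => l; rewrite in_cons => /orP[/eqP ->//|/H/negbTE -> //].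
Qed.

(** * The kernel of the duality matrix *)

Section Kernel.
Context {R : realType}.
Variables (N a T : R) (g : R -> R) (m0 : nat).
Hypotheses (aN : a < N / 2) (TN : N / 2 < T).
Hypothesis diag : m0%:R * (T - a) + a / 2 < N / 2.
Implicit Types (W : int -> R) (k n : int).

Let Ta : 0 < T - a. Proof. by rewrite subr_gt0 (lt_trans aN). Qed.

(** The points x + k (T - a) are the arguments of g on the diagonal of the duality
    matrix. *)
Lemma diag_in x k : `|x| <= a / 2 -> k \in irange m0 -> `|x + k%:~R * (T - a)| < N / 2.
Proof.
move=> xa km; apply: le_lt_trans diag; rewrite addrC.
rewrite [X in `|X|]addrC; apply: le_trans (ler_normD _ _) _; rewrite addrC; apply: lerD => //.
rewrite normrM (gtr0_norm Ta) ler_wpM2r ?(ltW Ta)// -intr_norm -[m0%:R]/(m0%:Z%:~R) ler_int.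
by rewrite -mem_irange_le.
Qed.

Hypotheses (N0 : 0 < N) (hg : V_window N a g) (a0 : 0 < a).

(** The equation that the k-th column of the duality matrix imposes on a row vector
    W: since T exceeds N / 2, only the diagonal entry, at x + k (T - a), and its two
    vertical neighbours can be nonzero. *)
Definition column_eq W (x : R) (k : int) : Prop :=
  W k * g (x + k%:~R * (T - a)) + W (k + 1) * g (x + k%:~R * (T - a) + T) +
  W (k - 1) * g (x + k%:~R * (T - a) - T) = 0.

(** A nonzero kernel entry whose diagonal point y is positive and closest to the
    origin forces its upper neighbour to be nonzero with a negative diagonal
    point; the two columns then share a 2 x 2 block, and the monotonicity of g on
    both sides of the origin makes its determinant positive. *)
Lemma kernel_positive W x n : `|x| <= a / 2 ->
  (forall k, k \notin irange m0 -> W k = 0) ->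
  (forall k, k \in irange m0 -> column_eq W x k) ->
  W n != 0 -> 0 < x + n%:~R * (T - a) ->
  (forall k, W k != 0 -> `|x + n%:~R * (T - a)| <= `|x + k%:~R * (T - a)|) -> False.
Proof.
move=> xa W0 Wk Wn yn min.
have a0' := a0; have TN' := TN; have Ta' := Ta.
have inW k : W k != 0 -> k \in irange m0 by apply: contraNT => /W0 ->.
have nI := inW n Wn; have yN := diag_in xa nI.
set y := x + n%:~R * (T - a) in yn min yN.
have gy := window_pos hg yN.
have gyT : g (y + T) = 0.
  by rewrite (window_out hg)// ger0_norm; lra.
have e1 := Wk n nI; rewrite /column_eq -/y gyT mulr0 addr0 in e1.
have W1 : W (n - 1) != 0.
  apply/eqP => W1; move/eqP: e1; rewrite W1 mul0r addr0 mulf_eq0.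
  by rewrite (negbTE Wn) gt_eqF.
have gT : g (y - T) != 0.
  apply/eqP => gT; move/eqP: e1; rewrite gT mulr0 addr0 mulf_eq0.
  by rewrite (negbTE Wn) gt_eqF.
have n1I := inW _ W1; have y1N := diag_in xa n1I.
have yE : x + (n - 1)%:~R * (T - a) = y - (T - a) by rewrite /y intrB; ring.
have := min _ W1; rewrite yE in y1N *; rewrite (gtr0_norm yn) => ymin.
have y1 : y - (T - a) <= - y.
  move: ymin; case: (ger0P (y - (T - a))) => _; have := Ta; lra.
have TyN : `|y - T| < N / 2.
  by rewrite ltNge; apply: contra gT => /(window_out hg) ->.
have e2 := Wk _ n1I; rewrite /column_eq yE in e2.
have z2 : g (y - (T - a) - T) = 0.
  rewrite (window_out hg)// ler0_norm; last by lra.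
  lra.
rewrite z2 mulr0 addr0 subrK in e2.
have ya : y - (T - a) + T = y + a by ring.
rewrite ya in e2.
have key : W n * (g y * g (y - (T - a)) - g (y + a) * g (y - T)) = 0.
  transitivity ((W n * g y + W (n - 1) * g (y - T)) * g (y - (T - a)) -
    (W (n - 1) * g (y - (T - a)) + W n * g (y + a)) * g (y - T)); first by ring.
  by rewrite e1 e2 !mul0r subr0.
have h1 : g (y + a) < g y.
  by apply: (window_decr hg) => //; rewrite !gtr0_norm; lra.
have h2 : g (y - T) < g (y - (T - a)).
  apply: (window_decr hg) => //; rewrite !ler0_norm; lra.
have h3 := window_ge0 hg (y + a); have h4 := window_pos hg TyN.
have : 0 < g y * g (y - (T - a)) - g (y + a) * g (y - T) by nra.
by move=> h; move/eqP: key; rewrite mulf_eq0 (negbTE Wn) gt_eqF.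
Qed.

(** Take a nonzero entry whose diagonal point is closest to the origin. At the
    origin itself its neighbours have coefficient g (T) = 0; on the negative side,
    the reflection x -> - x, k -> - k leads back to the positive side. *)
Lemma kernel_trivial W x : `|x| <= a / 2 ->
  (forall k, k \notin irange m0 -> W k = 0) ->
  (forall k, k \in irange m0 -> column_eq W x k) -> forall k, W k = 0.
Proof.
move=> xa W0 Wk k0; have TN' := TN; have N0' := N0; apply/eqP; case: eqP => // /eqP Wk0; exfalso.
have inW k : W k != 0 -> k \in irange m0 by apply: contraNT => /W0 ->.
have [n [nI Wn nmin]] := @minimizer_seq R _ _ (fun k => W k != 0)
  (fun k : int => `|x + k%:~R * (T - a)|) k0 (inW _ Wk0) Wk0.
have min k : W k != 0 -> `|x + n%:~R * (T - a)| <= `|x + k%:~R * (T - a)|.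
  by move=> Wk'; apply: nmin => //; exact: inW.
have [yn|yn|yn] := ltgtP (x + n%:~R * (T - a)) 0; last first.
- have := Wk n nI; rewrite /column_eq yn add0r sub0r (window_even hg).
  rewrite (window_out hg (x := T)) ?mulr0 ?addr0; last by rewrite ger0_norm; lra.
  by move/eqP; rewrite mulf_eq0 (negbTE Wn) gt_eqF// (window_pos hg)// normr0 divr_gt0.
- exact: kernel_positive Wn yn min.
have yN k : - x + (- k)%:~R * (T - a) = - (x + k%:~R * (T - a)) by rewrite mulrNz; ring.
apply: (@kernel_positive (fun k => W (- k)) (- x) (- n)).
- by rewrite normrN.
- by move=> k kI; apply: W0; rewrite mem_irangeN.
- move=> k kI; have kI' : - k \in irange m0 by rewrite mem_irangeN.
  have := Wk _ kI'; rewrite /column_eq.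
  have -> : - x + k%:~R * (T - a) = - (x + (- k)%:~R * (T - a)) by rewrite -yN opprK.
  set z := x + _ => H.
  have G1 : g (- z + T) = g (z - T) by rewrite -(window_even hg) opprD opprK.
  have G2 : g (- z - T) = g (z + T) by rewrite -(window_even hg) opprB opprK addrC.
  rewrite (window_even hg) G1 G2 (_ : - (k + 1) = - k - 1); last by rewrite opprD.
  rewrite (_ : - (k - 1) = - k + 1); last by rewrite opprB addrC.
  by rewrite -[RHS]H; ring.
- by rewrite opprK.
- by rewrite yN oppr_gt0.
- move=> k Wk'; rewrite yN normrN -[k]opprK yN normrN; exact: min.
Qed.

End Kernel.

(** * Continuity of determinants and adjugates *)

Section ContinuousDeterminant.
Context {R : realType}.

Lemma continuous_bigsum (I : Type) (s : seq I) (F : I -> R -> R) :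
  (forall i, continuous (F i)) -> continuous (fun x => \sum_(i <- s) F i x).
Proof.
move=> cF; elim: s => [|i s IH].
  rewrite (_ : (fun x => _) = fun=> 0); first exact: cst_continuous.
  by apply/funext => x; rewrite big_nil.
rewrite (_ : (fun x => _) = fun x => F i x + \sum_(j <- s) F j x); last by apply/funext => x; rewrite big_cons.
by move=> x; apply: continuousD; [exact: cF|exact: IH].
Qed.

Lemma continuous_bigprod (I : Type) (s : seq I) (F : I -> R -> R) :
  (forall i, continuous (F i)) -> continuous (fun x => \prod_(i <- s) F i x).
Proof.
move=> cF; elim: s => [|i s IH].
  rewrite (_ : (fun x => _) = fun=> 1); first exact: cst_continuous.
  by apply/funext => x; rewrite big_nil.
rewrite (_ : (fun x => _) = fun x => F i x * \prod_(j <- s) F j x); last by apply/funext => x; rewrite big_cons.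
by move=> x; apply: continuousM; [exact: cF|exact: IH].
Qed.

Lemma continuous_det (n : nat) (A : R -> 'M[R]_n) :
  (forall i j, continuous (fun x => A x i j)) -> continuous (fun x => \det (A x)).
Proof.
move=> cA; rewrite /determinant; apply: continuous_bigsum => s x.
by apply: cvgM; [exact: cvg_cst|exact: continuous_bigprod].
Qed.

Lemma continuous_adj (n : nat) (A : R -> 'M[R]_n) i j :
  (forall i j, continuous (fun x => A x i j)) -> continuous (fun x => (\adj (A x)) i j).
Proof.
move=> cA; rewrite (_ : (fun x => _) = fun x => (-1) ^+ (j + i) * \det (row' j (col' i (A x)))).
  move=> x; apply: cvgM; first exact: cvg_cst.
  apply: continuous_det => k l; rewrite (_ : (fun x => _) = fun x => A x (lift j k) (lift i l)); first exact: cA.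
  by apply/funext => y; rewrite !mxE.
by apply/funext => x; rewrite mxE.
Qed.

End ContinuousDeterminant.

(** * The dual window by Cramer's rule *)

Section DualityMatrix.
Context {R : realType}.
Variables (a b : R) (g : R -> R) (m0 : nat).
Local Notation T := (b^-1).
Local Notation p := (2 * m0).+1.
Local Notation seg := (`[- (a / 2), a / 2]%classic : set R).
Local Notation D := (`[- (a / 2), a / 2[%classic : set R).

Definition ord_int (i : 'I_p) : int := i%:Z - m0%:Z.

Lemma ord_int_inj : injective ord_int.
Proof. by move=> i j /addIr [] /val_inj. Qed.

Lemma mem_ord_int i : ord_int i \in irange m0.
Proof. by rewrite mem_irange /ord_int; have := ltn_ord i; lia. Qed.

Lemma ord_intP k : k \in irange m0 -> exists i, ord_int i = k.
Proof.
rewrite mem_irange => km; have kp : (absz (k + m0%:Z)%R < p)%N by lia.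
by exists (Ordinal kp); rewrite /ord_int /=; lia.
Qed.

Lemma sum_irange_ord (V : nmodType) (F : int -> V) :
  \sum_(k <- irange m0) F k = \sum_(i < p) F (ord_int i).
Proof. by rewrite big_map -[iota 0 p]/(index_iota 0 p) big_mkord. Qed.

(** Row i is the duality condition of index i at x, in the unknowns h (x - j a). *)
Definition duality_mx (x : R) : 'M[R]_p :=
  \matrix_(i, j) g (x + (ord_int i)%:~R * T - (ord_int j)%:~R * a).

Definition ord_mid : 'I_p := inord m0.

Lemma ord_int_mid i : (ord_int i == 0) = (i == ord_mid).
Proof.
rewrite -(inj_eq val_inj) /= inordK; last by lia.
by rewrite /ord_int; lia.
Qed.

(** b times the entry of the inverse matrix that solves the duality conditions. *)
Definition dual_value (i : 'I_p) (x : R) : R :=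
  b * (\det (duality_mx x))^-1 * (\adj (duality_mx x)) i ord_mid.

Lemma seg_norm x : seg x -> `|x| <= a / 2.
Proof. by rewrite /= in_itv /= ler_norml. Qed.

Lemma D_norm x : D x -> `|x| <= a / 2.
Proof. by rewrite /= in_itv /= ler_norml => /andP[-> /ltW]. Qed.

(** The translates of D tile the line, so that at most one term is nonzero. *)
Definition dual_fun (y : R) : R := \sum_(i < p) (dual_value i \_ D) (y + (ord_int i)%:~R * a).

Hypothesis a0 : 0 < a.

Lemma D_shift x (l : int) : D x -> D (x + l%:~R * a) -> l = 0.
Proof.
rewrite /= !in_itv /= => /andP[h1 h2] /andP[h3 h4].
have h5 : l%:~R * a < a by lra.
have h6 : (- l)%:~R * a < a by rewrite mulrNz mulNr; lra.
rewrite gtr_pMl// -[1]/(1%:~R) ltr_int in h5; rewrite gtr_pMl// -[1]/(1%:~R) ltr_int in h6; lia.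
Qed.

Lemma D_index x : exists k : int, D (x - k%:~R * a).
Proof.
have ai : 0 < a^-1 by rewrite invr_gt0.
have [k] := cell_index ai (- (a / 2)) x; rewrite invrK => hk; exists k.
by move: hk; rewrite /= !in_itv /= (_ : - (a / 2) + a = a / 2)//; field.
Qed.

Lemma dual_fun_in x i : D x -> dual_fun (x - (ord_int i)%:~R * a) = dual_value i x.
Proof.
move=> Dx; rewrite /dual_fun (bigD1 i)//= subrK /patch mem_set//= big1 ?addr0// => j ji.
case: ifP => //; rewrite inE => Dj; move/negP: ji; case; apply/eqP/ord_int_inj.
have : ord_int j - ord_int i = 0.
  apply: (D_shift Dx); rewrite (_ : x + _ = x - (ord_int i)%:~R * a + (ord_int j)%:~R * a)//.
  by rewrite intrB; ring.
by move/eqP; rewrite subr_eq0 => /eqP.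
Qed.

Lemma dual_fun_out x k : D x -> k \notin irange m0 -> dual_fun (x - k%:~R * a) = 0.
Proof.
move=> Dx kI; rewrite /dual_fun big1// => j _; rewrite /patch; case: ifP => //.
rewrite inE => Dj; have : ord_int j - k = 0.
  apply: (D_shift Dx); rewrite (_ : x + _ = x - (k)%:~R * a + (ord_int j)%:~R * a)//.
  by rewrite intrB; ring.
by move/eqP; rewrite subr_eq0 => /eqP jk; move: kI; rewrite -jk mem_ord_int.
Qed.

Lemma dual_fun_supp y : (m0%:R + 2^-1) * a < `|y| -> dual_fun y = 0.
Proof.
move=> hy; rewrite /dual_fun big1// => j _; rewrite /patch; case: ifP => //.
rewrite inE => /D_norm Dj; exfalso; move: hy; apply/negP; rewrite -leNgt.
have -> : y = (y + (ord_int j)%:~R * a) - (ord_int j)%:~R * a by ring.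
apply: le_trans (ler_normB _ _) _; rewrite mulrDl addrC (mulrC 2^-1); apply: lerD => //.
rewrite normrM (gtr0_norm a0) ler_wpM2r ?(ltW a0)// -intr_norm -[m0%:R]/(m0%:Z%:~R) ler_int.
by rewrite -mem_irange_le mem_ord_int.
Qed.

End DualityMatrix.

(** * Invertibility of the duality matrix *)

Section DualWindow.
Context {R : realType}.
Variables (N a b : R) (g : R -> R) (m0 : nat).
Local Notation T := (b^-1).
Local Notation p := (2 * m0).+1.
Local Notation seg := (`[- (a / 2), a / 2]%classic : set R).
Local Notation D := (`[- (a / 2), a / 2[%classic : set R).
Local Notation duality_mx := (duality_mx a b g m0).
Local Notation dual_value := (@dual_value _ a b g m0).
Local Notation dual_fun := (dual_fun a b g m0).
Hypotheses (N0 : 0 < N) (hg : V_window N a g) (a0 : 0 < a) (b0 : 0 < b).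
Hypotheses (aN : a < N / 2) (TN : N / 2 < T).
Hypothesis diag : m0%:R * (T - a) + a / 2 < N / 2.

Lemma duality_mx_kernel (W : int -> R) x : `|x| <= a / 2 ->
  (forall k, k \notin irange m0 -> W k = 0) ->
  (forall k, k \in irange m0 ->
     \sum_(n <- irange m0) W n * g (x + n%:~R * T - k%:~R * a) = 0) ->
  forall k, W k = 0.
Proof.
move=> xa W0 Wk; apply: (kernel_trivial aN TN diag N0 hg a0 xa W0) => k kI.
have := Wk k kI; rewrite (sum_seq_indep (s2 := [:: k; k + 1; k - 1])).
- rewrite !big_cons big_nil addr0 addrA /column_eq => <-; congr (_ * g _ + _ * g _ + _ * g _).
  + by ring.
  + by rewrite intrD1; ring.
  + by rewrite intrB; ring.
- exact: irange_uniq.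
- by rewrite /= !inE; apply/andP; split; lia.
- by move=> n nI; rewrite W0// mul0r.
move=> n; rewrite !inE => nk; rewrite (window_out hg) ?mulr0//.
have := diag_in aN TN diag xa kI; set y := x + _ => yN.
have -> : x + n%:~R * T - k%:~R * a = y + (n - k)%:~R * T by rewrite /y intrB; ring.
have T0 : 0 < T by rewrite invr_gt0.
have h2 : 2 * T <= `|(n - k)%:~R * T|.
  rewrite normrM (gtr0_norm T0) ler_wpM2r ?(ltW T0)// -intr_norm -[2]/(2%:~R) ler_int.
  by clear -nk; lia.
have h3 := ler_normD (y + (n - k)%:~R * T) (- y).
rewrite addrAC subrr add0r normrN in h3.
have TN' := TN; lra.
Qed.

Lemma duality_mx_det x : `|x| <= a / 2 -> \det (duality_mx x) != 0.
Proof.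
move=> xa; apply/det0P => -[v v0 vM]; move/eqP: v0; apply.
pose W k := \sum_(i < p) (if ord_int i == k then v 0 i else 0).
have WE i : W (ord_int i) = v 0 i.
  rewrite /W (bigD1 i)//= eqxx big1 ?addr0// => j ji.
  by rewrite (inj_eq (@ord_int_inj m0)) (negbTE ji).
have W0 k : k \notin irange m0 -> W k = 0.
  move=> kI; rewrite /W big1// => i _; case: eqP => // ik.
  by move: kI; rewrite -ik mem_ord_int.
apply/matrixP => i j; rewrite (ord1 i) mxE -WE; apply: (duality_mx_kernel xa W0) => k kI.
have [l lk] := ord_intP kI; rewrite sum_irange_ord -lk.
have /matrixP/(_ 0 l) := vM; rewrite !mxE => {2}<-.
by apply: eq_bigr => n _; rewrite WE mxE.
Qed.

Lemma duality_mx_inj x (u : 'I_p -> R) : `|x| <= a / 2 ->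
  (forall i, \sum_j duality_mx x i j * u j = 0) -> forall j, u j = 0.
Proof.
move=> xa Mu j; pose v : 'cV[R]_p := \col_j u j.
have Mv : duality_mx x *m v = 0.
  apply/matrixP => i k; rewrite !mxE -[RHS](Mu i).
  by apply: eq_bigr => l _; rewrite !mxE.
have := mul_adj_mx (duality_mx x) => /(congr1 (fun A => A *m v)).
rewrite -mulmxA Mv mulmx0 mul_scalar_mx => /matrixP/(_ j 0)/esym/eqP.
by rewrite !mxE mulf_eq0 (negbTE (duality_mx_det xa)) => /eqP.
Qed.

Lemma dual_valueE x i : `|x| <= a / 2 ->
  \sum_j duality_mx x i j * dual_value j x = if ord_int i == 0 then b else 0.
Proof.
move=> xa; have d0 := duality_mx_det xa.
transitivity (b * (\det (duality_mx x))^-1 * (duality_mx x *m \adj (duality_mx x)) i (ord_mid m0)).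
  rewrite [(_ *m _) i _]mxE mulr_sumr; apply: eq_bigr => j _.
  by rewrite /dual_value mulrCA.
rewrite mul_mx_adj mxE ord_int_mid; case: (i == ord_mid m0); last by rewrite mulr0n mulr0.
by rewrite mulr1n -mulrA mulVf// mulr1.
Qed.

(** On the closed segment the determinant does not vanish, so that the entries of
    the inverse matrix are continuous, hence bounded there; the window obtained from
    them may still jump between translates of D. *)
Lemma continuous_dual_value i : {within seg, continuous (dual_value i)}.
Proof.
have cM k l : continuous (fun x => duality_mx x k l).
  rewrite (_ : (fun x => _) = fun x => g (x + ((ord_int k)%:~R * T - (ord_int l)%:~R * a))).
    move=> x; apply: continuous_comp; last exact: (window_continuous hg).
    by apply: cvgD; [exact: cvg_id|exact: cvg_cst].
  by apply/funext => x; rewrite mxE addrA.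
apply: continuous_in_subspaceT => x; rewrite inE => /seg_norm xa.
apply: cvgM; last exact: continuous_adj.
apply: cvgM; first exact: cvg_cst.
by apply: cvgV; [exact: duality_mx_det|exact: continuous_det].
Qed.

Lemma dual_value_bounded i : exists B, forall x, seg x -> `|dual_value i x| <= B.
Proof.
have sa : - (a / 2) <= a / 2 by rewrite ge0_cp// divr_ge0// ltW.
have [c1 _ h1] := EVT_max sa (@continuous_dual_value i).
have [c2 _ h2] := EVT_min sa (@continuous_dual_value i).
exists (`|dual_value i c1| + `|dual_value i c2|) => x sx.
have := h1 x sx; have := h2 x sx; have := ler_norm (dual_value i c1).
have := ler_norm (- dual_value i c2); rewrite normrN.
have := normr_ge0 (dual_value i c1); have := normr_ge0 (dual_value i c2).
by move=> *; rewrite ler_norml; apply/andP; split; lra.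
Qed.

Lemma measurable_dual_value i : measurable_fun setT (dual_value i \_ D).
Proof.
apply/(measurable_restrictT _ (measurable_itv `[- (a / 2), a / 2[)).
apply: (@measurable_funS _ _ _ _ seg) => //.
  by apply: subset_itvl; rewrite bnd_simp.
by apply: subspace_continuous_measurable_fun => //; exact: continuous_dual_value.
Qed.

Lemma measurable_dual_fun : measurable_fun setT dual_fun.
Proof.
apply: measurable_sum => i.
exact: measurableT_comp (measurable_dual_value i) (measurable_shift _).
Qed.

Lemma dual_fun_bounded : exists B, forall y, `|dual_fun y| <= B.
Proof.
have /choice[B hB] := dual_value_bounded.
exists (\sum_i `|B i|) => y; apply: le_trans (ler_norm_sum _ _ _) _.
apply: ler_sum => i _; rewrite /patch; case: ifP => [|_]; last by rewrite normr0.
rewrite inE => Dy; apply: le_trans (hB i _ _) (ler_norm _).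
by move: Dy; rewrite /= !in_itv /= => /andP[-> /ltW].
Qed.

(** The conjugated difference of two solutions has its real and imaginary parts in
    the kernel of the duality matrix. *)
Lemma duality_unique h1 h2 x : D x ->
  (forall k : int, k \notin irange m0 -> h1 (x - k%:~R * a) = 0) ->
  (forall k : int, k \notin irange m0 -> h2 (x - k%:~R * a) = 0) ->
  duality_at a b (fun x => (g x)%:C) h1 x -> duality_at a b (fun x => (g x)%:C) h2 x ->
  forall k : int, h1 (x - k%:~R * a) = h2 (x - k%:~R * a).
Proof.
move=> Dx out1 out2 d1 d2 k; have xa := D_norm Dx.
have [kI|kI] := boolP (k \in irange m0); last by rewrite out1// out2.
have [i <-] := ord_intP kI.
pose z (j : 'I_p) := (h1 (x - (ord_int j)%:~R * a) - h2 (x - (ord_int j)%:~R * a))^*.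
have E l : \sum_j (duality_mx x l j)%:C * z j = 0.
  transitivity (\sum_(k <- irange m0) (g (x + (ord_int l)%:~R * T - k%:~R * a))%:C * (h1 (x - k%:~R * a))^* -
    \sum_(k <- irange m0) (g (x + (ord_int l)%:~R * T - k%:~R * a))%:C * (h2 (x - k%:~R * a))^*).
    rewrite -sumrB sum_irange_ord; apply: eq_bigr => j _.
    by rewrite mxE -mulrBr; congr (_ * _); exact: rmorphB.
  by rewrite d1// d2// subrr.
have ERe j : complex.Re (z j) = 0.
  apply: (duality_mx_inj (u := fun j => complex.Re (z j)) xa) => l.
  rewrite -[RHS]/(complex.Re (0 : R[i])) -(E l) Re_sum.
  by apply: eq_bigr => j' _; case: (z j') => u v /=; rewrite mul0r subr0.
have EIm j : complex.Im (z j) = 0.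
  apply: (duality_mx_inj (u := fun j => complex.Im (z j)) xa) => l.
  rewrite -[RHS]/(complex.Im (0 : R[i])) -(E l) Im_sum.
  by apply: eq_bigr => j' _; case: (z j') => u v /=; rewrite mul0r addr0.
have z0 : z i = 0 by have := ERe i; have := EIm i; case: (z i) => u v /= -> ->.
apply/eqP; rewrite -subr_eq0; apply/eqP; apply: (inv_inj (@conjCK _)).
by rewrite conjC0; exact: z0.
Qed.

Hypothesis offdiag : N / 2 <= (m0%:R + 1) * T - m0%:R * a - a / 2.

(** Translating x by a multiple of a only renumbers the unknowns, so that x may be
    taken in D. The conditions of index at most m0 then form the linear system
    solved above; in the others every value of g lies outside its support. *)
Lemma duality_dual_fun x : duality_at a b (fun x => (g x)%:C) (fun x => (dual_fun x)%:C) x.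
Proof.
move=> j n hn; have [k0 Dx] := D_index a0 x; set x0 := x - _ in Dx.
have xk k : x - (k + k0)%:~R * a = x0 - k%:~R * a by rewrite /x0 intrD; ring.
rewrite (sum_seq_indep (s2 := [seq k + k0 | k <- irange m0])); last 4 first.
- exact: irange_uniq.
- by rewrite map_inj_uniq ?irange_uniq//; exact: addIr.
- by move=> k kI; rewrite hn// conjC0 mulr0.
- move=> k kI; rewrite -[k](subrK k0) xk (dual_fun_out b g a0 Dx) ?conjC0 ?mulr0//.
  by apply: contra kI => kI; apply/mapP; exists (k - k0); rewrite ?subrK.
rewrite big_map sum_irange_ord.
rewrite (eq_bigr (fun i => (g (x0 + j%:~R * T - (ord_int i)%:~R * a) * dual_value i x0)%:C)); last first.
  move=> i _; rewrite xk (dual_fun_in b g a0)// conj_realc -rmorphM; congr ((g _ * _)%:C).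
  by rewrite /x0 intrD; ring.
rewrite -rmorph_sum /=; have [jI|jI] := boolP (j \in irange m0).
  have [i ij] := ord_intP jI; have := dual_valueE i (D_norm Dx); rewrite ij => H.
  rewrite (eq_bigr (fun l => duality_mx x0 i l * dual_value l x0)); last by move=> l _; rewrite mxE ij.
  by rewrite H; case: ifP.
rewrite ifF; last by apply: contraNF jI => /eqP ->; rewrite mem_irange; lia.
rewrite big1// => i _; rewrite (window_out hg) ?mul0r//.
have xa := D_norm Dx; have T0 : 0 < T by rewrite invr_gt0.
have h1 : (m0%:R + 1) * T <= `|j%:~R * T|.
  rewrite normrM (gtr0_norm T0) ler_wpM2r ?(ltW T0)// -intr_norm -[m0%:R]/(m0%:Z%:~R) -intrD1 ler_int.
  by rewrite lezD1 ltNge -mem_irange_le.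
have h2 : `|(ord_int i)%:~R * a| <= m0%:R * a.
  rewrite normrM (gtr0_norm a0) ler_wpM2r ?(ltW a0)// -intr_norm -[m0%:R]/(m0%:Z%:~R) ler_int.
  by rewrite -mem_irange_le mem_ord_int.
have h3 := ler_normB (x0 + j%:~R * T - (ord_int i)%:~R * a) (x0 - (ord_int i)%:~R * a).
have h4 := ler_normB x0 ((ord_int i)%:~R * a).
have h5 : x0 + j%:~R * T - (ord_int i)%:~R * a - (x0 - (ord_int i)%:~R * a) = j%:~R * T by ring.
rewrite h5 in h3; have h6 := offdiag; lra.
Qed.

End DualWindow.

(** * The parameter region *)

Section WindowParameters.
Context {R : realType}.

(** For m = m0 + 1 the lower bound on b puts the diagonal arguments of the duality
    matrix inside the support of the window, and the upper bound puts all arguments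
    of the conditions of index beyond m0 outside of it. *)
Lemma T_regionP (a b N : R) (m0 : nat) : 0 < N -> (1 <= m0)%N -> T_region N m0.+1 (a, b) ->
  [/\ a < N / 2, N / 2 < b^-1, m0%:R * (b^-1 - a) + a / 2 < N / 2 &
      N / 2 <= (m0%:R + 1) * b^-1 - m0%:R * a - a / 2].
Proof.
move=> N0 m1 /= [a0 b0 /andP[_ aN] /andP[h1 h2] h3].
have T0 : 0 < b^-1 by rewrite invr_gt0.
have n1 : (1 : R) <= m0%:R by rewrite ler1n.
rewrite -(natr1 m0) in h1 h2.
have d1 : 0 < N + (2 * (m0%:R + 1) - 3) * a by rewrite ltr_pwDl// mulr_ge0//; lra.
have d2 : 0 < N + (2 * (m0%:R + 1) - 1) * a by rewrite ltr_pwDl// mulr_ge0//; lra.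
have {}h1 : 2 * (m0%:R + 1 - 1) * b^-1 < N + (2 * (m0%:R + 1) - 3) * a.
  by rewrite -ltr_pdivlMr// invrK (mulrC _ b) -ltr_pdivrMr.
have {}h2 : N + (2 * (m0%:R + 1) - 1) * a <= 2 * (m0%:R + 1) * b^-1.
  by rewrite -ler_pdivrMr// invrK (mulrC _ b) -ler_pdivlMr.
have {}h3 : N < 2 * b^-1.
  by rewrite -ltr_pdivrMr// invrK (mulrC _ b) -ltr_pdivlMr.
move: (b^-1) T0 h1 h2 h3 => T T0 h1 h2 h3.
by split; [exact: aN|lra|nra|nra].
Qed.

End WindowParameters.

(** * Existence and uniqueness of the dual window *)

Section WindowTheorem.
Context {R : realType}.
Variables (N a b : R) (g : R -> R) (m0 : nat).
Local Notation T := (b^-1).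
Local Notation mu := (@lebesgue_measure R).
Hypotheses (N0 : 0 < N) (hg : V_window N a g) (a0 : 0 < a) (b0 : 0 < b).
Hypotheses (aN : a < N / 2) (TN : N / 2 < T).
Hypothesis diag : m0%:R * (T - a) + a / 2 < N / 2.
Hypothesis offdiag : N / 2 <= (m0%:R + 1) * T - m0%:R * a - a / 2.

Local Notation gC := (fun x => (g x)%:C : R[i]).
Local Notation hC := (fun x => (dual_fun a b g m0 x)%:C : R[i]).
Local Notation c := ((m0%:R + 2^-1) * a).
Local Notation C := (N / 2 + c).

Let c0 : 0 <= c. Proof. by rewrite mulr_ge0 ?addr_ge0// ltW. Qed.

Let mg : cmeas gC.
Proof. by apply: cmeas_real; apply: continuous_measurable_fun; exact: (window_continuous hg). Qed.

Let gM x : sqn (gC x) <= g 0 ^+ 2.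
Proof.
rewrite sqn_real ler_pXn2r ?nnegrE//; first exact: (window_le N0 hg).
  exact: (window_ge0 hg).
exact: (window_ge0 hg).
Qed.

Let gout x : C < `|x| -> gC x = 0.
Proof. by move=> /ltW Cx; rewrite (window_out hg)// (le_trans _ Cx)// lerDl. Qed.

Let mh : cmeas hC.
Proof. by apply: cmeas_real; exact: (measurable_dual_fun N0 hg a0 b0 aN TN diag). Qed.

Let hout x : c < `|x| -> hC x = 0.
Proof. by move=> /(dual_fun_supp b g a0) ->. Qed.

Let hout' x : C < `|x| -> hC x = 0.
Proof. by move=> Cx; apply: hout; apply: le_lt_trans Cx; rewrite lerDr divr_ge0// ltW. Qed.

Lemma window_dual_frames : is_frame (gabor gC a b) /\ dual_window gC a b hC.
Proof.
have [B hB] := dual_fun_bounded N0 hg a0 b0 aN TN diag.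
have hM x : sqn (hC x) <= B ^+ 2.
  rewrite sqn_real -[leLHS]real_normK ?num_real//.
  by rewrite ler_pXn2r ?nnegrE// (le_trans _ (hB 0)).
apply: (duality_dual_frames a0 b0 mg mh gM hM gout hout') => [x|].
  exact: (duality_dual_fun N0 hg a0 b0 aN TN diag offdiag).
exact: ltW (lt_trans aN TN).
Qed.

Lemma dual_window_supp : ess_supp hC `<=` `[- c, c]%classic.
Proof.
move=> x; apply: contra_notP => xc /=.
exists (~` `[- c, c]%classic).
  by apply: open_nbhs_nbhs; split; [apply: closed_openC; exact: interval_closed|].
apply: aeW => y yc; apply: hout; rewrite ltNge ler_norml; apply/negP => h; apply: yc.
by rewrite /= in_itv /=.
Qed.

(** A dual window with essential support in [-c, c] satisfies the duality
    conditions almost everywhere, and these have only one solution. *)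
Lemma dual_window_unique h' : dual_window gC a b h' -> ess_supp h' `<=` `[- c, c]%classic ->
  {ae mu, forall x, h' x = hC x}.
Proof.
move=> [lh' [_ _ exp]] supp.
have lg := L2_window mg gM gout.
(* The endpoint c is dropped so that, for x in D, only the translates x - k a with
   |k| <= m0 lie in I. *)
pose I : set R := `[- c, c[%classic.
have mI : measurable I by exact: measurable_itv.
pose h1 x := h' x * cind I x.
have h1I x : ~ I x -> h1 x = 0 by move=> Ix; rewrite /h1 cind_out// mulr0.
have lh1 : L2 h1 by exact: L2_mul_cind.
have h'1 : {ae mu, forall x, h' x = h1 x}.
  apply: ae_sub (ae_and (ess_supp_ae supp) (ae_neq c)) => x [hx xc].
  rewrite /h1; have [Ix|Ix] := pselect (I x); first by rewrite cind_in// mulr1.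
  rewrite cind_out// mulr0 hx// => /=; rewrite in_itv /= => /andP[x1 x2].
  by apply: Ix; rewrite /I /= in_itv /= x1 /= lt_neqAle x2 andbT; apply/eqP.
have W f v : L2 f -> L2 v ->
    has_sum (fun i => inner f (gabor h1 a b i) * (inner v (gabor gC a b i))^*) (inner f v).
  move=> lf lv; have := L2_expansion_weak (fun i => L2_gabor a b i lg) lf lv (exp f lf).1.
  apply: has_sum_ext => -[l k]; congr (_ * _); rewrite !innerE.
  apply: cint_ae; try by apply: cmeasM; [exact: L2_cmeas|apply: cmeas_conj; apply: L2_cmeas; exact: L2_gabor].
  by apply: ae_sub (ae_shift (- (k%:~R * a)) h'1) => x hx; rewrite !gaborE hx.
have h1out x : C < `|x| -> h1 x = 0.
  move=> Cx; apply: h1I; rewrite /I /= in_itv /= => /andP[x1 x2].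
  have : `|x| <= c by rewrite ler_norml x1 ltW.
  by apply/negP; rewrite -ltNge; apply: le_lt_trans Cx; rewrite lerDr divr_ge0// ltW.
have D1 := duality_ae_cell a0 b0 (- (a / 2)) mg gM gout h1out lh1 W.
pose D : set R := `[- (a / 2), a / 2[%classic.
have h1D (k : int) x : D x -> k \notin irange m0 -> h1 (x - k%:~R * a) = 0.
  rewrite /D /= in_itv /= => /andP[x1 x2] kI; apply: h1I.
  rewrite /I /= in_itv /= => /andP[x3 x4].
  have h5 : k%:~R * a < (m0%:R + 1) * a by lra.
  have h6 : (- k)%:~R * a < (m0%:R + 1) * a by rewrite mulrNz mulNr; lra.
  rewrite ltr_pM2r// -[m0%:R]/(m0%:Z%:~R) -intrD1 ltr_int in h5.
  rewrite ltr_pM2r// -[m0%:R]/(m0%:Z%:~R) -intrD1 ltr_int in h6.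
  by move: kI; rewrite mem_irange_le ler_norml -lerN2 opprK -!ltzD1 h5 h6.
have D2 : {ae mu, forall x, D x -> forall k : int, h1 (x - k%:~R * a) = hC (x - k%:~R * a)}.
  apply: ae_sub D1 => x dx Dx.
  apply: (@duality_unique _ _ _ _ _ _ N0 hg a0 b0 aN TN diag h1 hC x Dx).
  - by move=> k; exact: h1D.
  - by move=> k kI; rewrite (dual_fun_out b g a0 Dx kI).
  - apply: dx; move: Dx; rewrite /D /= !in_itv /= => /andP[-> x2] /=.
    have := lt_trans aN TN; lra.
  - exact: (duality_dual_fun N0 hg a0 b0 aN TN diag offdiag).
have D3 : {ae mu, forall x, forall k : int, D (x - k%:~R * a) -> h1 x = hC x}.
  apply: ae_forall_countable => k.
  apply: ae_sub (ae_shift (- (k%:~R * a)) D2) => x hx Dx.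
  by have := hx Dx (- k); rewrite mulrNz mulNr opprK subrK.
apply: ae_sub (ae_and h'1 D3) => x [-> hx].
by have [k Dk] := D_index a0 x; exact: hx Dk.
Qed.

End WindowTheorem.

Theorem theorem1 (R : realType) (a N : R) (ha : 0 < a) (hN : 2 <= N)
    (g : R -> R) (hg : V_window N a g)
    (m : nat) (hm : (3 <= m)%N) (b : R) (hb : 0 < b) (hab : T_region N m (a, b)) :
  let gC : R -> R[i] := fun x => (g x)%:C in
  let c : R := (2 * m%:R - 1) / 2 * a in
  is_frame (gabor gC a b) /\
  exists h : R -> R[i],
    [/\ dual_window gC a b h,
        ess_supp h `<=` `[- c, c]%classic &
        forall h' : R -> R[i],
          dual_window gC a b h' -> ess_supp h' `<=` `[- c, c]%classic ->
          h' = h %[ae (@lebesgue_measure R)]].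
Proof.
move=> gC c; case: m hm hab @c => // m0 hm0 hab c.
have N0 : 0 < N by exact: lt_le_trans hN.
have [aN TN diag offdiag] := T_regionP N0 (ltnW hm0) hab.
have -> : c = (m0%:R + 2^-1) * a by rewrite /c -(natr1 m0); field.
have [frame dual] := window_dual_frames N0 hg ha hb aN TN diag offdiag.
split=> //; exists (fun x => (dual_fun a b g m0 x)%:C); split=> //.
  exact: dual_window_supp.
by move=> h' dh' supp; apply: ae_sub (dual_window_unique N0 hg ha hb aN TN diag offdiag dh' supp) => x ->.
Qed.
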